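(* Let $t\in\mathbb{Q}$ with $t\neq1$ and $t\neq2$. Let $K_t\subset\overline{\mathbb{Q}}$ be the splitting field of $f_t$, let $\alpha\in K_t$ be a root of $f_t$, and put $\beta=\sum_{i=0}^5 a_i\alpha^i$. Then: (1) $f_t$ is irreducible over $\mathbb{Q}$. (2) The set of the six roots of $f_t$ in $K_t$ is $\{\alpha,\beta,\beta/\alpha,1/\alpha,1/\beta,\alpha/\beta\}$. In particular $K_t=\mathbb{Q}(\alpha)$, the extension $\mathbb{Q}(\alpha)/\mathbb{Q}$ is Galois of degree $6$, and its Galois group is isomorphic to $\mathfrak{S}_3$. (3) The points $[\alpha,\beta,1]$, $[1/\alpha,\beta/\alpha,1]$, $[1/\beta,\alpha/\beta,1]$, together with the three points obtained by swapping their first two coordinates, belong to $F_5(K_t)$; these six points are pairwise distinct and nontrivial (all coordinates nonzero). This set of six points is the $\mathrm{Gal}(K_t/\mathbb{Q})$-orbit of each of them, and also the $\mathfrak{S}_3$-orbit of each of them, where $\mathfrak{S}_3$ acts on $\mathbb{P}^2$ by permuting the coordinates.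
   Context: $F_5$ is the Fermat curve $x^5+y^5+z^5=0$ in $\mathbb{P}^2$; a point $[x,y,z]$ of it is nontrivial if $xyz\ne0$. For $t\in\mathbb{Q}$, $t\neq2$, put $u=\frac{3t^2-2t+2}{t^2+t-1}$, $v=\frac{t^5-5t^4+10t^3-20t^2+15t-7}{(t-2)(t^2+t-1)^2}$, $w=\frac{-3t^5+10t^4-20t^3+20t^2-20t+6}{(t-2)(t^2+t-1)^2}$, and $f_t=X^6+uX^5+vX^4+wX^3+vX^2+uX+1\in\mathbb{Q}[X]$. Put $s=(t^4-3t^3-t^2+3t+1)(t-2)$ (nonzero for rational $t\ne2$) and $a_0=-\frac{(t^2+1)(t^3-t^2+2t-3)}{s}$, $a_1=-\frac{3t^7-9t^6+16t^5-15t^4+10t^3-11t^2+8t-7}{(t^2+t-1)s}$, $a_2=\frac{2t^8-14t^7+52t^6-99t^5+100t^4-54t^3+38t^2-44t+13}{(t^2+t-1)(t-2)s}$, $a_3=\frac{t^8+t^7-21t^6+65t^5-90t^4+78t^3-57t^2+32t-15}{(t^2+t-1)(t-2)s}$, $a_4=-\frac{2t^5-6t^4+13t^3-14t^2+7t-5}{s}$, $a_5=-\frac{(t^2+t-1)(t^3-t^2+2t-3)}{s}$. *)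

(* Defs.v *)
From HB Require Import structures.
From mathcomp Require Import all_boot all_order all_algebra all_fingroup all_field.
Set Implicit Arguments. Unset Strict Implicit. Unset Printing Implicit Defensive.
Import GRing.Theory Num.Theory.
Local Open Scope ring_scope.

Definition u_t (t : rat) : rat := (3*t^+2 - 2*t + 2) / (t^+2 + t - 1).
Definition v_t (t : rat) : rat :=
  (t^+5 - 5*t^+4 + 10*t^+3 - 20*t^+2 + 15*t - 7) / ((t - 2) * (t^+2 + t - 1)^+2).
Definition w_t (t : rat) : rat :=
  (-3*t^+5 + 10*t^+4 - 20*t^+3 + 20*t^+2 - 20*t + 6) / ((t - 2) * (t^+2 + t - 1)^+2).

Definition f_t (t : rat) : {poly rat} :=
  Poly [:: 1; u_t t; v_t t; w_t t; v_t t; u_t t; 1].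

Definition s_t (t : rat) : rat := (t^+4 - 3*t^+3 - t^+2 + 3*t + 1) * (t - 2).

Definition a_t (t : rat) (i : nat) : rat :=
  let s := s_t t in
  let q := t^+2 + t - 1 in
  match i with
  | 0 => - ((t^+2 + 1) * (t^+3 - t^+2 + 2*t - 3)) / s
  | 1 => - (3*t^+7 - 9*t^+6 + 16*t^+5 - 15*t^+4 + 10*t^+3 - 11*t^+2 + 8*t - 7) / (q * s)
  | 2 => (2*t^+8 - 14*t^+7 + 52*t^+6 - 99*t^+5 + 100*t^+4 - 54*t^+3 + 38*t^+2 - 44*t + 13)
           / (q * (t - 2) * s)
  | 3 => (t^+8 + t^+7 - 21*t^+6 + 65*t^+5 - 90*t^+4 + 78*t^+3 - 57*t^+2 + 32*t - 15)
           / (q * (t - 2) * s)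
  | 4 => - (2*t^+5 - 6*t^+4 + 13*t^+3 - 14*t^+2 + 7*t - 5) / s
  | 5 => - (q * (t^+3 - t^+2 + 2*t - 3)) / s
  | _ => 0
  end.

Section Pts.
Variable L : fieldExtType rat.

Definition beta_of (t : rat) (alpha : L) : L :=
  \sum_(i < 6) (a_t t i)%:A * alpha ^+ i.

(* homogeneous coordinates of a point of P^2(L) *)
Definition pt3 (x y z : L) : 'rV[L]_3 := \row_(i < 3) [:: x; y; z]`_i.

Definition projeq (P Q : 'rV[L]_3) : Prop := exists2 c : L, c != 0 & P = c *: Q.

Definition nontrivial (P : 'rV[L]_3) : Prop := forall i, P 0 i != 0.

Definition onF5 (P : 'rV[L]_3) : Prop := P 0 0 ^+ 5 + P 0 1 ^+ 5 + P 0 2 ^+ 5 = 0.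

Definition perm_pt (s : 'S_3) (P : 'rV[L]_3) : 'rV[L]_3 := \row_j P 0 (s j).

Definition six_pts (a b : L) : seq 'rV[L]_3 :=
  [:: pt3 a b 1; pt3 b a 1;
      pt3 (1/a) (b/a) 1; pt3 (b/a) (1/a) 1;
      pt3 (1/b) (a/b) 1; pt3 (a/b) (1/b) 1].
End Pts.

Definition gal_pt (L : splittingFieldType rat) (E : {subfield L}) (g : gal_of E)
  (P : 'rV[L]_3) : 'rV[L]_3 := map_mx (fun x => g x) P.

(* Main.v *)
Require Import Defs.
From HB Require Import structures.
From mathcomp Require Import all_boot all_order all_algebra all_fingroup all_field.
From mathcomp Require Import ring lra zify.
From Stdlib Require Import ClassicalEpsilon Classical.
Set Implicit Arguments. Unset Strict Implicit. Unset Printing Implicit Defensive.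
Import Order.TTheory GRing.Theory Num.Theory.
Local Open Scope ring_scope.

(* Let [x, y, z] be the point [alpha, beta, 1] scaled so that x + y + z = 1.  For a root
   alpha of f_t, the numbers x, y, z are the roots of a rational cubic
   X^3 - X^2 + e X - c with e = 1 / (2 - t) and 5 (e - 1) c = 5 e^2 - 5 e + 1 (the last
   relation is x^5 + y^5 + z^5 = 0), and the roots of f_t are the six ratios of x, y, z.
   So the theorem holds as soon as this cubic has Galois group S_3, that is, has no rational
   root and a discriminant that is not a square.  A rational root gives a rational point
   with S <> 1 on 5 Z^2 = 1 + 4 S^5, a square discriminant gives a rational point on
   Y^2 = - 100 e^5 + 200 e^3 - 180 e^2 + 60 e - 7; neither exists.

   Both facts come from a descent over Q(zeta), zeta^5 = 1, on the Jacobian of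
   V (1 - V) = U^5.  An unordered pair of points (U1, V1), (U2, V2) is encoded by
   N = V1 V2, M = (1 - V1) (1 - V2), P = U1 U2, T = U1 + U2.  All valuations of N are
   divisible by 5; as Z[zeta] is Euclidean with units +-zeta^i phi^j, N and M are fifth
   powers g^5, e^5 whenever N / M = 1 modulo pi^3, where pi = 1 - zeta.  The class is then
   divisible by 1 - zeta, and explicit formulas give the quotient as a new quadruple
   (N, M, P, T).  At each step the valuation of g / e - 1 at pi drops by 1 or by 5
   (depending on the integrality of the point), which cannot go on forever. *)

(** * The field Q(zeta) *)

(** The only global input of the descent is [fifth_root_lift]; the rest is local, for a valuation
    with v(5) = 4 and residue field F_5. The modulus pi^3 is dictated by the units: zeta = 1 - pi is
    detected modulo pi^2, but phi = -2 (1 + 2 pi^2) only modulo pi^3. Fifth roots g, e can then be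
    chosen with g / e = 1 modulo pi^2, the range where taking fifth powers adds exactly 4 to the
    valuation of the ratio minus 1. One division by 1 - zeta adds 3 to this valuation in the
    integral case and removes 1 in the other; the roots cost 4, whence the drops of 1 and 5, and the
    bound 2 has to hold again after each step. In the last integral step leading terms can cancel
    when g has residue 1, so the residue of g is tracked along with the valuation. The value t = 1
    would give e = 1, where the relation for c has no solution. The coefficients of beta come from
    writing alpha + beta + 1 as a rational function of alpha. *)

(* [Cyc5 a b c d] is a + b z + c z^2 + d z^3. *)
Record cyc5 := Cyc5 { cf0 : rat; cf1 : rat; cf2 : rat; cf3 : rat }.

Definition tup_of_cyc5 (x : cyc5) := (cf0 x, cf1 x, cf2 x, cf3 x).
Definition cyc5_of_tup (x : rat * rat * rat * rat) :=
  let: (a, b, c, d) := x in Cyc5 a b c d.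
Lemma tup_of_cyc5K : cancel tup_of_cyc5 cyc5_of_tup.
Proof. by case. Qed.
HB.instance Definition _ := Choice.copy cyc5 (can_type tup_of_cyc5K).

Lemma cyc5P (x y : cyc5) :
  cf0 x = cf0 y -> cf1 x = cf1 y -> cf2 x = cf2 y -> cf3 x = cf3 y -> x = y.
Proof. by case: x y => a b c d [a' b' c' d'] /= -> -> -> ->. Qed.

Definition add5 (x y : cyc5) :=
  Cyc5 (cf0 x + cf0 y) (cf1 x + cf1 y) (cf2 x + cf2 y) (cf3 x + cf3 y).
Definition opp5 (x : cyc5) := Cyc5 (- cf0 x) (- cf1 x) (- cf2 x) (- cf3 x).
Definition zero5 := Cyc5 0 0 0 0.

Lemma add5A : associative add5.
Proof. by move=> x y z; apply: cyc5P => /=; ring. Qed.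
Lemma add5C : commutative add5.
Proof. by move=> x y; apply: cyc5P => /=; ring. Qed.
Lemma add05 : left_id zero5 add5.
Proof. by move=> x; apply: cyc5P => /=; ring. Qed.
Lemma addN5 : left_inverse zero5 opp5 add5.
Proof. by move=> x; apply: cyc5P => /=; ring. Qed.
HB.instance Definition _ := GRing.isZmodule.Build cyc5 add5A add5C add05 addN5.

(* Product reduced with z^4 = - 1 - z - z^2 - z^3 and z^5 = 1. *)
Definition mul5 (x y : cyc5) :=
  let: Cyc5 a0 a1 a2 a3 := x in let: Cyc5 b0 b1 b2 b3 := y in
  let c4 := a1 * b3 + a2 * b2 + a3 * b1 in
  Cyc5 (a0 * b0 + (a2 * b3 + a3 * b2) - c4)
       (a0 * b1 + a1 * b0 + a3 * b3 - c4)
       (a0 * b2 + a1 * b1 + a2 * b0 - c4)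
       (a0 * b3 + a1 * b2 + a2 * b1 + a3 * b0 - c4).
Definition one5 := Cyc5 1 0 0 0.

Lemma mul5A : associative mul5.
Proof. by move=> [????] [????] [????]; apply: cyc5P => /=; ring. Qed.
Lemma mul5C : commutative mul5.
Proof. by move=> [????] [????]; apply: cyc5P => /=; ring. Qed.
Lemma mul15 : left_id one5 mul5.
Proof. by move=> [????]; apply: cyc5P => /=; ring. Qed.
Lemma mul5Dl : left_distributive mul5 add5.
Proof. by move=> [????] [????] [????]; apply: cyc5P => /=; ring. Qed.
Lemma one5_neq0 : one5 != 0.
Proof. by apply/eqP => - []. Qed.
HB.instance Definition _ :=
  GRing.Zmodule_isComNzRing.Build cyc5 mul5A mul5C mul15 mul5Dl one5_neq0.

(* z |-> z^2 *)
Definition tau5 (x : cyc5) :=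
  Cyc5 (cf0 x - cf2 x) (cf3 x - cf2 x) (cf1 x - cf2 x) (- cf2 x).
Lemma tau5M x y : tau5 (x * y) = tau5 x * tau5 y.
Proof. by case: x y => ???? [????]; apply: cyc5P => /=; ring. Qed.
Definition rat5 (q : rat) := Cyc5 q 0 0 0.

Definition nm5 (x : cyc5) : rat :=
  cf0 (x * tau5 x * (tau5 (tau5 x) * tau5 (tau5 (tau5 x)))).

Lemma nm5E x : x * tau5 x * (tau5 (tau5 x) * tau5 (tau5 (tau5 x))) = rat5 (nm5 x).
Proof. by case: x => ????; apply: cyc5P => //=; ring. Qed.

Lemma rat_sqr_neq5 (q : rat) : q ^+ 2 != 5.
Proof.
apply/eqP => h.
have dn0 : (denq q)%:~R != 0 :> rat by rewrite intr_eq0 denq_neq0.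
have e : numq q * numq q = 5 * (denq q * denq q).
  apply/eqP; rewrite -(eqr_int rat) !intrM; apply/eqP.
  have -> : (numq q)%:~R = q * (denq q)%:~R :> rat.
    by rewrite -{2}(divq_num_den q) mulfVK.
  by transitivity (q ^+ 2 * ((denq q)%:~R * (denq q)%:~R)); [ring | rewrite h].
have n0 : numq q != 0.
  apply/eqP => n0; move: e; rewrite n0 mul0r => /esym/eqP.
  by rewrite mulf_eq0 mulf_eq0 /= (negPf (denq_neq0 q)).
have {}e : (`|numq q| ^ 2 = 5 * `|denq q| ^ 2)%N.
  by rewrite -!mulnn -abszM e !abszM.
have : logn 5 (`|numq q| ^ 2) = logn 5 (5 * `|denq q| ^ 2) by rewrite e.
rewrite lognM ?expn_gt0 ?absz_gt0 ?denq_neq0 // !lognX (_ : logn 5 5 = 1%N) //.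
by lia.
Qed.

(** [nmu x] and [nmv x] are the coordinates of x times its complex conjugate in the basis 1, z + 1/z
    of Q(sqrt 5). Thus [2 * nmu x - nmv x] is a trace and [nm5_quad] computes a norm from Q(sqrt
    5). *)
Definition nmu (x : cyc5) : rat :=
  let: Cyc5 a b c d := x in
  a ^+ 2 + b ^+ 2 + c ^+ 2 + d ^+ 2 - (a * c + b * d + a * d).
Definition nmv (x : cyc5) : rat :=
  let: Cyc5 a b c d := x in
  (a * b + b * c + c * d) - (a * c + b * d + a * d).

Lemma nm5_quad x : 4 * nm5 x = (2 * nmu x - nmv x) ^+ 2 - 5 * nmv x ^+ 2.
Proof. by case: x => a b c d; rewrite /nm5 /=; ring. Qed.

(** With a fifth coordinate 0 at z^4, the trace form is half the sum of the squared differences of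
    the five coordinates; in particular it is positive definite. *)
Lemma nmtrE x : 2 * nmu x - nmv x =
  let: Cyc5 a b c d := x in
  ((a - b) ^+ 2 + (a - c) ^+ 2 + (a - d) ^+ 2 + (b - c) ^+ 2 + (b - d) ^+ 2 +
   (c - d) ^+ 2 + a ^+ 2 + b ^+ 2 + c ^+ 2 + d ^+ 2) / 2.
Proof. by case: x => a b c d /=; field. Qed.

Lemma nmtr_eq0 x : 2 * nmu x - nmv x = 0 -> x = 0.
Proof.
rewrite nmtrE; case: x => a b c d h.
have H y : 0 <= y ^+ 2 :> rat := sqr_ge0 y.
have := H (a - b); have := H (a - c); have := H (a - d).
have := H (b - c); have := H (b - d); have := H (c - d).
have := H a; have := H b; have := H c; have := H d.
move: ((a - b) ^+ 2) ((a - c) ^+ 2) ((a - d) ^+ 2) ((b - c) ^+ 2) ((b - d) ^+ 2)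
  ((c - d) ^+ 2) h => ?????? h *.
have S y : y ^+ 2 = 0 -> y = 0 :> rat by move/eqP; rewrite sqrf_eq0 => /eqP.
by congr Cyc5; apply: S; lra.
Qed.

(** If [nmv x] is not 0, 5 would be a rational square; otherwise the definite trace form vanishes at
    x. *)
Lemma nm5_eq0 x : nm5 x = 0 -> x = 0.
Proof.
move=> n0; apply: nmtr_eq0; have := nm5_quad x; rewrite n0 mulr0 => /esym/eqP.
rewrite subr_eq0 => /eqP e; case: (eqVneq (nmv x) 0) => [v0|v0].
  by apply/eqP; rewrite -sqrf_eq0 e v0 expr0n mulr0.
case/negP: (rat_sqr_neq5 ((2 * nmu x - nmv x) / nmv x)).
by rewrite expr_div_n e mulfK // sqrf_eq0.
Qed.

Lemma nm5M x y : nm5 (x * y) = nm5 x * nm5 y.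
Proof.
have R a b : rat5 (a * b) = rat5 a * rat5 b.
  by apply: cyc5P => /=; rewrite ?mul0r ?mulr0 ?addr0 ?subr0.
have : rat5 (nm5 (x * y)) = rat5 (nm5 x * nm5 y).
  by rewrite R -!nm5E !tau5M; ring.
by case.
Qed.

Definition inv5 (x : cyc5) : cyc5 :=
  tau5 x * (tau5 (tau5 x) * tau5 (tau5 (tau5 x))) * rat5 (nm5 x)^-1.

Lemma mul5V x : x != 0 -> inv5 x * x = 1.
Proof.
move=> x0; have nx0 : nm5 x != 0 by apply: contraNneq x0 => /nm5_eq0 ->.
rewrite /inv5 mulrC !mulrA (_ : x * _ * _ * _ = rat5 (nm5 x)); last first.
  by rewrite -nm5E !mulrA.
by apply: cyc5P; rewrite /= ?mulfV // ?mul0r ?mulr0 ?addr0 ?subr0.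
Qed.

Lemma inv5_0 : inv5 0 = 0.
Proof. by rewrite /inv5 (_ : tau5 0 = 0) ?mul0r //; apply: cyc5P => /=; ring. Qed.

HB.instance Definition _ := GRing.ComNzRing_isField.Build cyc5 mul5V inv5_0.

Lemma rat5_is_zmod_morphism : zmod_morphism rat5.
Proof. by move=> a b; apply: cyc5P => /=; rewrite ?subrr. Qed.
Lemma rat5_is_monoid_morphism : monoid_morphism rat5.
Proof.
by split=> [|a b]; apply: cyc5P => //=; rewrite ?mul0r ?mulr0 ?addr0 ?subr0.
Qed.
HB.instance Definition _ := GRing.isZmodMorphism.Build rat cyc5 rat5 rat5_is_zmod_morphism.
HB.instance Definition _ := GRing.isMonoidMorphism.Build rat cyc5 rat5 rat5_is_monoid_morphism.

Definition z5 := Cyc5 0 1 0 0.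
Lemma z5_sum : 1 + z5 + z5 ^+ 2 + z5 ^+ 3 + z5 ^+ 4 = 0.
Proof. by apply: cyc5P. Qed.
Lemma z5_5 : z5 ^+ 5 = 1.
Proof. by apply: cyc5P. Qed.

(** * The Euclidean ring Z[zeta] *)

Definition O5 : {pred cyc5} := [pred x | [&& cf0 x \is a Num.int, cf1 x \is a Num.int,
  cf2 x \is a Num.int & cf3 x \is a Num.int]].

Lemma O5P x : reflect [/\ cf0 x \is a Num.int, cf1 x \is a Num.int,
  cf2 x \is a Num.int & cf3 x \is a Num.int] (x \in O5).
Proof. exact: and4P. Qed.

Lemma O5_subring : subring_closed O5.
Proof.
have r0 : (0 : rat) \is a Num.int := rpred0 _.
have r1 : (1 : rat) \is a Num.int := rpred1 _.
split=> [|[a b c d] [a1 b1 c1 d1] /O5P[/= ? ? ? ?] /O5P[/= ? ? ? ?]|[a b c d] [a1 b1 c1 d1] /O5P[/= ? ? ? ?] /O5P[/= ? ? ? ?]].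
- by apply/O5P; split.
- by apply/O5P; split; rewrite /= ?rpredB ?rpredD ?rpredN.
by apply/O5P; split; rewrite /= !(rpredB, rpredD, rpredN, rpredM).
Qed.
HB.instance Definition _ := GRing.isSubringClosed.Build cyc5 O5 O5_subring.

Lemma O5_z : z5 \in O5. Proof. by apply/O5P; split=> /=; rewrite ?rpred0 ?rpred1. Qed.
Lemma O5_rat q : (rat5 q \in O5) = (q \is a Num.int).
Proof. by apply/idP/idP => [/O5P[]|h] //; apply/O5P; split=> //=; rewrite rpred0. Qed.
Lemma tau5_O5 x : x \in O5 -> tau5 x \in O5.
Proof. by case/O5P => ????; apply/O5P; split; rewrite /= ?rpredN ?rpredB. Qed.

(* Coordinates of p + q s + (e + f s) (z - z^-1), where s = 1 + 2 (z + z^-1). *)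
Lemma nm5_sos p q e f :
  nm5 (Cyc5 (p - q + e + f) (2 * (e + f)) (e + 3 * f - 2 * q) (e - f - 2 * q)) =
  (p ^+ 2 - 5 * q ^+ 2) ^+ 2 + 5 * (e ^+ 2 - 5 * f ^+ 2) ^+ 2 +
  5 * (p * e - 5 * q * f + (p * f - q * e)) ^+ 2 + 20 * (p * f - q * e) ^+ 2.
Proof. by rewrite /nm5 /=; ring. Qed.

Lemma nm5_ge0 x : 0 <= nm5 x.
Proof.
case: x => a b c d; pose f := (c - d) / 4; pose e := b / 2 - f.
pose q := (e - f - d) / 2; pose p := a + q - e - f.
have -> : Cyc5 a b c d = Cyc5 (p - q + e + f) (2 * (e + f)) (e + 3 * f - 2 * q) (e - f - 2 * q).
  by congr Cyc5; rewrite /p /q /e /f; field.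
rewrite nm5_sos; have H (k : nat) (w : rat) : 0 <= k%:R * w ^+ 2.
  by rewrite mulr_ge0 ?ler0n ?sqr_ge0.
by apply: addr_ge0 (H 20%N _); apply: addr_ge0 (H 5%N _); apply: addr_ge0 (H 5%N _); apply: sqr_ge0.
Qed.

Lemma nm5_gt0 x : x != 0 -> 0 < nm5 x.
Proof. by move=> x0; rewrite lt0r nm5_ge0 andbT; apply: contraNneq x0 => /nm5_eq0 ->. Qed.

Lemma nm5_1 : nm5 1 = 1. Proof. by []. Qed.

Lemma nm5_nat x : x \in O5 -> exists n : nat, nm5 x = n%:R.
Proof.
move=> xO; apply/natrP; rewrite natrEint nm5_ge0 andbT -O5_rat -nm5E.
by rewrite !rpredM ?tau5_O5.
Qed.

Lemma nm5_unit x : x \in O5 -> nm5 x = 1 -> x^-1 \in O5.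
Proof.
move=> xO n1; rewrite (_ : x^-1 = inv5 x) // /inv5 n1 invr1 rpredM ?O5_rat //.
by rewrite !rpredM ?tau5_O5.
Qed.

Lemma nm5_nonunit x : x \in O5 -> x != 0 -> x^-1 \notin O5 -> 1 < nm5 x.
Proof.
move=> xO x0 xV; have [n e] := nm5_nat xO.
have := nm5_gt0 x0; have : nm5 x != 1 by apply: contraNneq xV; apply: nm5_unit.
by rewrite e ltr0n ltr1n (eqr_nat _ n 1); lia.
Qed.

(* Four points miss one of the five arcs of length 1/5, so that up to integer
   translations all of them and 0 lie in an interval of length 4/5. *)
Lemma euclid5 x : exists2 y, y \in O5 & nm5 (x - y) < 1.
Proof.
have fl (a : rat) : exists i n : int, [/\ 0 <= i, i <= 4,
    i%:~R <= 5 * (a - n%:~R) & 5 * (a - n%:~R) < i%:~R + 1].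
  exists (Num.floor (5 * (a - (Num.floor a)%:~R))), (Num.floor a).
  have h1 := floor_le a; have h2 := floorD1_gt a.
  have h3 := floor_le (5 * (a - (Num.floor a)%:~R)).
  have h4 := floorD1_gt (5 * (a - (Num.floor a)%:~R)).
  rewrite !intrD in h2 h4; split=> //.
    by rewrite floor_ge_int; lra.
  by rewrite -ltzD1 floor_lt_int; lra.
case: x => a b c d.
have [i1 [n1 [a1 b1 l1 u1]]] := fl a; have [i2 [n2 [a2 b2 l2 u2]]] := fl b.
have [i3 [n3 [a3 b3 l3 u3]]] := fl c; have [i4 [n4 [a4 b4 l4 u4]]] := fl d.
have [k [k0 k4] [kn1 kn2 kn3 kn4]] : exists2 k : int, 0 <= k /\ k <= 4 &
    [/\ k != i1, k != i2, k != i3 & k != i4].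
  have : [|| [&& 0 != i1, 0 != i2, 0 != i3 & 0 != i4], [&& 1 != i1, 1 != i2, 1 != i3 & 1 != i4],
    [&& 2 != i1, 2 != i2, 2 != i3 & 2 != i4], [&& 3 != i1, 3 != i2, 3 != i3 & 3 != i4] |
    [&& 4 != i1, 4 != i2, 4 != i3 & 4 != i4]] by lia.
  by case/or4P => [/and4P[]|/and4P[]|/and4P[]|/orP[]/and4P[]] *;
    [exists 0|exists 1|exists 2|exists 3|exists 4]; split.
pose m : rat := (k%:~R + 1) / 5 - 1.
have kb0 : 0 <= k%:~R :> rat by rewrite ler0z.
have kb4 : k%:~R <= 4%:~R :> rat by rewrite ler_int.
have {}kb4 : k%:~R <= 4 :> rat := kb4.
have rnd (t : rat) i n : k != i -> i%:~R <= 5 * (t - n%:~R) -> 5 * (t - n%:~R) < i%:~R + 1 ->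
    0 <= i -> i <= 4 -> exists n' : int, 0 <= t - n'%:~R - m < 4 / 5.
  move=> ki li ui j0 j4; case: (ltrP i k) => ik.
    have : (i + 1)%:~R <= k%:~R :> rat by rewrite ler_int lezD1.
    rewrite intrD.
    have : 0 <= i%:~R :> rat by rewrite ler0z.
    by exists n; rewrite /m; lra.
  have : (k + 1)%:~R <= i%:~R :> rat by rewrite ler_int lezD1 lt_neqAle ki.
  rewrite intrD.
  have ib4 : i%:~R <= 4%:~R :> rat by rewrite ler_int.
  have {}ib4 : i%:~R <= 4 :> rat := ib4.
  by exists (n + 1); rewrite intrD /m; lra.
have [p1 h1] := rnd _ _ _ kn1 l1 u1 a1 b1; have [p2 h2] := rnd _ _ _ kn2 l2 u2 a2 b2.
have [p3 h3] := rnd _ _ _ kn3 l3 u3 a3 b3; have [p4 h4] := rnd _ _ _ kn4 l4 u4 a4 b4.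
exists (Cyc5 p1%:~R p2%:~R p3%:~R p4%:~R); first by apply/O5P; split; rewrite intr_int.
set x := _ - _.
(* By [nm5_quad] a trace smaller than 2 in absolute value gives a norm smaller than 1. *)
have tr : 0 <= 2 * nmu x - nmv x < 2.
  have h0 : 0 <= - m <= 4 / 5 by rewrite /m; lra.
  rewrite nmtrE /x /=.
  move: (a - _) (b - _) (c - _) (d - _) h1 h2 h3 h4 => {x rnd l1 u1 l2 u2 l3 u3 l4 u4} x y z t.
  move: (m) h0 => {m} m.
  move=> h0 h1 h2 h3 h4; pose y0 := - m; pose y1 := x - m; pose y2 := y - m.
  pose y3 := z - m; pose y4 := t - m; pose S := y0 + y1 + y2 + y3 + y4.
  pose q := y0 ^+ 2 + y1 ^+ 2 + y2 ^+ 2 + y3 ^+ 2 + y4 ^+ 2.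
  have -> : (x - y) ^+ 2 + (x - z) ^+ 2 + (x - t) ^+ 2 + (y - z) ^+ 2 + (y - t) ^+ 2 +
    (z - t) ^+ 2 + x ^+ 2 + y ^+ 2 + z ^+ 2 + t ^+ 2 = 5 * q - S ^+ 2.
    by rewrite /q /S /y0 /y1 /y2 /y3 /y4; ring.
  apply/andP; split.
    have -> : 5 * q - S ^+ 2 = (x - y) ^+ 2 + (x - z) ^+ 2 + (x - t) ^+ 2 + (y - z) ^+ 2 +
     (y - t) ^+ 2 + (z - t) ^+ 2 + x ^+ 2 + y ^+ 2 + z ^+ 2 + t ^+ 2.
      by rewrite /q /S /y0 /y1 /y2 /y3 /y4; ring.
    by rewrite divr_ge0 // !addr_ge0 ?sqr_ge0.
  have sq (w : rat) : 0 <= w <= 4 / 5 -> 0 <= w * (4 / 5 - w) by move=> ?; apply: mulr_ge0; lra.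
  have sq0 (w : rat) : 0 <= w < 4 / 5 -> w * (4 / 5 - w) <= 0 -> w <= 0.
    case/andP=> _ w1 h; rewrite leNgt; apply/negP => w0.
    by have := lt_le_trans (mulr_gt0 w0 (etrans (subr_gt0 _ _) w1)) h; rewrite ltxx.
  have s0 := sq y0 h0; have s1 := sq y1 ltac:(rewrite /y1; lra).
  have s2 := sq y2 ltac:(rewrite /y2; lra); have s3 := sq y3 ltac:(rewrite /y3; lra).
  have s4 := sq y4 ltac:(rewrite /y4; lra).
  (* The subtracted terms are nonnegative, so 5 q - S^2 <= 4 S - S^2 <= 4. Equality forces S = 2 and
     every y_i to be 0 or 4/5; as y1, ..., y4 are below 4/5 they vanish, and S <= 4/5. *)
  have qE : q = 4 / 5 * S - (y0 * (4 / 5 - y0) + y1 * (4 / 5 - y1) + y2 * (4 / 5 - y2)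
    + y3 * (4 / 5 - y3) + y4 * (4 / 5 - y4)) by rewrite /q /S; field.
  rewrite ltNge; apply/negP => big.
  have sS : (S - 2) ^+ 2 = S ^+ 2 - 4 * S + 4 by ring.
  have sS0 : 0 <= (S - 2) ^+ 2 := sqr_ge0 _.
  have S2 : S - 2 = 0 by apply/eqP; rewrite -sqrf_eq0; apply/eqP; lra.
  have e1 : y1 <= 0 by apply: (sq0 y1 h1); lra.
  have e2 : y2 <= 0 by apply: (sq0 y2 h2); lra.
  have e3 : y3 <= 0 by apply: (sq0 y3 h3); lra.
  have e4 : y4 <= 0 by apply: (sq0 y4 h4); lra.
  by move: S2; rewrite /S /y0; lra.
have : 4 * nm5 x < 4.
  by rewrite nm5_quad; have := sqr_ge0 (nmv x); case/andP: tr => ??; nra.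
by lra.
Qed.

Lemma nm5_min (P : cyc5 -> Prop) x0 : x0 \in O5 -> x0 != 0 -> P x0 ->
  exists x, [/\ x \in O5, x != 0, P x &
    forall y, y \in O5 -> y != 0 -> P y -> nm5 x <= nm5 y].
Proof.
move=> x0O x0n Px0; have [n e] := nm5_nat x0O.
elim/ltn_ind: n x0 e x0O x0n Px0 => n IH x e xO xn Px.
case: (classic (exists y, [/\ y \in O5, y != 0, P y & nm5 y < nm5 x])).
  case=> y [yO yn Py lt]; have [m em] := nm5_nat yO.
  by apply: (IH m _ y) => //; move: lt; rewrite e em ltr_nat.
move=> h; exists x; split=> // y yO yn Py; rewrite leNgt; apply/negP => lt.
by apply: h; exists y.
Qed.

(** Divisibility of a by q in Z[zeta] is written [a / q \in O5]; [q^-1 \notin O5] says that q is not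
    a unit. *)
Definition prime5 q := [/\ q \in O5, q != 0, q^-1 \notin O5 &
  forall a b, a \in O5 -> b \in O5 -> a * b / q \in O5 -> a / q \in O5 \/ b / q \in O5].

(** A nonzero element of least norm in the ideal of a and b divides both, since a remainder from
    [euclid5] would have smaller norm. *)
Lemma bezout5 a b : a \in O5 -> b \in O5 -> a != 0 ->
  exists x y, [/\ x \in O5, y \in O5, x * a + y * b != 0,
    a / (x * a + y * b) \in O5 & b / (x * a + y * b) \in O5].
Proof.
move=> aO bO a0.
pose P g := exists x y, [/\ x \in O5, y \in O5 & g = x * a + y * b].
have Pa : P a by exists 1, 0; rewrite mul1r mul0r addr0 rpred1 rpred0.
have [g [gO g0 [x [y [xO yO ge]]] gm]] := nm5_min aO a0 Pa.
have key c : P c -> c / g \in O5.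
  move=> [x' [y' [xO' yO' ce]]]; have [k kO] := euclid5 (c / g).
  case: (eqVneq (c / g - k) 0) => [/eqP|n0 lt]; first by rewrite subr_eq0 => /eqP ->.
  have : nm5 g <= nm5 ((c / g - k) * g).
    have e : (c / g - k) * g = (x' - k * x) * a + (y' - k * y) * b.
      by rewrite mulrBl mulfVK // ce [in LHS]ge; ring.
    apply: gm; last by exists (x' - k * x), (y' - k * y); rewrite !rpredB ?rpredM.
      by rewrite e rpredD ?rpredM ?rpredB ?rpredM.
    by rewrite mulf_neq0.
  by rewrite nm5M ler_pMl ?nm5_gt0 // leNgt lt.
exists x, y; rewrite -ge; split=> //; apply: key => //.
by exists 0, 1; rewrite mul1r mul0r add0r rpred1 rpred0.
Qed.

(** A non-unit divisor q of c of least norm is prime. If q divides a b, the gcd g of q and a divides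
    c: either g is a unit, and q divides b, or g has at least the norm of q, so q / g is a unit and
    q divides a. *)
Lemma prime5_divisor c : c \in O5 -> c != 0 -> c^-1 \notin O5 ->
  exists2 q, prime5 q & c / q \in O5.
Proof.
move=> cO c0 cV; pose P q := q^-1 \notin O5 /\ c / q \in O5.
have Pc : P c by split=> //; rewrite mulfV // rpred1.
have [q [qO q0 [qV cq] qm]] := nm5_min cO c0 Pc.
exists q => //; split=> // a b aO bO abq.
have [x [y [xO yO g0 qg ag]]] := bezout5 qO aO q0.
set g := x * q + y * a in g0 qg ag.
have gO : g \in O5 by rewrite rpredD ?rpredM.
case: (boolP (g^-1 \in O5)) => gV.
  right; have -> : b / q = g^-1 * (x * b + y * (a * b / q)).
    by rewrite /g in g0 *; field; rewrite q0 g0.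
  by rewrite rpredM // rpredD // rpredM.
left; have : nm5 q <= nm5 g.
  apply: qm => //; split=> //.
  by have -> : c / g = c / q * (q / g) by [field; rewrite q0 g0]; rewrite rpredM.
have qgn : q / g != 0 by rewrite mulf_neq0 ?invr_eq0.
have [n en] := nm5_nat qg; have := nm5_gt0 qgn.
have -> : nm5 q = nm5 (q / g) * nm5 g by rewrite -nm5M mulfVK.
move=> n0; rewrite -subr_ge0 -{1}[nm5 g]mul1r -mulrBl pmulr_lge0 ?nm5_gt0 // subr_ge0 => n1.
have /nm5_unit : nm5 (q / g) = 1.
  rewrite en; move: n0 n1; rewrite en ltr0n lern1.
  by case: (n) => [|[|m]].
rewrite invf_div => /(_ qg) gq.
by have -> : a / q = a / g * (g / q) by [field; rewrite q0 g0]; rewrite rpredM.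
Qed.

Lemma prime5_nm q : prime5 q -> 1 < nm5 q.
Proof. by case=> *; apply: nm5_nonunit. Qed.

Lemma cyc5_frac x : x != 0 -> exists a b, [/\ a \in O5, b \in O5, a != 0, b != 0 & x = a / b].
Proof.
move=> x0; pose m := denq (cf0 x) * denq (cf1 x) * denq (cf2 x) * denq (cf3 x).
have m0 : m != 0 by rewrite !mulf_neq0 ?denq_neq0.
have b0 : m%:~R != 0 :> cyc5.
  rewrite -(rmorph_int rat5) fmorph_eq0 intr_eq0; exact: m0.
exists (x * m%:~R), m%:~R; split=> //; rewrite ?rpred_int ?mulf_neq0 ?mulfK //.
have den (q : rat) : q * (denq q)%:~R \is a Num.int.
  by rewrite -{1}(divq_num_den q) mulfVK ?intr_int ?intr_eq0 ?denq_neq0.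
have Mr y q : y * rat5 q = Cyc5 (cf0 y * q) (cf1 y * q) (cf2 y * q) (cf3 y * q).
  by case: y => *; apply: cyc5P => /=; ring.
rewrite -(rmorph_int rat5) Mr; apply/O5P; rewrite /= /m !intrM.
have Z (n : int) : n%:~R \is a @Num.int rat := intr_int _ n.
have p4 (a b c d : rat) : a \is a Num.int -> b \is a Num.int -> c \is a Num.int ->
    d \is a Num.int -> a * b * c * d \is a Num.int.
  by move=> *; do !apply: rpredM.
have r0 (a b c d e : rat) : a * (b * c * d * e) = a * b * c * d * e by ring.
have r1 (a b c d e : rat) : a * (b * c * d * e) = a * c * b * d * e by ring.
have r2 (a b c d e : rat) : a * (b * c * d * e) = a * d * b * c * e by ring.
have r3 (a b c d e : rat) : a * (b * c * d * e) = a * e * b * c * d by ring.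
split; [rewrite r0|rewrite r1|rewrite r2|rewrite r3]; apply: p4 => //; exact: den.
Qed.

(** * Valuations *)

(* The value of a valuation at 0 is junk, hence the predicates [vge] and [veq]. *)
Section Valuation.
Variables (K : fieldType) (v : K -> int).
Definition valuation_axiom :=
  (forall x y, x != 0 -> y != 0 -> v (x * y) = v x + v y) /\
  (forall x y k, x != 0 -> y != 0 -> x + y != 0 -> k <= v x -> k <= v y -> k <= v (x + y)).
Definition vge (k : int) (x : K) := (x == 0) || (k <= v x).
Definition veq (k : int) (x : K) := (x != 0) && (v x == k).
Hypothesis vP : valuation_axiom.
Let vM := vP.1.
Let vD := vP.2.

Lemma val1 : v 1 = 0.
Proof. by move: (vM (oner_neq0 K) (oner_neq0 K)); rewrite mulr1; move: (v 1) => k; lia. Qed.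
Lemma valN x : v (- x) = v x.
Proof.
case: (eqVneq x 0) => [->|x0]; first by rewrite oppr0.
have n1 : (-1 : K) != 0 by rewrite oppr_eq0 oner_neq0.
have e : v (-1) = 0 by move: (vM n1 n1); rewrite mulrNN mulr1 val1; move: (v _) => k; lia.
by rewrite -mulN1r vM // e add0r.
Qed.
Lemma valV x : x != 0 -> v x^-1 = - v x.
Proof.
move=> x0; have := vM x0 (invr_neq0 x0); rewrite mulfV // val1; move: (v x) (v _) => k l; lia.
Qed.

Lemma veqP k x : reflect (x != 0 /\ v x = k) (veq k x).
Proof. by apply: (iffP andP) => -[x0 /eqP]. Qed.
Lemma veq_neq0 k x : veq k x -> x != 0. Proof. by case/andP. Qed.
Lemma veq_val x : x != 0 -> veq (v x) x. Proof. by rewrite /veq eqxx andbT. Qed.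
Lemma veq_uniq k l x : veq k x -> veq l x -> k = l.
Proof. by case/veqP=> _ <- /veqP[_ <-]. Qed.
Lemma vge0 k : vge k 0. Proof. by rewrite /vge eqxx. Qed.
Lemma veq1 : veq 0 1. Proof. by rewrite /veq oner_neq0 val1 eqxx. Qed.
Lemma vge_veq k l x : veq l x -> k <= l -> vge k x.
Proof. by case/veqP=> _ <- kl; rewrite /vge kl orbT. Qed.
Lemma vge_le k l x : vge l x -> k <= l -> vge k x.
Proof. by case/orP=> [/eqP->|h] kl; rewrite /vge ?eqxx ?(le_trans kl h) ?orbT. Qed.
Lemma veq_geF k l x : veq k x -> vge l x -> l <= k.
Proof. by case/veqP=> x0 <-; rewrite /vge (negPf x0). Qed.
Lemma vgeN k x : vge k (- x) = vge k x.
Proof. by rewrite /vge oppr_eq0 valN. Qed.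
Lemma veqN k x : veq k (- x) = veq k x.
Proof. by rewrite /veq oppr_eq0 valN. Qed.
Lemma vgeD k x y : vge k x -> vge k y -> vge k (x + y).
Proof.
rewrite /vge; case: (eqVneq x 0) => [->|x0] /=; first by rewrite add0r.
case: (eqVneq y 0) => [->|y0] /= hx hy; first by rewrite addr0 hx orbT.
by case: (eqVneq (x + y) 0) => //= h; apply: vD.
Qed.
Lemma vgeB k x y : vge k x -> vge k y -> vge k (x - y).
Proof. by move=> hx hy; rewrite vgeD // vgeN. Qed.
Lemma vgeM k l x y : vge k x -> vge l y -> vge (k + l) (x * y).
Proof.
rewrite /vge mulf_eq0; case: (eqVneq x 0) => //= x0; case: (eqVneq y 0) => //= y0 ??.
by rewrite vM // lerD.
Qed.
Lemma veqM k l x y : veq k x -> veq l y -> veq (k + l) (x * y).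
Proof. by case/veqP=> x0 <- /veqP[y0 <-]; apply/veqP; rewrite mulf_neq0 ?vM. Qed.
Lemma veqV k x : veq k x -> veq (- k) x^-1.
Proof. by case/veqP=> x0 <-; apply/veqP; rewrite invr_eq0 valV. Qed.
Lemma veqF k l x y : veq k x -> veq l y -> veq (k - l) (x / y).
Proof. by move=> hx hy; apply: veqM => //; apply: veqV. Qed.
Lemma vgeF k l x y : vge k x -> veq l y -> vge (k - l) (x / y).
Proof. by move=> hx /veqV hy; apply: vgeM => //; apply: vge_veq hy _. Qed.
Lemma veqX k x n : veq k x -> veq (k * n%:Z) (x ^+ n).
Proof.
move=> hx; elim: n => [|n IH]; first by rewrite expr0 mulr0 veq1.
by rewrite exprS; have := veqM hx IH; congr (veq _ _); lia.
Qed.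
Lemma vgeX k x n : vge k x -> vge (k * n%:Z) (x ^+ n).
Proof.
move=> hx; elim: n => [|n IH]; first by rewrite expr0 mulr0 (vge_veq veq1).
by rewrite exprS; have := vgeM hx IH; congr (vge _ _); lia.
Qed.
Lemma veqDl k x y : veq k x -> vge (k + 1) y -> veq k (x + y).
Proof.
move=> hx hy; have [x0 vx] := veqP _ _ hx.
have hxy : vge k (x + y) by rewrite vgeD // ?(vge_veq hx) //; apply: vge_le hy _; lia.
case: (boolP (vge (k + 1) (x + y))) => h.
  have : vge (k + 1) x by rewrite -(addrK y x) vgeB.
  by move/(veq_geF hx); lia.
move: hxy h; rewrite /vge /veq negb_or => /orP[->//|h1] /andP[-> h2] /=; lia.
Qed.
Lemma veqDr k x y : veq k y -> vge (k + 1) x -> veq k (x + y).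
Proof. by move=> hy hx; rewrite addrC; apply: veqDl. Qed.
Lemma veqBl k x y : veq k x -> vge (k + 1) y -> veq k (x - y).
Proof. by move=> hx hy; apply: veqDl; rewrite ?vgeN. Qed.
Lemma veq_Mcancel k l x y : veq l y -> veq (k + l) (x * y) -> veq k x.
Proof.
move=> hy h; have := veqF h hy; rewrite mulfK ?(veq_neq0 hy) //.
by congr (veq _ _); lia.
Qed.
End Valuation.

Section PrimeValuation.
Variable q : cyc5.
Hypothesis qP : prime5 q.
Let qO : q \in O5. Proof. by case: qP. Qed.
Let q0 : q != 0. Proof. by case: qP. Qed.

Definition vspec x (n : int) := exists a b, [/\ a \in O5 /\ b \in O5,
  a / q \notin O5, b / q \notin O5 & x = q ^ n * (a / b)].

Lemma vspec_O5 x : x \in O5 -> x != 0 ->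
  exists (n : nat) (a : cyc5), [/\ a \in O5, a / q \notin O5 & x = q ^+ n * a].
Proof.
move=> xO x0; have [n e] := nm5_nat xO.
elim/ltn_ind: n x e xO x0 => n IH x e xO x0.
case: (boolP (x / q \in O5)) => xq; last by exists 0%N, x; rewrite expr0 mul1r.
have xq0 : x / q != 0 by rewrite mulf_neq0 ?invr_eq0.
have [m em] := nm5_nat xq; have lt : (m < n)%N.
  rewrite -(@ltr_nat rat) -em -e (_ : nm5 x = nm5 (x / q) * nm5 q); last by rewrite -nm5M mulfVK.
  by rewrite ltr_pMr ?nm5_gt0 // prime5_nm.
have [k [a [aO aq ae]]] := IH m lt (x / q) em xq xq0.
by exists k.+1, a; split=> //; rewrite exprSr -mulrA mulrCA -ae mulrCA mulfV // mulr1.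
Qed.

Lemma nondvd_neq0 a : a / q \notin O5 -> a != 0.
Proof. by apply: contraNneq => ->; rewrite mul0r rpred0. Qed.

Lemma nondvdM a b : a \in O5 -> b \in O5 -> a / q \notin O5 -> b / q \notin O5 -> a * b / q \notin O5.
Proof.
by case: qP => _ _ _ h aO bO aq bq; apply/negP => abq; case: (h a b aO bO abq); apply/negP.
Qed.

Lemma vspec_ex x : x != 0 -> exists n, vspec x n.
Proof.
move=> x0; have [a [b [aO bO a0 b0 ->]]] := cyc5_frac x0.
have [n [a' [aO' aq ->]]] := vspec_O5 aO a0; have [m [b' [bO' bq ->]]] := vspec_O5 bO b0.
exists (n%:Z - m%:Z), a', b'; split=> //.
have b0' := nondvd_neq0 bq; rewrite expfzDr // -exprnN -exprnP.
by field; rewrite b0' expf_neq0.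
Qed.

Lemma vspec_uniq x n m : vspec x n -> vspec x m -> n = m.
Proof.
wlog: n m / n <= m => [W hn hm|].
  by case: (lerP n m) => h; [exact: W | symmetry; apply: W => //; exact: ltW].
move=> le [a [b [[aO bO] aq bq ->]]] [c [d [[cO dO] cq dq]]].
have [k ->] : exists k : nat, m = n + k%:Z by exists `|m - n|%N; lia.
case: k => [|k]; first by rewrite addr0.
have a0 := nondvd_neq0 aq; have b0 := nondvd_neq0 bq; have d0 := nondvd_neq0 dq.
rewrite expfzDr // -mulrA => /(mulfI (expfz_neq0 n q0)); rewrite -exprnP => e.
have {}e : a * d = q ^+ k.+1 * (b * c) by rewrite -(mulfVK b0 a) e; field; rewrite d0.
case/negP: (nondvdM aO dO aq dq); rewrite e (_ : _ / q = q ^+ k * (b * c)); last by rewrite exprS; field.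
by rewrite !rpredM ?rpredX.
Qed.

Definition val5 x : int := epsilon (inhabits 0) (vspec x).

Lemma val5P x : x != 0 -> vspec x (val5 x).
Proof. by move=> x0; apply: epsilon_spec; apply: vspec_ex. Qed.

Lemma val5_eq x n : x != 0 -> vspec x n -> val5 x = n.
Proof. by move=> x0; apply: vspec_uniq; apply: val5P. Qed.

Lemma val5_ge0 x : x \in O5 -> x != 0 -> 0 <= val5 x.
Proof.
move=> xO x0; have [n [a [aO aq e]]] := vspec_O5 xO x0.
rewrite (@val5_eq x n) //; exists a, 1; split=> //; rewrite ?rpred1 ?divr1 //.
by rewrite mul1r; case: qP.
Qed.

Lemma val5_valuation : valuation_axiom val5.
Proof.
have vM (x y : cyc5) : x != 0 -> y != 0 -> val5 (x * y) = val5 x + val5 y.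
  move=> x0 y0; apply: val5_eq; first exact: mulf_neq0.
  have [a [b [[aO bO] aq bq e]]] := val5P x0; have [c [d [[cO dO] cq dq f]]] := val5P y0.
  exists (a * c), (b * d); split; [by rewrite !rpredM | exact: nondvdM | exact: nondvdM |].
  have b0 := nondvd_neq0 bq; have d0 := nondvd_neq0 dq.
  by rewrite [in LHS]e [in LHS]f expfzDr // mulrACA mulf_div.
split=> [|x y k x0 y0 xy0 kx ky]; first exact: vM.
have sc (w : cyc5) (l : int) : w != 0 -> l <= val5 w -> exists c d, [/\ c \in O5, d \in O5, d / q \notin O5 & w = q ^ l * (c / d)].
  move=> w0 lw; have [a [b [[aO bO] aq bq e]]] := val5P w0.
  exists (q ^+ `|val5 w - l| * a), b; split; rewrite // ?rpredM ?rpredX //.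
  have -> : q ^+ `|val5 w - l| = q ^ (val5 w - l) by rewrite exprnP; congr (_ ^ _); move: (val5 w) lw => u lw; lia.
  rewrite -mulrA (mulrA (q ^ l)) -expfzDr // [in LHS]e; congr (_ ^ _ * _).
  by move: (val5 w) => u; lia.
have [a [b [aO bO bq e]]] := sc _ _ x0 kx; have [c [d [cO dO dq f]]] := sc _ _ y0 ky.
have b0 := nondvd_neq0 bq; have d0 := nondvd_neq0 dq.
have g : x + y = q ^ k * ((a * d + c * b) / (b * d)).
  by rewrite e f -mulrDr addf_div.
have n0 : a * d + c * b != 0 by apply: contraNneq xy0 => h; rewrite g h mul0r mulr0.
have bd0 : b * d != 0 by rewrite mulf_neq0.
have vbd : val5 (b * d) = 0.
  apply: val5_eq => //; exists (b * d), 1; split; rewrite ?mul1r; [by rewrite rpredM ?rpred1 | exact: nondvdM | by case: qP |].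
  by rewrite divr1 ?expr0z ?mul1r.
have vk : val5 (q ^ k) = k.
  apply: val5_eq; first exact: expfz_neq0.
  exists 1, 1; have q1 : 1 / q \notin O5 by rewrite mul1r; case: qP.
  by split; [rewrite rpred1 | exact: q1 | exact: q1 | rewrite divr1 ?mulr1].
have f0 : (a * d + c * b) / (b * d) != 0 by rewrite mulf_neq0 ?invr_eq0.
rewrite g (vM _ _ (expfz_neq0 k q0) f0) vk.
have -> : val5 ((a * d + c * b) / (b * d)) = val5 (a * d + c * b).
  by have := vM _ _ f0 bd0; rewrite mulfVK // vbd addr0.
by rewrite lerDl val5_ge0 // rpredD ?rpredM.
Qed.
End PrimeValuation.

Lemma val5_dvd q x (n : nat) : prime5 q -> x \in O5 -> x != 0 -> n%:Z <= val5 q x ->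
  x / q ^+ n \in O5.
Proof.
move=> qP xO x0; have [m [a [aO aq e]]] := vspec_O5 qP xO x0.
have q1 : 1 / q \notin O5 by rewrite mul1r; case: qP.
have q0 : q != 0 by case: qP.
rewrite (@val5_eq q qP x m) //; last by exists a, 1; split; rewrite ?rpred1 ?divr1.
rewrite lez_nat => nm; rewrite e -(subnK nm) exprD mulrAC mulfK ?expf_neq0 //.
by rewrite rpredM ?rpredX //; case: qP.
Qed.

Lemma val5_pos q x : prime5 q -> x \in O5 -> x != 0 -> x / q \in O5 -> 1 <= val5 q x.
Proof.
move=> qP xO x0 xq; have [m [a [aO aq e]]] := vspec_O5 qP xO x0.
have q1 : 1 / q \notin O5 by rewrite mul1r; case: qP.
rewrite (@val5_eq q qP x m) //; last by exists a, 1; split; rewrite ?rpred1 ?divr1.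
by case: m e => // e; case/negP: aq; move: xq; rewrite e expr0 mul1r.
Qed.

Lemma val5_unit q u : prime5 q -> u \in O5 -> u^-1 \in O5 -> u != 0 -> val5 q u = 0.
Proof.
move=> qP uO vO u0; have v0 : u^-1 != 0 by rewrite invr_eq0.
have := val5_ge0 qP uO u0; have := val5_ge0 qP vO v0.
by rewrite (valV (val5_valuation qP)) //; move: (val5 q u) => k; lia.
Qed.

(** Replacing a / b by a b^4 = (a / b) b^5 reduces to elements of Z[zeta]. There a prime divisor q
    occurs at least five times, and dividing by q^5 lowers the norm. *)
Lemma fifth_power x : x != 0 -> (forall q, prime5 q -> exists k : int, val5 q x = 5 * k) ->
  exists u g, [/\ u \in O5, u^-1 \in O5, g != 0 & x = u * g ^+ 5].
Proof.
suff H c : c \in O5 -> c != 0 -> (forall q, prime5 q -> exists k : int, val5 q c = 5 * k) ->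
    exists u g, [/\ u \in O5, u^-1 \in O5, g != 0 & c = u * g ^+ 5].
  move=> x0 hx; have [a [b [aO bO a0 b0 e]]] := cyc5_frac x0.
  have b5 : b ^+ 5 != 0 by rewrite expf_neq0.
  have ec : a * b ^+ 4 = x * b ^+ 5 by rewrite e (exprS b 4) [RHS]mulrA mulfVK.
  have [|||u [g [uO vO g0 eg]]] := H (a * b ^+ 4).
  - by rewrite rpredM ?rpredX.
  - by rewrite mulf_neq0 ?expf_neq0.
  - move=> q qP; have [k hk] := hx q qP; exists (k + val5 q b).
    have vP := val5_valuation qP; rewrite ec vP.1 // hk.
    have /veqP[_ ->] := veqX vP 5 (veq_val (val5 q) b0).
    by move: (val5 q b) => l; lia.
  exists u, (g / b); rewrite mulf_neq0 ?invr_eq0 //; split=> //.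
  by rewrite expr_div_n mulrA -eg ec mulfK.
move=> cO c0 hc; have [n e] := nm5_nat cO.
elim/ltn_ind: n c e cO c0 hc => n IH c e cO c0 hc.
case: (boolP (c^-1 \in O5)) => cV.
  by exists c, 1; rewrite oner_neq0 expr1n mulr1.
have [q qP cq] := prime5_divisor cO c0 cV; have vP := val5_valuation qP.
have q0 : q != 0 by case: qP.
have [k hk] := hc q qP; have v1 := val5_pos qP cO c0 cq.
have dO : c / q ^+ 5 \in O5.
  by apply: val5_dvd => //; move: hk v1; move: (val5 q c) => l; lia.
have d0 : c / q ^+ 5 != 0 by rewrite mulf_neq0 ?invr_eq0 ?expf_neq0.
have cE : c = c / q ^+ 5 * q ^+ 5 by rewrite mulfVK ?expf_neq0.
have [m em] := nm5_nat dO; have lt : (m < n)%N.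
  rewrite -(@ltr_nat rat) -em -e (_ : nm5 c = nm5 (c / q ^+ 5) * nm5 (q ^+ 5)); last first.
    by rewrite -nm5M -cE.
  rewrite ltr_pMr ?nm5_gt0 //.
  have nX (j : nat) : nm5 (q ^+ j) = nm5 q ^+ j.
    by elim: j => [|j IHj]; rewrite ?expr0 ?nm5_1 // !exprS nm5M IHj.
  by rewrite nX exprn_egt1 // prime5_nm.
have [|u [g [uO vO g0 eg]]] := IH m lt _ em dO d0.
  move=> r rP; have [l hl] := hc r rP; exists (l - val5 r q).
  have rv := val5_valuation rP; move: hl; rewrite {1}cE rv.1 ?expf_neq0 //.
  have /veqP[_ ->] := veqX rv 5 (veq_val (val5 r) q0).
  by move: (val5 r q) (val5 r _) => a b; lia.
exists u, (g * q); rewrite mulf_neq0 //; split=> //.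
by rewrite exprMn mulrA -eg mulfVK ?expf_neq0.
Qed.

(** * The prime pi = 1 - zeta and its residue field F_5 *)

Definition pi5 : cyc5 := 1 - z5.
Definition sum5 (x : cyc5) := cf0 x + cf1 x + cf2 x + cf3 x.

Lemma pi5V : pi5^-1 = Cyc5 (4 / 5) (3 / 5) (2 / 5) (1 / 5).
Proof.
have p0 : pi5 != 0 by apply/eqP => - [].
by apply: (mulfI p0); rewrite mulfV //; apply: cyc5P.
Qed.

Lemma O5_ints x : x \in O5 -> exists a b c d : int,
  x = Cyc5 a%:~R b%:~R c%:~R d%:~R.
Proof.
case: x => a b c d /O5P[/= /intrP[a' ->] /intrP[b' ->] /intrP[c' ->] /intrP[d' ->]].
by exists a', b', c', d'.
Qed.

(** Modulo pi one has zeta = 1, so the residue of x is the sum of its coordinates modulo 5. *)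
Lemma pi5_dvd x : x \in O5 -> (x / pi5 \in O5) = (sum5 x / 5 \is a Num.int).
Proof.
move=> /O5_ints[a [b [c [d ->]]]]; rewrite pi5V.
have I (n : int) : n%:~R \is a @Num.int rat := intr_int _ n.
set s := sum5 _; have e : s = (a + b + c + d)%:~R by rewrite !intrD.
apply/idP/idP => [/O5P[h _ _ _]|h].
  rewrite (_ : s / 5 = a%:~R - cf0 (Cyc5 a%:~R b%:~R c%:~R d%:~R * Cyc5 (4 / 5) (3 / 5) (2 / 5) (1 / 5))).
    by rewrite rpredB.
  by rewrite e !intrD /=; field.
have N (k : nat) : (k%:R : rat) \is a Num.int := rpred_nat _ k.
apply/O5P; rewrite /=; split.
- rewrite (_ : _ - _ = a%:~R - s / 5); first exact: rpredB.
  by rewrite e !intrD; field.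
- rewrite (_ : _ - _ = 3 * (s / 5) - (c%:~R + d%:~R)).
    by apply: rpredB; [apply: rpredM => //; exact: N 3%N | apply: rpredD].
  by rewrite e !intrD; field.
- rewrite (_ : _ - _ = 2 * (s / 5) - d%:~R).
    by apply: rpredB => //; apply: rpredM => //; exact: N 2%N.
  by rewrite e !intrD; field.
rewrite (_ : _ - _ = s / 5) //.
by rewrite e !intrD; field.
Qed.

Lemma int_div5 (n : int) : ((n%:~R / 5 : rat) \is a Num.int) = (5 %| n)%Z.
Proof.
apply/idP/idP => [/intrP[m e]|/dvdzP[m ->]].
  apply/dvdzP; exists m; apply: (@intr_inj rat); rewrite intrM -e.
  by rewrite mulfVK.
by rewrite intrM mulfK // intr_int.
Qed.

Lemma pi5_prime : prime5 pi5.
Proof.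
have pO : pi5 \in O5 by rewrite rpredB ?rpred1 ?O5_z.
split=> // x y xO yO; have xyO : x * y \in O5 by rewrite rpredM.
rewrite (pi5_dvd xyO) (pi5_dvd xO) (pi5_dvd yO) {xyO}.
have [a [b [c [d ->]]]] := O5_ints xO; have [a' [b' [c' [d' ->]]]] := O5_ints yO.
have E : sum5 (Cyc5 a%:~R b%:~R c%:~R d%:~R * Cyc5 a'%:~R b'%:~R c'%:~R d'%:~R) =
    ((a + b + c + d) * (a' + b' + c' + d') - 5 * (b * d' + c * c' + d * b'))%:~R.
  by rewrite /sum5 /= !(intrB, intrM, intrD); ring.
rewrite E /sum5 /= -!intrD !int_div5 => h.
have {h} : (5 %| (a + b + c + d) * (a' + b' + c' + d'))%Z.
  by move: (_ * _) (_ + d * b') h => P X h; lia.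
by rewrite !dvdzE abszM Euclid_dvdM // => /orP.
Qed.

Notation v5 := (val5 pi5).
Lemma v5P : valuation_axiom v5. Proof. exact: val5_valuation pi5_prime. Qed.

Lemma v5_O5 x : x \in O5 -> vge v5 0 x.
Proof. by move=> xO; rewrite /vge; case: eqVneq => //= x0; exact: (val5_ge0 pi5_prime). Qed.

Lemma v5_O5_dvd x : x \in O5 -> x / pi5 \in O5 -> vge v5 1 x.
Proof.
by move=> xO xp; rewrite /vge; case: eqVneq => //= x0; exact: (val5_pos pi5_prime).
Qed.

Lemma v5_O5_eq0 x : x \in O5 -> x / pi5 \notin O5 -> veq v5 0 x.
Proof.
move=> xO xp; have x0 : x != 0 by apply: contraNneq xp => ->; rewrite mul0r rpred0.
have p1 : 1 / pi5 \notin O5 by [].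
apply/veqP; split; first exact: x0.
apply: (@val5_eq pi5 pi5_prime x 0 x0); exists x, 1.
by split; [split; [exact: xO | exact: rpred1] | exact: xp | exact: p1 | rewrite expr0z mul1r divr1].
Qed.

Lemma v5_pi : veq v5 1 pi5.
Proof.
have p1 : 1 / pi5 \notin O5 by [].
have p0 : pi5 != 0 by [].
apply/veqP; split; first exact: p0.
apply: (@val5_eq pi5 pi5_prime pi5 1 p0); exists 1, 1.
by split; [split; exact: rpred1 | exact: p1 | exact: p1 | rewrite expr1z divr1 ?mulr1].
Qed.

Lemma v5_residue x : vge v5 0 x -> exists c : nat, (c < 5)%N /\ vge v5 1 (x - c%:R).
Proof.
move=> hx; case: (eqVneq x 0) => [->|x0]; first by exists 0%N; rewrite subrr vge0.
have {hx} v0 : 0 <= v5 x by move: hx; rewrite /vge (negPf x0).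
have [a [b [[aO bO] ap bp e]]] := val5P pi5_prime x0.
have pO : pi5 \in O5 by rewrite rpredB ?rpred1 ?O5_z.
have {e} e : x = pi5 ^+ `|v5 x| * a / b.
  by rewrite -mulrA [in LHS]e; congr (_ * _); rewrite exprnP; congr (_ ^ _); move: (v5 x) v0 => k; lia.
have aO' : pi5 ^+ `|v5 x| * a \in O5 by rewrite rpredM ?rpredX.
move: (pi5 ^+ _ * a) aO' e => a' aO' e.
have b0 := nondvd_neq0 bp.
have [b0' [b1 [b2 [b3 eb]]]] := O5_ints bO; have [a0 [a1 [a2 [a3 ea]]]] := O5_ints aO'.
pose A := a0 + a1 + a2 + a3; pose B := b0' + b1 + b2 + b3.
have nB : ~~ (5 %| B)%Z.
  by move: bp; rewrite pi5_dvd // eb /sum5 /= -!intrD int_div5.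
have [c [c5 hc]] : exists c : nat, (c < 5)%N /\ (5 %| A - c%:Z * B)%Z.
  have : [|| 5 %| A, 5 %| A - B, 5 %| A - 2 * B, 5 %| A - 3 * B | 5 %| A - 4 * B]%Z.
    by move: (A) (B) nB => A' B' nB'; lia.
  by case/or4P => [h|h|h|/orP[]h]; [exists 0%N|exists 1%N|exists 2%N|exists 3%N|exists 4%N];
    split=> //; rewrite ?mul0r ?subr0 ?mul1r.
exists c; split=> //.
have -> : x - c%:R = (a' - c%:R * b) / b by rewrite e mulrBl mulfK.
rewrite -[1]subr0; apply: (vgeF v5P); last exact: v5_O5_eq0.
have cO : a' - c%:R * b \in O5 by rewrite rpredB // rpredM // rpred_nat.
apply: v5_O5_dvd => //; rewrite pi5_dvd // (_ : sum5 _ = (A - c%:Z * B)%:~R) ?int_div5 //.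
have -> : c%:R = rat5 c%:R by rewrite rmorph_nat.
by rewrite ea eb /sum5 /= /A /B intrB intrM !intrD; ring.
Qed.

(** * Units that are fifth powers *)

(** The golden ratio - (z^2 + z^3), which generates the units of the real subfield up to sign. *)
Definition phi5 : cyc5 := Cyc5 0 0 (-1) (-1).
Lemma phi5_sqr : phi5 ^+ 2 = phi5 + 1.
Proof. by apply: cyc5P. Qed.
Lemma phi5_neq0 : phi5 != 0. Proof. by []. Qed.
Lemma phi5V : phi5^-1 = phi5 - 1.
Proof.
apply: (mulfI phi5_neq0); rewrite (mulfV phi5_neq0); exact: cyc5P.
Qed.

Definition range2 : seq int := [:: -2; -1; 0; 1; 2].
Definition unit_shape (a b c d : int) : bool :=
  (a, b, c, d) \in [:: (1, 0, 0, 0); (0, 1, 0, 0); (0, 0, 1, 0); (0, 0, 0, 1); (1, 1, 1, 1);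
   (-1, 0, 0, 0); (0, -1, 0, 0); (0, 0, -1, 0); (0, 0, 0, -1); (-1, -1, -1, -1)].
Lemma sqr_le4_range2 (x : int) : x ^+ 2 <= 4 -> x \in range2.
Proof.
move=> h; have : -2 <= x <= 2 by rewrite expr2 in h; nia.
by case/andP=> ??; rewrite !inE; lia.
Qed.
(** The solutions are the ten roots of unity of the field. Each square is at most 4, which leaves a
    finite search. *)
Lemma unit_shapeP (a b c d : int) :
  (a - b) ^+ 2 + (a - c) ^+ 2 + (a - d) ^+ 2 + (b - c) ^+ 2 + (b - d) ^+ 2 +
   (c - d) ^+ 2 + a ^+ 2 + b ^+ 2 + c ^+ 2 + d ^+ 2 = 4 -> unit_shape a b c d.
Proof.
have chk : all (fun a => all (fun b => all (fun c => all (fun d =>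
  ((a - b) * (a - b) + (a - c) * (a - c) + (a - d) * (a - d) + (b - c) * (b - c) +
   (b - d) * (b - d) + (c - d) * (c - d) + a * a + b * b + c * c + d * d == 4) ==>
   unit_shape a b c d) range2) range2) range2) range2 by vm_compute.
move=> e; have H (x : int) : 0 <= x ^+ 2 := sqr_ge0 x.
have [ha [hb [hc hd]]] : a ^+ 2 <= 4 /\ b ^+ 2 <= 4 /\ c ^+ 2 <= 4 /\ d ^+ 2 <= 4.
  move: e (H (a - b)) (H (a - c)) (H (a - d)) (H (b - c)) (H (b - d)) (H (c - d))
    (H a) (H b) (H c) (H d); clear chk H.
  move: ((a - b) ^+ 2) ((a - c) ^+ 2) ((a - d) ^+ 2) ((b - c) ^+ 2) ((b - d) ^+ 2)
    ((c - d) ^+ 2) (a ^+ 2) (b ^+ 2) (c ^+ 2) (d ^+ 2) => *; lia.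
have /(allP chk)/allP/(_ b)chk1 : a \in range2 by apply: sqr_le4_range2.
have /chk1/allP/(_ c)chk2 : b \in range2 by apply: sqr_le4_range2.
have /chk2/allP/(_ d)chk3 : c \in range2 by apply: sqr_le4_range2.
have /chk3 : d \in range2 by apply: sqr_le4_range2.
by rewrite -!expr2 e eqxx.
Qed.

Definition conj5 x := tau5 (tau5 x).
Lemma conj5M x y : conj5 (x * y) = conj5 x * conj5 y.
Proof. by rewrite /conj5 !tau5M. Qed.
Lemma conj5_O5 x : x \in O5 -> conj5 x \in O5.
Proof. by move=> ?; rewrite !tau5_O5. Qed.
Lemma conj5_eq0 x : (conj5 x == 0) = (x == 0).
Proof.
apply/eqP/eqP => [|->]; last by apply: cyc5P.
by case: x => a b c d [] *; apply: cyc5P => /=; lra.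
Qed.
Lemma conj5V x : x != 0 -> conj5 x^-1 = (conj5 x)^-1.
Proof.
move=> x0; have c0 : conj5 x != 0 by rewrite conj5_eq0.
apply: (mulfI c0); rewrite mulfV // -conj5M mulfV //; exact: cyc5P.
Qed.

(** The equation forces [nmu w = 1] and [nmv w = 0], so the trace form takes the value 2, and
    [unit_shapeP] lists all such elements. *)
Lemma norm1_root w : w \in O5 -> w * conj5 w = 1 ->
  exists s i, w = (-1) ^+ s * z5 ^+ i.
Proof.
move=> /O5_ints[a [b [c [d ->]]]] e.
have uv : nmu (Cyc5 a%:~R b%:~R c%:~R d%:~R) = 1 /\ nmv (Cyc5 a%:~R b%:~R c%:~R d%:~R) = 0.
  move/(congr1 (fun x => (cf0 x, cf2 x))): e => [/= e0 e2]; split; lra.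
have : 2 * nmu (Cyc5 a%:~R b%:~R c%:~R d%:~R) - nmv (Cyc5 a%:~R b%:~R c%:~R d%:~R) = 2.
  by rewrite uv.1 uv.2.
rewrite nmtrE => h.
have /unit_shapeP : (a - b) ^+ 2 + (a - c) ^+ 2 + (a - d) ^+ 2 + (b - c) ^+ 2 + (b - d) ^+ 2 +
   (c - d) ^+ 2 + a ^+ 2 + b ^+ 2 + c ^+ 2 + d ^+ 2 = 4.
  apply: (@intr_inj rat); rewrite !expr2 !(intrD, intrM, intrB); move: h; rewrite !expr2 !intrN; lra.
rewrite /unit_shape !inE => sh.
have E s i : (a%:~R, b%:~R, c%:~R, d%:~R) = tup_of_cyc5 ((-1) ^+ s * z5 ^+ i) ->
    exists s i, Cyc5 a%:~R b%:~R c%:~R d%:~R = (-1) ^+ s * z5 ^+ i.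
  by move=> hE; exists s, i; apply: (can_inj tup_of_cyc5K).
case/or4P: sh => [/eqP[???? ]|/eqP[????]|/eqP[????]|]; first by subst; apply: (E 0%N 0%N).
- by subst; apply: (E 0%N 1%N).
- by subst; apply: (E 0%N 2%N).
case/or4P => [/eqP[????]|/eqP[????]|/eqP[????]|]; first by subst; apply: (E 0%N 3%N).
- by subst; apply: (E 1%N 4%N).
- by subst; apply: (E 1%N 0%N).
case/or4P => [/eqP[????]|/eqP[????]|/eqP[????]|/eqP[????]]; first by subst; apply: (E 1%N 1%N).
- by subst; apply: (E 1%N 2%N).
- by subst; apply: (E 1%N 3%N).
by subst; apply: (E 0%N 4%N).
Qed.

Lemma real5 x : conj5 x = x -> exists a b, x = rat5 a + rat5 b * phi5.
Proof.
case: x => a b c d /(congr1 tup_of_cyc5)[] h0 h1 h2 h3.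
by exists a, (- c); apply: cyc5P => /=; lra.
Qed.

Lemma golden_mul (R : comNzRingType) (f a b : R) : f ^+ 2 = f + 1 ->
  (b - a + a * f) * f = a + b * f /\ (b + (a + b) * f) * (f - 1) = a + b * f.
Proof.
move=> e; split.
  by rewrite (_ : _ * f = (b - a) * f + a * f ^+ 2); [rewrite e; ring | ring].
by rewrite (_ : _ * (f - 1) = b * f - b + (a + b) * (f ^+ 2 - f)); [rewrite e; ring | ring].
Qed.

(** The form is the norm of A + B phi. Division by phi when A B >= 0, and multiplication by phi
    otherwise, decreases |A| + |B| as long as neither is 0. *)
Lemma real_unit (A B : int) : (A * A + A * B - B * B) ^+ 2 = 1 ->
  exists s (n : int), A%:~R + B%:~R * phi5 = (-1) ^+ s * phi5 ^ n.
Proof.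
have [k] : exists k : nat, `|A| + `|B| <= k%:Z by exists (absz (`|A| + `|B|)); lia.
elim: k A B => [|k IH] A B lk e.
  have A0 : A = 0 by lia.
  have B0 : B = 0 by lia.
  by move: e; rewrite A0 B0.
have {}e : A * A + A * B - B * B = 1 \/ A * A + A * B - B * B = -1.
  by move/eqP: e; rewrite sqrf_eq1 => /orP[]/eqP->; [left|right].
case: (eqVneq B 0) => [B0|B0].
  have [A1|A1] : A = 1 \/ A = -1 by rewrite B0 in e; nia.
    by exists 0%N, 0; rewrite B0 A1 mul0r addr0 expr0 mul1r.
  by exists 1%N, 0; rewrite B0 A1 mul0r addr0 expr1 mulN1r.
case: (eqVneq A 0) => [A0|A0].
  have [B1|B1] : B = 1 \/ B = -1 by rewrite A0 in e; nia.
    by exists 0%N, 1; rewrite A0 B1 add0r expr0 expr1z.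
  by exists 1%N, 1; rewrite A0 B1 add0r expr1 expr1z.
have e2 (C D : int) : C * C + C * D - D * D = 1 \/ C * C + C * D - D * D = -1 ->
    (C * C + C * D - D * D) ^+ 2 = 1.
  by case=> ->; rewrite ?sqrrN expr1n.
case: (lerP 0 (A * B)) => AB.
  have le : `|A| <= `|B| by case: e => e; nia.
  have [||s [n h]] := IH (B - A) A.
  - nia.
  - by apply: e2; clear -e; case: e => e; [right|left]; lra.
  exists s, (n + 1); rewrite expfzDr ?phi5_neq0 // expr1z mulrA -h.
  by rewrite intrB (golden_mul _ _ phi5_sqr).1.
have le : `|B| <= `|A| by case: e => e; nia.
have [||s [n h]] := IH B (A + B).
- nia.
- by apply: e2; clear -e; case: e => e; [right|left]; lra.
exists s, (n - 1); rewrite expfzDr ?phi5_neq0 // mulrA -h.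
have -> : phi5 ^ (-1) = phi5 - 1 by rewrite -phi5V.
by rewrite intrD (golden_mul _ _ phi5_sqr).2.
Qed.

(** The quotient of u by its conjugate is a root of unity +-z^(2 j); then u / z^j equals its
    conjugate up to sign, the sign is +, and [real_unit] applies. *)
Lemma unit_form u : u \in O5 -> u^-1 \in O5 -> u != 0 ->
  exists s i (n : int), u = (-1) ^+ s * z5 ^+ i * phi5 ^ n.
Proof.
move=> uO vO u0; have c0 : conj5 u != 0 by rewrite conj5_eq0.
have wO : u / conj5 u \in O5 by rewrite rpredM // -conj5V // conj5_O5.
have cK : conj5 (conj5 u) = u by case: (u) => a b c d; apply: cyc5P => /=; ring.
have z0 : z5 != 0 by [].
have [|s [i w]] := norm1_root wO.
  by rewrite conj5M conj5V // cK; field; rewrite u0.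
have {w} w : u = (-1) ^+ s * z5 ^+ i * conj5 u by rewrite -w mulfVK.
(* an exponent [2 j] equal to [i] modulo 5 *)
have [j zj] : exists j, z5 ^+ i = z5 ^+ j * z5 ^+ j.
  by exists (i * 3)%N; rewrite -exprD -mulnDr (_ : (3 + 3)%N = (5 + 1)%N) // mulnDr exprD mulnC exprM z5_5 expr1n mul1r muln1.
have cz : conj5 z5 = z5^-1.
  by apply: (mulfI z0); rewrite (mulfV z0); apply: cyc5P.
have cX k : conj5 (z5 ^+ k) = (z5 ^+ k)^-1.
  elim: k => [|k IHk]; first by rewrite expr0 invr1; apply: cyc5P.
  by rewrite exprS conj5M IHk cz invfM.
have zk k : z5 ^+ k != 0 by rewrite expf_neq0.
pose r := u / z5 ^+ j.
have zO k : z5 ^+ k \in O5 by apply: rpredX; exact: O5_z.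
have rO : r \in O5 by apply: rpredM; [exact: uO | rewrite -cX; apply: conj5_O5; exact: zO].
have rE : u = z5 ^+ j * r by rewrite /r mulrC (mulfVK (zk j)).
have cr : r = (-1) ^+ s * conj5 r.
  apply: (mulfI (zk j)); rewrite -rE {1}w zj {1}rE conj5M cX.
  by move: (conj5 r) (zk j); move: (z5 ^+ j) => a b b0; field.
have r0 : r != 0 by rewrite /r mulf_neq0 ?invr_eq0 ?zk ?u0.
have rV : r^-1 \in O5 by rewrite /r invf_div; apply: rpredM; [exact: zO | exact: vO].
clear w wO; clearbody r.
have s0 : conj5 r = r.
  case: (boolP (odd s)) => os; last first.
    by rewrite [in RHS]cr -signr_odd (negPf os) expr0 mul1r.
  have {}cr : r = - conj5 r by rewrite [LHS]cr -signr_odd os expr1 mulN1r.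
  exfalso.
  (* Conjugation is trivial modulo pi, so r = - conj r gives 2 r = 0 modulo pi, impossible for a
     unit. *)
  have : r / pi5 \in O5.
    rewrite (pi5_dvd rO); have [a [b [c [d e]]]] := O5_ints rO.
    move: cr; rewrite e /sum5 /= -!intrD int_div5 => /(congr1 tup_of_cyc5)[] e0 e1 e2 e3.
    have : (a + b + c + d)%:~R = (5 * a)%:~R :> rat.
      rewrite !(intrM, intrD); lra.
    by move/intr_inj => {}e; lia.
  move/(val5_pos pi5_prime rO r0); rewrite (val5_unit pi5_prime rO rV r0).
  by [].
have [A [B rAB]] := real5 s0.
have [A' [B' {}rAB]] : exists A B : int, r = A%:~R + B%:~R * phi5.
  have [a [b [c [d e]]]] := O5_ints rO; exists a, (- c).
  move: rAB; rewrite e => /(congr1 tup_of_cyc5)[] e0 e1 e2 e3.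
  by rewrite -!(rmorph_int rat5); apply: cyc5P => /=; rewrite ?intrN; lra.
(* The norm of a unit is a natural number dividing 1; for A' + B' phi it is the square of A'^2 + A'
   B' - B'^2, as [real_unit] requires. *)
have rn : nm5 r = 1.
  have [n1 e1] := nm5_nat rO; have [n2 e2] := nm5_nat rV.
  have : nm5 r * nm5 r^-1 = 1 by rewrite -nm5M (mulfV r0) nm5_1.
  rewrite e1 e2 -natrM => /eqP; rewrite (eqr_nat _ _ 1) muln_eq1 => /andP[/eqP->].
  by [].
have [|t [n h]] := @real_unit A' B'.
  apply: (@intr_inj rat); rewrite -[RHS]rn rAB -!(rmorph_int rat5) /nm5 /=.
  by rewrite !expr2 !(intrM, intrD, intrB); ring.
exists t, j, n; rewrite rE rAB h mulrCA mulrA //.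
Qed.

(* Residues modulo pi^3 and 5 of a + b z + c z^2 + d z^3, written in powers of pi
   (with z = 1 - pi). *)
Definition cong3 (x : cyc5) (m0 m1 m2 : int) := exists a b c d : int,
  [/\ x = Cyc5 a%:~R b%:~R c%:~R d%:~R, (5 %| a + b + c + d - m0)%Z,
      (5 %| b + 2 * c + 3 * d + m1)%Z & (5 %| c + 3 * d - m2)%Z].

Lemma cong3_ex x : x \in O5 -> exists m0 m1 m2, cong3 x m0 m1 m2.
Proof.
move=> /O5_ints[a [b [c [d ->]]]].
exists (a + b + c + d), (- (b + 2 * c + 3 * d)), (c + 3 * d), a, b, c, d.
by rewrite !subrr.
Qed.

Lemma cong3M x y m0 m1 m2 k0 k1 k2 : cong3 x m0 m1 m2 -> cong3 y k0 k1 k2 ->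
  cong3 (x * y) (m0 * k0) (m0 * k1 + m1 * k0) (m0 * k2 + m1 * k1 + m2 * k0).
Proof.
move=> [a [b [c [d [-> /dvdzP[p0 e0] /dvdzP[p1 e1] /dvdzP[p2 e2]]]]]].
move=> [a' [b' [c' [d' [-> /dvdzP[q0 f0] /dvdzP[q1 f1] /dvdzP[q2 f2]]]]]].
pose c4 := b * d' + c * c' + d * b'.
exists (a * a' + (c * d' + d * c') - c4), (a * b' + b * a' + d * d' - c4),
  (a * c' + b * b' + c * a' - c4), (a * d' + b * c' + c * b' + d * a' - c4).
split.
- by apply: cyc5P; rewrite /= !(intrB, intrD, intrM).
- have -> : m0 = a + b + c + d - p0 * 5 by lra.
  have -> : k0 = a' + b' + c' + d' - q0 * 5 by lra.
  apply/dvdzP; exists (p0 * (a' + b' + c' + d') + q0 * (a + b + c + d) - 5 * p0 * q0 - c4).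
  by rewrite /c4; ring.
- have -> : m0 = a + b + c + d - p0 * 5 by lra.
  have -> : k0 = a' + b' + c' + d' - q0 * 5 by lra.
  have -> : m1 = p1 * 5 - (b + 2 * c + 3 * d) by lra.
  have -> : k1 = q1 * 5 - (b' + 2 * c' + 3 * d') by lra.
  apply/dvdzP; exists ((a + b + c + d) * q1 + (a' + b' + c' + d') * p1
    + p0 * (b' + 2 * c' + 3 * d') + q0 * (b + 2 * c + 3 * d) - 5 * p0 * q1 - 5 * p1 * q0
    - 2 * c4 - (c * d' + d * c') - d * d').
  by rewrite /c4; ring.
have -> : m0 = a + b + c + d - p0 * 5 by lra.
have -> : k0 = a' + b' + c' + d' - q0 * 5 by lra.
have -> : m1 = p1 * 5 - (b + 2 * c + 3 * d) by lra.
have -> : k1 = q1 * 5 - (b' + 2 * c' + 3 * d') by lra.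
have -> : m2 = c + 3 * d - p2 * 5 by lra.
have -> : k2 = c' + 3 * d' - q2 * 5 by lra.
apply/dvdzP; exists ((a + b + c + d) * q2 + p0 * (c' + 3 * d') - 5 * p0 * q2 - 5 * p1 * q1
  + p1 * (b' + 2 * c' + 3 * d') + q1 * (b + 2 * c + 3 * d) + (c + 3 * d) * q0
  + p2 * (a' + b' + c' + d') - 5 * p2 * q0 - 2 * c4 - 2 * (c * d' + d * c') - 3 * (d * d')).
by rewrite /c4; ring.
Qed.

Lemma cong3_pi3 x : x \in O5 -> cong3 (pi5 ^+ 3 * x) 0 0 0.
Proof.
have p : cong3 pi5 0 1 0 by exists 1, (-1), 0, 0; split=> //; apply: cyc5P.
move=> /cong3_ex[m0 [m1 [m2 h]]]; have := cong3M p (cong3M p (cong3M p h)).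
by rewrite !mulrA -!expr2 -exprSr !(mul0r, mulr0, add0r, addr0).
Qed.

Lemma cong3_int (k : int) : cong3 k%:~R k 0 0.
Proof.
exists k, 0, 0, 0; split; rewrite ?addr0 ?subr0 ?subrr //.
by rewrite -(rmorph_int rat5).
Qed.

Lemma cong3_uniq x m0 m1 m2 k0 k1 k2 : cong3 x m0 m1 m2 -> cong3 x k0 k1 k2 ->
  [/\ (5 %| m0 - k0)%Z, (5 %| m1 - k1)%Z & (5 %| m2 - k2)%Z].
Proof.
move=> [a [b [c [d [-> e0 e1 e2]]]]] [a' [b' [c' [d' [/(congr1 tup_of_cyc5)[]]]]]].
by move=> /intr_inj<- /intr_inj<- /intr_inj<- /intr_inj<- f0 f1 f2; split; lia.
Qed.

Lemma cong3D x y m0 m1 m2 k0 k1 k2 : cong3 x m0 m1 m2 -> cong3 y k0 k1 k2 ->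
  cong3 (x + y) (m0 + k0) (m1 + k1) (m2 + k2).
Proof.
move=> [a [b [c [d [-> e0 e1 e2]]]]] [a' [b' [c' [d' [-> f0 f1 f2]]]]].
exists (a + a'), (b + b'), (c + c'), (d + d'); split; [|lia|lia|lia].
by rewrite !intrD; apply: cyc5P.
Qed.

Lemma cong3_z i : cong3 (z5 ^+ i) 1 (- i%:Z) 'C(i, 2)%:Z.
Proof.
elim: i => [|i IH]; first by rewrite expr0; exact: (cong3_int 1).
have z : cong3 z5 1 (-1) 0 by exists 0, 1, 0, 0; split=> //; apply: cyc5P.
have := cong3M z IH; rewrite -exprS binS bin1 PoszD.
by congr (cong3 _ _ _ _); lia.
Qed.

(* phi = -2 + 5 pi - 4 pi^2 = -2 (1 + 2 pi^2) modulo (pi^3, 5) *)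
Lemma cong3_phi n : cong3 (phi5 ^+ n) ((-2) ^+ n) 0 (2 * n%:Z * (-2) ^+ n).
Proof.
elim: n => [|n IH]; first by rewrite expr0; exact: (cong3_int 1).
have p : cong3 phi5 (-2) 0 (-4) by exists 0, 0, (-1), (-1); split=> //; apply: cyc5P.
have := cong3M p IH; rewrite -!exprS !(mulr0, mul0r, addr0, add0r).
by congr (cong3 _ _ _ _); rewrite (_ : n.+1%:Z = n%:Z + 1) ?exprS; [ring | lia].
Qed.

(** The product is E (1 - 2 i pi + (4 n + C(2 i, 2)) pi^2) modulo pi^3, with E prime to 5. The
    coefficient of pi gives the divisibility of i, hence of C(2 i, 2), and then that of pi^2 gives
    the divisibility of n. *)
Lemma kill_unit (i n c : nat) : vge v5 3 ((z5 ^+ i * phi5 ^+ n) ^+ 2 * c%:R ^+ 5 - 1) ->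
  (5 %| i)%N /\ (5 %| n)%N.
Proof.
pose E : int := (-2) ^+ (n * 2) * c%:Z ^+ 5.
have phO : phi5 \in O5 by apply/O5P; split.
have h : cong3 ((z5 ^+ i * phi5 ^+ n) ^+ 2 * c%:R ^+ 5 - 1)
    (E - 1) (- (2 * i%:Z) * E) (E * (4 * n%:Z) + 'C(i * 2, 2)%:Z * E).
  rewrite exprMn -!exprM.
  have := cong3D (cong3M (cong3M (cong3_z (i * 2)) (cong3_phi (n * 2))) (cong3_int (c%:Z ^+ 5)))
    (cong3_int (-1)).
  rewrite rmorphXn /= -[c%:~R]/(c%:R); congr (cong3 _ _ _ _); rewrite /E ?PoszM; ring.
have xO : (z5 ^+ i * phi5 ^+ n) ^+ 2 * c%:R ^+ 5 - 1 \in O5.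
  have [a [b [c' [d [e _ _ _]]]]] := h; rewrite e; apply/O5P; split; exact: intr_int.
move: (_ - 1) h xO => x h xO hx.
have {hx} xp : x / pi5 ^+ 3 \in O5.
  case: (eqVneq x 0) => [->|x0]; first by rewrite mul0r rpred0.
  by apply: (val5_dvd pi5_prime) => //; move: hx; rewrite /vge (negPf x0).
have p0 : pi5 ^+ 3 != 0 by rewrite expf_neq0.
have := cong3_pi3 xp; rewrite mulrC mulfVK // => h0.
have [] := cong3_uniq h h0; rewrite !subr0 => d0 d1 d2.
have E1 : ~~ (5 %| E)%Z by clear -d0; lia.
have cop (m : int) : (5 %| m * E)%Z -> (5 %| m)%Z.
  by move: E1; rewrite !dvdzE abszM Euclid_dvdM // => /negPf-> /orP[].
have i5 : (5 %| i)%N by have := cop _ d1; clear; lia.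
split=> //; move: d2; rewrite mulrC -mulrDl => /cop.
have : (5 %| 'C(i * 2, 2))%N.
  rewrite bin2 -divn2; case/dvdnP: i5 => k ->.
  by apply/dvdnP; exists (k * (k * 5 * 2).-1)%N; rewrite -(mulnK (k * (k * 5 * 2).-1 * 5) (isT : 0 < 2)%N); congr (_ %/ 2)%N; lia.
by clear; lia.
Qed.

Section Pow5.
Variables (F : fieldType) (v : F -> int).
Hypotheses (vP : valuation_axiom v) (v5' : vge v 4 5).

(** With e = x - y, the difference of fifth powers is e^5 plus 5 e times an integral element. *)
Lemma vge_pow5_sub k x y : 1 <= k -> vge v 0 x -> vge v 0 y -> vge v k (x - y) ->
  vge v (Num.min (k + 4) (5 * k)) (x ^+ 5 - y ^+ 5).
Proof.
move=> k1 x0 y0 exy; pose e := x - y.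
have -> : x ^+ 5 - y ^+ 5 = 5 * (e * (y ^+ 4 + 2 * (y ^+ 3 * e) + 2 * (y ^+ 2 * e ^+ 2) + y * e ^+ 3))
   + e ^+ 5 by rewrite /e; ring.
have e0 : vge v 0 e by apply: vge_le exy _; lia.
have i2 : vge v 0 2 by rewrite (_ : 2 = 1 + 1) // vgeD // (vge_veq (veq1 vP)).
have M0 a b : vge v 0 a -> vge v 0 b -> vge v 0 (a * b) by move=> ha hb; have := vgeM vP ha hb.
have X0 a n : vge v 0 a -> vge v 0 (a ^+ n) by move=> ha; have := vgeX vP n ha; rewrite mul0r.
apply: vgeD => //.
  have h : vge v 0 (y ^+ 4 + 2 * (y ^+ 3 * e) + 2 * (y ^+ 2 * e ^+ 2) + y * e ^+ 3).
    by rewrite !vgeD // ?M0 // ?X0 // ?M0 ?X0.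
  by have := vgeM vP v5' (vgeM vP exy h); move/vge_le; apply; rewrite ge_min; apply/orP; left; lia.
by have := vgeX vP 5 exy; move/vge_le; apply; rewrite ge_min; apply/orP; right; lia.
Qed.
End Pow5.

Lemma v5_5 : veq v5 4 5.
Proof.
have p4 : pi5 ^+ 4 != 0 by rewrite expf_neq0.
have h : veq v5 0 (5 / pi5 ^+ 4) by apply: v5_O5_eq0.
have := veqM v5P h (veqX v5P 4 v5_pi); rewrite mulfVK //.
Qed.

(** The sign and the part of the exponent of phi divisible by 5 are absorbed into y. Then y = c
    modulo pi for an integer c, so y^5 = c^5 modulo pi^5, and [kill_unit] applies to what remains of
    u. *)
Lemma fifth_power_unit u y : u \in O5 -> u^-1 \in O5 -> u != 0 -> veq v5 0 y ->
  vge v5 3 (u ^+ 2 * y ^+ 5 - 1) -> exists w, u = w ^+ 5.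
Proof.
move=> uO uV u0 y0; have [s [i [n ->]]] := unit_form uO uV u0.
have [k [m nm]] : exists (k : int) (m : nat), n = 5 * k + m%:Z.
  by exists (n %/ 5)%Z, `|(n %% 5)%Z|%N; rewrite mulrC gez0_abs ?modz_ge0 // -divz_eq.
pose w : cyc5 := (-1) ^+ s * phi5 ^ k.
have s5 : ((-1) ^+ s) ^+ 5 = (-1) ^+ s :> cyc5 by rewrite -exprM mulnC exprM -[(-1) ^+ 5]signr_odd.
have -> : (-1) ^+ s * z5 ^+ i * phi5 ^ n = z5 ^+ i * phi5 ^+ m * w ^+ 5.
  rewrite nm expfzDr ?phi5_neq0 // -exprnP exprMn s5 (_ : (phi5 ^ k) ^+ 5 = phi5 ^ (5 * k)).
    by move: (phi5 ^ _) (phi5 ^+ m) (z5 ^+ i) ((-1) ^+ s) => a b c d; ring.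
  by rewrite exprnP exprz_exp mulrC.
have w0 : veq v5 0 w.
  have ph : veq v5 0 (phi5 ^ k).
    apply/veqP; split; first exact: expfz_neq0.
    have phO (j : nat) : phi5 ^+ j \in O5 by apply: rpredX; apply/O5P; split.
    have phV (j : nat) : (phi5 ^+ j)^-1 \in O5.
      by rewrite -exprVn phi5V rpredX // rpredB ?rpred1 //; apply/O5P; split.
    case: k {nm w} => j; last first.
      by rewrite NegzE -exprnN; apply: (val5_unit pi5_prime); rewrite ?invrK // invr_eq0 expf_neq0.
    by rewrite -exprnP; apply: (val5_unit pi5_prime); rewrite // expf_neq0.
  rewrite /w -signr_odd; case: (odd s); rewrite ?expr0 ?expr1 ?mul1r // mulN1r.
  by rewrite (veqN v5P).
have Y0 : veq v5 0 (w ^+ 2 * y) by have := veqM v5P (veqX v5P 2 w0) y0.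
clearbody w.
set A := z5 ^+ i * phi5 ^+ m; have AO : A \in O5.
  by rewrite rpredM ?rpredX ?O5_z //; apply/O5P; split.
have -> : (A * w ^+ 5) ^+ 2 * y ^+ 5 - 1 = A ^+ 2 * (w ^+ 2 * y) ^+ 5 - 1 by ring.
move: (w ^+ 2 * y) Y0 => Y Y0 hY; have [c [_ hc]] := v5_residue (vge_veq Y0 (lexx 0)).
have c0 : vge v5 0 c%:R by apply: v5_O5; rewrite rpred_nat.
have YV := vge_veq Y0 (lexx 0).
have Yc := vge_pow5_sub v5P (vge_veq v5_5 (lexx 4)) (lexx 1) YV c0 hc.
have : vge v5 3 (A ^+ 2 * c%:R ^+ 5 - 1).
  have -> : A ^+ 2 * c%:R ^+ 5 - 1 = A ^+ 2 * Y ^+ 5 - 1 - A ^+ 2 * (Y ^+ 5 - c%:R ^+ 5) by ring.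
  rewrite (vgeB v5P) //; have A0 : vge v5 0 (A ^+ 2) by apply: v5_O5; rewrite rpredX.
  exact: vge_le (vgeM v5P A0 Yc) _.
case/kill_unit => /dvdnP[i' ei] /dvdnP[m' em].
by exists (z5 ^+ i' * phi5 ^+ m' * w); rewrite /A ei em !exprMn -!exprM.
Qed.

(** * Division by 1 - zeta *)

(** The Dickson polynomial: [dickson5 (x + y) (x * y) = x ^+ 5 + y ^+ 5]. For a pair of points,
    [N + M - (N - M) ^+ 2] equals V1 (1 - V1) + V2 (1 - V2), which is the second equation of
    [pair_pt]. *)
Definition dickson5 (F : comNzRingType) (T P : F) : F := T ^+ 5 - 5 * (T ^+ 3 * P) + 5 * (T * P ^+ 2).
Definition pair_pt (F : comNzRingType) (N M P T : F) :=
  N * M = P ^+ 5 /\ dickson5 T P = N + M - (N - M) ^+ 2.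

Section PairValuation.
Variables (F : fieldType) (v : F -> int).
Hypotheses (vP : valuation_axiom v).

Lemma vge_nat n : vge v 0 n%:R.
Proof.
elim: n => [|n IH]; first exact: vge0.
by rewrite -addn1 natrD vgeD // (vge_veq (veq1 vP)).
Qed.

(** If v N = v M, the relation v N + v M = 5 v P suffices. Otherwise let k be the smaller one: R has
    valuation k for k > 0 and 2 k for k < 0. As [dickson5 T P], it has valuation 5 v T, or else all
    terms have valuation at least 5 v P / 2, which exceeds k. *)
Lemma pair_val (N M P T : F) : N != 0 -> M != 0 -> pair_pt N M P T ->
  exists k : int, v N = 5 * k.
Proof.
move=> N0 M0 [NM DE].
have P0 : P != 0 by apply: contraNneq N0 => P0; move/eqP: NM; rewrite P0 expr0n mulf_eq0 (negPf M0) orbF.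
have hP := veq_val v P0; have h5 : vge v 0 5 := vge_nat 5.
have nm : v N + v M = 5 * v P.
  have /veqP[_ <-] := veqM vP (veq_val v N0) (veq_val v M0).
  by rewrite NM; have /veqP[_ ->] := veqX vP 5 hP; lia.
pose R := N + M - (N - M) ^+ 2.
suff main k : (k < v N + v M - k) -> veq v k R \/ (k < 0 /\ veq v (2 * k) R) \/ k = 0 ->
    exists l, k = 5 * l.
  have RC : N + M - (N - M) ^+ 2 = M + N - (M - N) ^+ 2 by ring.
  have key (A B : F) : v A < v B -> veq v (v A) A -> veq v (v B) B ->
      let X := A + B - (A - B) ^+ 2 in
      veq v (v A) X \/ (v A < 0 /\ veq v (2 * v A) X) \/ v A = 0.
    move=> AB hA hB X; have B1 : vge v (v A + 1) B by apply: vge_veq hB _; lia.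
    have hs := veqDl vP hA B1; have hd := veqX vP 2 (veqBl vP hA B1).
    case: (ltrgtP (v A) 0) => A0; [right; left | left | by right; right].
      split=> //; rewrite /X addrC -(veqN vP) opprD opprK -[2 * _]mulrC.
      by apply: veqBl vP _ _ _ hd _; apply: vge_veq hs _; lia.
    by apply: veqBl => //; apply: vge_veq hd _; lia.
  case: (ltrgtP (v N) (v M)) => NMlt.
  - apply: main; first by lia.
    exact: key NMlt (veq_val v N0) (veq_val v M0).
  - have [||l hl] := main (v M); first by lia.
      by rewrite /R RC; apply: key NMlt (veq_val v M0) (veq_val v N0).
    by exists (v P - l); lia.
  by exists (v N - 2 * v P); lia.
move=> kk hR; have {DE}DE : dickson5 T P = R := DE.
have TT : (T != 0 /\ 2 * v T < v P) \/ (T == 0) || (v P <= 2 * v T).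
  by case: (eqVneq T 0) => //= T0; [right | case: (ltrP (2 * v T) (v P)); [left|right]].
case: TT => [[T0 TP]|TP].
  have hT := veq_val v T0.
  have hD : veq v (5 * v T) R.
    rewrite -DE /dickson5 -addrA; apply: veqDl => //.
      by have := veqX vP 5 hT; congr (veq _ _ _); lia.
    apply: vgeD => //; rewrite ?(vgeN vP).
      apply: vge_le (vgeM vP h5 (vge_veq (veqM vP (veqX vP 3 hT) hP) (lexx _))) _; lia.
    apply: vge_le (vgeM vP h5 (vge_veq (veqM vP hT (veqX vP 2 hP)) (lexx _))) _; lia.
  case: hR => [h|[[k0 h]|->]]; last by exists 0.
    by exists (v T); apply: veq_uniq h hD.
  by exists (k - 2 * v T); have := veq_uniq h hD; lia.
(* c is 5 v P / 2 rounded up. *)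
have [c [c1 c2]] : exists c : int, 2 * c - 1 <= 5 * v P /\ 5 * v P <= 2 * c.
  by exists ((5 * v P + 1) %/ 2)%Z; lia.
have hD : vge v c R.
  rewrite -DE; case: (eqVneq T 0) TP => /= [->|T0] TP.
    by rewrite /dickson5 expr0n expr0n /= !mul0r !mulr0 subr0 addr0 vge0.
  have hT := veq_val v T0; rewrite /dickson5; apply: vgeD => //; [apply: vgeB => //|].
  - apply: vge_veq (veqX vP 5 hT) _; lia.
  - apply: vge_le (vgeM vP h5 (vge_veq (veqM vP (veqX vP 3 hT) hP) (lexx _))) _; lia.
  apply: vge_le (vgeM vP h5 (vge_veq (veqM vP hT (veqX vP 2 hP)) (lexx _))) _; lia.
case: hR => [h|[[k0 h]|->]]; last by exists 0.
  by have := veq_geF h hD; lia.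
by have := veq_geF h hD; lia.
Qed.
End PairValuation.

(* Polynomials in the golden element h (h^2 = 1 - h) as pairs of coefficients. *)
Section Golden.
Variables (F : comNzRingType) (h : F).
Hypothesis hE : h ^+ 2 = 1 - h.
Definition gev (x : F * F) : F := x.1 + x.2 * h.
Definition gmul (x y : F * F) : F * F :=
  (x.1 * y.1 + x.2 * y.2, x.1 * y.2 + x.2 * y.1 - x.2 * y.2).
Definition gadd (x y : F * F) : F * F := (x.1 + y.1, x.2 + y.2).
Definition gsub (x y : F * F) : F * F := (x.1 - y.1, x.2 - y.2).
(** This normal form turns an identity modulo h^2 = 1 - h into two identities of coefficients, which
    [ring] proves without knowing the relation. *)
Lemma gevM x y : gev x * gev y = gev (gmul x y).
Proof.
have -> : gev x * gev y = x.1 * y.1 + (x.1 * y.2 + x.2 * y.1) * h + x.2 * y.2 * h ^+ 2.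
  by rewrite /gev; ring.
by rewrite hE /gev /gmul /=; ring.
Qed.
Lemma gevD x y : gev x + gev y = gev (gadd x y). Proof. by rewrite /gev /gadd /=; ring. Qed.
Lemma gevB x y : gev x - gev y = gev (gsub x y). Proof. by rewrite /gev /gsub /=; ring. Qed.
Lemma gevc c : c = gev (c, 0). Proof. by rewrite /gev /= mul0r addr0. Qed.
End Golden.

(* For h = zeta + 1 / zeta, k = g + e and p = g e, [dvl] and [dvl'] are the products of the
   factors zeta^i g + zeta^-i e - t for i = 1, 4 and i = 2, 3, and [dvA], [dvB] those of
   (g^5 - e^5) / (g - e).  [dvZ] is the exact quotient in [dvZ_fac]. *)
Section DivisionPolynomials.
Variables (F : comNzRingType) (h k t p : F).
Definition dvA := k ^+ 2 - h ^+ 2 * p.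
Definition dvB := k ^+ 2 - (1 + h) ^+ 2 * p.
Definition dvl := k ^+ 2 + (h ^+ 2 - 4) * p - h * t * k + t ^+ 2.
Definition dvl' := k ^+ 2 + ((1 + h) ^+ 2 - 4) * p + (1 + h) * t * k + t ^+ 2.
Definition dvx := p + t * k.
Definition dvt := k + h ^+ 2 * t.
Definition dvY := dvB * dvt ^+ 2 - h ^+ 4 * dvA * dvl.
Definition dvZ := gev h
  (6 * k ^+ 7 + k ^+ 6 * t - k ^+ 5 * t ^+ 2 - 51 * (k ^+ 5 * p) - 6 * (k ^+ 4 * t ^+ 3) - 26 * (k ^+ 4 * t * p) - 23 * (k ^+ 3 * t ^+ 2 * p) + 137 * (k ^+ 3 * p ^+ 2) + 25 * (k ^+ 2 * t ^+ 3 * p) + 84 * (k ^+ 2 * t * p ^+ 2) + 113 * (k * t ^+ 2 * p ^+ 2) - 111 * (k * p ^+ 3) + 16 * (t ^+ 3 * p ^+ 2) - 14 * (t * p ^+ 3),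
   - (10 * k ^+ 7) - 2 * (k ^+ 6 * t) + 2 * (k ^+ 5 * t ^+ 2) + 84 * (k ^+ 5 * p) + 10 * (k ^+ 4 * t ^+ 3) + 45 * (k ^+ 4 * t * p) + 37 * (k ^+ 3 * t ^+ 2 * p) - 223 * (k ^+ 3 * p ^+ 2) - 41 * (k ^+ 2 * t ^+ 3 * p) - 141 * (k ^+ 2 * t * p ^+ 2) - 185 * (k * t ^+ 2 * p ^+ 2) + 178 * (k * p ^+ 3) - 26 * (t ^+ 3 * p ^+ 2) + 22 * (t * p ^+ 3)).

Hypothesis hE : h ^+ 2 = 1 - h.
Let M := gevM hE.
Let h4 : h ^+ 4 = gev h (2, -3).
Proof.
have -> : h ^+ 4 = (h ^+ 2) ^+ 2 by ring.
rewrite hE (_ : (1 - h) ^+ 2 = 1 - 2 * h + h ^+ 2); last by ring.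
by rewrite hE /gev /=; ring.
Qed.
Let h3 : (4 - h ^+ 2) * h = gev h (1, 2).
Proof.
rewrite hE (_ : _ * h = 3 * h + h ^+ 2); last by ring.
by rewrite hE /gev /=; ring.
Qed.

Lemma dvA_ev : dvA = gev h (k ^+ 2 - p, p).
Proof. by rewrite /dvA hE /gev /=; ring. Qed.
Lemma onehE : (1 + h) ^+ 2 = 2 + h.
Proof. by rewrite (_ : _ ^+ 2 = 1 + 2 * h + h ^+ 2); [rewrite hE; ring | ring]. Qed.
Lemma dvB_ev : dvB = gev h (k ^+ 2 - 2 * p, - p).
Proof. by rewrite /dvB onehE /gev /=; ring. Qed.
Lemma dvl_ev : dvl = gev h (k ^+ 2 + t ^+ 2 - 3 * p, - (k * t) - p).
Proof. by rewrite /dvl hE /gev /=; ring. Qed.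
Lemma dvl'_ev : dvl' = gev h (k ^+ 2 + k * t + t ^+ 2 - 2 * p, k * t + p).
Proof. by rewrite /dvl' onehE /gev /=; ring. Qed.
Lemma dvt_ev : dvt = gev h (k + t, - t).
Proof. by rewrite /dvt hE /gev /=; ring. Qed.
Lemma dvY_ev : dvY = gev h
  (- k ^+ 4 - k ^+ 3 * t + 6 * (k ^+ 2 * p) + 6 * (k * t * p) + 4 * (t ^+ 2 * p) - 7 * p ^+ 2,
   3 * k ^+ 4 + 3 * (k ^+ 3 * t) - 13 * (k ^+ 2 * p) - 13 * (k * t * p) - 7 * (t ^+ 2 * p) + 11 * p ^+ 2).
Proof.
rewrite /dvY (expr2 dvt) h4 dvA_ev dvB_ev dvl_ev dvt_ev !M gevB /gsub /gmul /=.
by congr (gev _ (_, _)); ring.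
Qed.

Lemma dvAB : dvA * dvB = k ^+ 4 - 3 * (k ^+ 2 * p) + p ^+ 2.
Proof. by rewrite dvA_ev dvB_ev M [RHS](gevc h) /gmul /=; congr (gev _ (_, _)); ring. Qed.

(** For k = g + e and p = g e, the five numbers zeta^i g + zeta^-i e are the roots in T of
    [dickson5 T p = dickson5 k p]. *)
Lemma dvprod : (k - t) * dvl * dvl' = dickson5 k p - dickson5 t p.
Proof.
rewrite dvl_ev dvl'_ev -mulrA M [k - t](gevc h) M [RHS](gevc h) /gmul /= /dickson5.
by congr (gev _ (_, _)); ring.
Qed.

(** Completing the square expresses the factor through k - t and k^2 - 4 p = (g - e)^2, both small
    in the integral case, which is how its valuation is found. *)
Lemma dvl4 : 4 * dvl = ((2 - h) * k - 2 * (k - t)) ^+ 2 + (4 - h ^+ 2) * (k ^+ 2 - 4 * p).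
Proof. by rewrite /dvl; ring. Qed.
Lemma dvl4' : 4 * dvl' = ((3 + h) * k - 2 * (k - t)) ^+ 2 + (4 - (1 + h) ^+ 2) * (k ^+ 2 - 4 * p).
Proof. by rewrite /dvl'; ring. Qed.

Lemma dvXid : (dvB * dvt ^+ 2 - dvA * dvl) * dvl' =
  (4 - h ^+ 2) * h * dvx * ((k - t) * dvx * dvt + h * dvA * dvl).
Proof.
rewrite h3.
have -> : h * dvA * dvl = gev h (0, 1) * (gev h (dvx, 0) * 0 + dvA * dvl) by rewrite /gev /=; ring.
have -> : (k - t) * dvx * dvt = gev h ((k - t) * dvx, 0) * dvt by rewrite -gevc.
rewrite [X in _ * X * _](gevc h dvx) mulr0 add0r (expr2 dvt) dvA_ev dvB_ev dvl_ev dvl'_ev dvt_ev.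
rewrite !M gevB gevD !M /gmul /gadd /gsub /= /dvx.
by congr (gev _ (_, _)); ring.
Qed.

(** The second equation of [pair_pt] for the quotient with denominators cleared: Z stands for the
    new N + M, the bracket for [dickson5 T P], and the last term for the new (N - M)^2. *)
Lemma dvZ_fac : dvA * dvl ^+ 2 * dvZ =
  dvB * dvt * (dvB ^+ 2 * dvt ^+ 4 - 5 * h ^+ 2 * dvA * dvB * dvt ^+ 2 * dvl
     + 5 * h ^+ 4 * dvA ^+ 2 * dvl ^+ 2) * dvl' - h * (4 - h ^+ 2) * (k - t) * dvx ^+ 2 * dvY ^+ 2.
Proof.
have -> : h * (4 - h ^+ 2) * (k - t) * dvx ^+ 2 * dvY ^+ 2 =
   gev h (1, 2) * gev h ((k - t) * dvx ^+ 2, 0) * (dvY * dvY).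
  by rewrite -h3 -gevc; ring.
have -> : 5 * h ^+ 2 * dvA * dvB * dvt ^+ 2 * dvl = gev h (5, - 5) * dvA * dvB * (dvt * dvt) * dvl.
  by rewrite hE /gev /=; ring.
have -> : 5 * h ^+ 4 * dvA ^+ 2 * dvl ^+ 2 = gev h (10, - 15) * (dvA * dvA) * (dvl * dvl).
  by rewrite h4 /gev /=; ring.
have -> : dvB ^+ 2 * dvt ^+ 4 = dvB * dvB * ((dvt * dvt) * (dvt * dvt)) by ring.
rewrite (expr2 dvl) dvA_ev dvB_ev dvl_ev dvl'_ev dvt_ev dvY_ev /dvZ.
rewrite !M gevB gevD !M gevB /gmul /gadd /gsub /= /dvx.
by congr (gev _ (_, _)); ring.
Qed.

(** The equation N M = P^5 for the quotient, whose N and M are multiples of Z +- h^3 d m x Y with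
    d^2 = h^2 - 4 and m^2 = k^2 - 4 p. *)
Lemma dvZ_norm : dvZ ^+ 2 - h ^+ 6 * (h ^+ 2 - 4) * (k ^+ 2 - 4 * p) * dvx ^+ 2 * dvY ^+ 2 =
  4 * h ^+ 10 * dvA ^+ 3 * dvB * dvl * dvl' ^+ 2.
Proof.
have h8 : h ^+ 8 = gev h (13, -21).
  have -> : h ^+ 8 = h ^+ 4 * h ^+ 4 by ring.
  by rewrite h4 M /gmul /=; congr (gev _ (_, _)); ring.
have h6 : h ^+ 6 = gev h (5, -8).
  have -> : h ^+ 6 = h ^+ 4 * (1 - h) by rewrite -hE; ring.
  have -> : 1 - h = gev h (1, -1) by rewrite /gev /=; ring.
  by rewrite h4 M /gmul /=; congr (gev _ (_, _)); ring.
have -> : h ^+ 6 * (h ^+ 2 - 4) = gev h (-7, 11).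
  have -> : h ^+ 6 * (h ^+ 2 - 4) = h ^+ 8 - gev h (4, 0) * h ^+ 6 by rewrite -gevc; ring.
  by rewrite h8 h6 M gevB /gmul /gsub /=; congr (gev _ (_, _)); ring.
have -> : 4 * h ^+ 10 = gev h (136, -220).
  have -> : 4 * h ^+ 10 = gev h (4, 0) * (h ^+ 6 * h ^+ 4) by rewrite -gevc; ring.
  by rewrite h4 h6 !M /gmul /=; congr (gev _ (_, _)); ring.
have -> : gev h (-7, 11) * (k ^+ 2 - 4 * p) * dvx ^+ 2 * dvY ^+ 2 =
   gev h (-7, 11) * gev h ((k ^+ 2 - 4 * p) * dvx ^+ 2, 0) * (dvY * dvY) by rewrite -gevc; ring.
have -> : gev h (136, - 220) * dvA ^+ 3 * dvB * dvl * dvl' ^+ 2 =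
   gev h (136, - 220) * (dvA * dvA * dvA) * dvB * dvl * (dvl' * dvl') by ring.
rewrite (expr2 dvZ) dvA_ev dvB_ev dvl_ev dvl'_ev dvY_ev /dvZ.
rewrite !M gevB /gmul /gsub /= /dvx.
by congr (gev _ (_, _)); ring.
Qed.
End DivisionPolynomials.

(** The polynomials are replaced by independent letters to keep [field] feasible. The second
    identity gives N M = P^5; the first gives the other equation once the third has replaced (m A
    B)^2. *)
Lemma pair_pt_of_identities (F : fieldType) (h d m k t x A B l l' s Y Z : F) :
  (2 : F) != 0 -> h != 0 -> l != 0 -> l' != 0 ->
  A * l ^+ 2 * Z = B * s * (B ^+ 2 * s ^+ 4 - 5 * h ^+ 2 * A * B * s ^+ 2 * l
     + 5 * h ^+ 4 * A ^+ 2 * l ^+ 2) * l' + h * d ^+ 2 * (k - t) * x ^+ 2 * Y ^+ 2 ->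
  Z ^+ 2 - h ^+ 6 * d ^+ 2 * m ^+ 2 * x ^+ 2 * Y ^+ 2 = 4 * h ^+ 10 * A ^+ 3 * B * l * l' ^+ 2 ->
  (k - t) * l * l' = (m * A * B) ^+ 2 ->
  let c := A * B ^+ 2 / (2 * h ^+ 5 * l ^+ 3 * l') in
  pair_pt (c * (Z + h ^+ 3 * d * m * x * Y)) (c * (Z - h ^+ 3 * d * m * x * Y))
    (A * B / l) (B * s / (h * l)).
Proof.
move=> n2 h0 l0 l0' Zf Zn G2 c; split.
  have -> : c * (Z + h ^+ 3 * d * m * x * Y) * (c * (Z - h ^+ 3 * d * m * x * Y)) =
     c ^+ 2 * (Z ^+ 2 - h ^+ 6 * d ^+ 2 * m ^+ 2 * x ^+ 2 * Y ^+ 2) by ring.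
  by rewrite Zn /c; field; rewrite n2 h0 l0 l0'.
have -> : c * (Z + h ^+ 3 * d * m * x * Y) + c * (Z - h ^+ 3 * d * m * x * Y) =
   B ^+ 2 / (h ^+ 5 * l ^+ 5 * l') * (A * l ^+ 2 * Z).
  by rewrite /c; field; rewrite n2 h0 l0 l0'.
have -> : (c * (Z + h ^+ 3 * d * m * x * Y) - c * (Z - h ^+ 3 * d * m * x * Y)) ^+ 2 =
   (m * A * B) ^+ 2 * (B * d * x * Y / (h ^+ 2 * l ^+ 3 * l')) ^+ 2.
  by rewrite /c; field; rewrite n2 h0 l0 l0'.
by rewrite -G2 Zf /dickson5; field; rewrite h0 l0 l0'.
Qed.

Section Division.
Variables (F : fieldType) (h d k t p m : F).
Hypotheses (hE : h ^+ 2 = 1 - h) (dE : d ^+ 2 = h ^+ 2 - 4) (mE : m ^+ 2 = k ^+ 2 - 4 * p).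
Hypotheses (n2 : (2 : F) != 0).
Let A := dvA h k p. Let B := dvB h k p.
Let l := dvl h k t p. Let l' := dvl' h k t p.
Hypotheses (l0 : l != 0) (l0' : l' != 0).
Hypothesis G2 : (k - t) * l * l' = (m * A * B) ^+ 2.
Let x := dvx k t p. Let s := dvt h k t.

Lemma golden_neq0 : h != 0.
Proof.
by apply/eqP=> h0; move: hE; rewrite h0 expr0n subr0 => /eqP; rewrite eq_sym oner_eq0.
Qed.

Let P := A * B / l.
Let T := B * s / (h * l).
Let mu := m * A * B * x / (l * l').

Lemma division : exists N M, N - M = d * mu * (T ^+ 2 - h ^+ 2 * P) /\ pair_pt N M P T.
Proof.
have h0 := golden_neq0.
have Zf := dvZ_fac k t p hE; have Zn := dvZ_norm k t p hE.
rewrite -/A -/B -/l -/l' -/x -/s in Zf Zn; rewrite -dE -mE in Zn.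
set Z := dvZ h k t p in Zf Zn; set Y := dvY h k t p in Zf Zn.
have Zf' : A * l ^+ 2 * Z = B * s * (B ^+ 2 * s ^+ 4 - 5 * h ^+ 2 * A * B * s ^+ 2 * l
     + 5 * h ^+ 4 * A ^+ 2 * l ^+ 2) * l' + h * d ^+ 2 * (k - t) * x ^+ 2 * Y ^+ 2.
  by rewrite Zf dE; ring.
have Q := pair_pt_of_identities n2 h0 l0 l0' Zf' Zn G2.
eexists; eexists; split; last exact: Q.
have YE : Y = B * s ^+ 2 - h ^+ 4 * A * l by [].
rewrite YE /mu /P /T; clearbody A B l l' x s.
by field; rewrite n2 h0 l0 l0'.
Qed.

(** This decides the size of the new N - M. In the integral case the last term is negligible against
    (1 + 2 h) P, where 1 + 2 h is a square root of 5; in the other case it dominates. *)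
Lemma division_X : T ^+ 2 - h ^+ 2 * P = (1 + 2 * h) * P * (1 + (1 + h) * x / l') - d ^+ 2 * mu ^+ 2 * T.
Proof.
have h0 := golden_neq0; have E := dvXid k t p hE; rewrite -/A -/B -/l -/l' -/x -/s in E.
have muE : mu ^+ 2 = (k - t) * x ^+ 2 / (l * l').
  have -> : mu ^+ 2 = (m * A * B) ^+ 2 * (x / (l * l')) ^+ 2.
    by rewrite /mu; clearbody A B l l' x; field; rewrite l0 l0'.
  by rewrite -G2; clearbody l l' x; field; rewrite l0 l0'.
have E' : B * s ^+ 2 = A * l + (4 - h ^+ 2) * h * x * ((k - t) * x * s + h * A * l) / l'.
  by rewrite -E; clearbody A B l l' s; field.
have -> : (1 + 2 * h) * P * (1 + (1 + h) * x / l') = P * ((1 - h ^+ 4) / h ^+ 2 + (4 - h ^+ 2) * x / l').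
  have -> : (1 - h ^+ 4) / h ^+ 2 = 1 + 2 * h.
    have -> : 1 - h ^+ 4 = (1 + 2 * h) * h ^+ 2; last by field.
    rewrite (_ : h ^+ 4 = (h ^+ 2) ^+ 2); last by ring.
    rewrite hE; have -> : (1 - h) ^+ 2 = 1 - 2 * h + h ^+ 2 by ring.
    have -> : (1 + 2 * h) * (1 - h) = 1 + h - 2 * h ^+ 2 by ring.
    by rewrite hE; ring.
  have -> : 4 - h ^+ 2 = (1 + 2 * h) * (1 + h).
    have -> : (1 + 2 * h) * (1 + h) = 1 + 3 * h + 2 * h ^+ 2 by ring.
    by rewrite hE; ring.
  by ring.
rewrite muE dE /P.
have -> : T ^+ 2 = B * (B * s ^+ 2) / (h ^+ 2 * l ^+ 2).
  by rewrite /T; clearbody B s l; field; rewrite l0 h0.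
by rewrite E' /T; clearbody A B l l' x s; field; rewrite h0 l0 l0'.
Qed.

End Division.

Lemma dvx4 (F : comNzRingType) (k t p m : F) : m ^+ 2 = k ^+ 2 - 4 * p ->
  4 * dvx k t p = 5 * k ^+ 2 - m ^+ 2 - 4 * (k - t) * k.
Proof. by move=> ->; rewrite /dvx; ring. Qed.

Lemma pow5_diff (F : comNzRingType) (h g e : F) : h ^+ 2 = 1 - h ->
  g ^+ 5 - e ^+ 5 = (g - e) * dvA h (g + e) (g * e) * dvB h (g + e) (g * e).
Proof. by move=> hE; rewrite -mulrA dvAB //; ring. Qed.

(** * Residues modulo pi and one division in the integral case *)

Section Residues.
Variables (F : fieldType) (v : F -> int).
Hypotheses (vP : valuation_axiom v) (v5 : veq v 4 (5 : F)).

(** Residues in F_5 are represented by integers, so that the residue of an expression is computed by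
    evaluation. *)
Definition rs (x : F) (n : int) := vge v 1 (x - n%:~R).

Lemma vge_int (n : int) : vge v 0 n%:~R.
Proof. by case: n => n; rewrite ?NegzE ?mulrNz ?(vgeN vP) -?pmulrn vge_nat. Qed.
Lemma rs_ge x n : rs x n -> vge v 0 x.
Proof. by move=> hx; rewrite -(subrK n%:~R x) (vgeD vP) ?vge_int // (vge_le hx). Qed.
Lemma rsc n : rs n%:~R n. Proof. by rewrite /rs subrr vge0. Qed.
Lemma rs0 x : vge v 1 x -> rs x 0. Proof. by rewrite /rs subr0. Qed.
Lemma rsD x y a b : rs x a -> rs y b -> rs (x + y) (a + b).
Proof. by move=> hx hy; rewrite /rs rmorphD opprD addrACA; apply: vgeD. Qed.
Lemma rsN x a : rs x a -> rs (- x) (- a).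
Proof. by move=> hx; rewrite /rs rmorphN -opprD (vgeN vP). Qed.
Lemma rsB x y a b : rs x a -> rs y b -> rs (x - y) (a - b).
Proof. by move=> hx hy; apply: rsD => //; apply: rsN. Qed.
Lemma rsM x y a b : rs x a -> rs y b -> rs (x * y) (a * b).
Proof.
move=> hx hy; rewrite /rs rmorphM /=.
have -> : x * y - a%:~R * b%:~R = (x - a%:~R) * y + a%:~R * (y - b%:~R) by ring.
by apply: (vgeD vP); [rewrite -[1]addr0 | rewrite -[1]add0r]; apply: (vgeM vP) => //;
  [apply: rs_ge hy | apply: vge_int].
Qed.
Lemma rsX x a n : rs x a -> rs (x ^+ n) (a ^+ n).
Proof.
move=> hx; elim: n => [|n IH]; first by rewrite !expr0; apply: (rsc 1).
by rewrite !exprS; apply: rsM.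
Qed.
Lemma rs_dvd a : (5 %| a)%Z -> vge v 1 (a%:~R : F).
Proof.
move=> /dvdzP[b ->]; rewrite rmorphM /= -[1]add0r; apply: (vgeM vP (vge_int b)).
exact: vge_veq v5 _.
Qed.
Lemma rs_mod x a b : rs x a -> (5 %| a - b)%Z -> rs x b.
Proof.
move=> hx ab; rewrite /rs.
have -> : x - b%:~R = (x - a%:~R) + (a - b)%:~R by rewrite rmorphB /=; ring.
by apply: vgeD => //; apply: rs_dvd.
Qed.
Lemma veq_prime5 (a : int) : ~~ (5 %| a)%Z -> veq v 0 (a%:~R : F).
Proof.
move=> na; have cop : coprimez a 5 by rewrite /coprimez gcdzC -[_ == _]/(coprime 5 `|a|) prime_coprime.
have [[u w] /= uw] := coprimezP a 5 cop.
have E : (u%:~R : F) * a%:~R = 1 - w%:~R * 5.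
  have := congr1 (fun z : int => z%:~R : F) uw; rewrite rmorphD !rmorphM /= => e.
  by apply/eqP; rewrite eq_sym subr_eq; apply/eqP; exact: esym e.
have := @veqBl F v vP 0 1 (w%:~R * 5) (veq1 vP).
rewrite -E => /(_ _)/veqP[].
  by rewrite -[0 + 1]addr0 addrC; apply: (vgeM vP (vge_int w)); apply: vge_veq v5 _.
rewrite mulf_eq0 negb_or => /andP[u0 a0]; rewrite vP.1 // => h0.
have := vge_int a; have := vge_int u; rewrite /veq /vge (negPf u0) (negPf a0) /=; lia.
Qed.
Lemma rs_unit x a : rs x a -> ~~ (5 %| a)%Z -> veq v 0 x.
Proof. by move=> hx na; rewrite -(subrK a%:~R x) addrC; apply: veqDl => //; apply: veq_prime5. Qed.
Lemma rs_uniq x a b : rs x a -> rs x b -> (5 %| a - b)%Z.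
Proof.
move=> ha hb; apply/negPn/negP => na; have := rsB ha hb; rewrite subrr => /rs_unit/(_ na)/veqP[].
by rewrite eqxx.
Qed.
Lemma rsV x a b : rs x a -> (5 %| a * b - 1)%Z -> rs x^-1 b.
Proof.
move=> hx ab; have na : ~~ (5 %| a)%Z.
  apply/negP=> /dvdzP[k ak]; move/dvdzP: ab => [l]; rewrite ak => e.
  have : 5 * (k * b - l) = 1 by rewrite mulrBr (mulrC 5 l) -e; ring.
  by move: (k * b - l) => w; lia.
have x0 := rs_unit hx na.
rewrite /rs (_ : x^-1 - b%:~R = x^-1 * (1 - x * b%:~R)); last by field; apply: veq_neq0 x0.
rewrite -[1]add0r; apply: (vgeM vP); first by have := veqV vP x0; rewrite oppr0 => /vge_veq; apply.
have h1 : rs (x * b%:~R - 1%:~R) 0 by apply: rs_mod (rsB (rsM hx (rsc b)) (rsc 1)) _; rewrite subr0.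
by move: h1; rewrite /rs subr0 -(vgeN vP) opprB.
Qed.
Lemma rsF x y a b b' : rs x a -> rs y b -> (5 %| b * b' - 1)%Z -> rs (x / y) (a * b').
Proof. by move=> hx hy hb; apply: rsM => //; apply: rsV hb. Qed.
(** For k >= 2 the term 5 (y - 1) dominates; at k = 1 it has the same valuation 5 as (y - 1)^5. *)
Lemma v_pow5B1 y k : 2 <= k -> veq v k (y - 1) -> veq v (k + 4) (y ^+ 5 - 1).
Proof.
move=> k2 hy; set e := y - 1 in hy.
have -> : y ^+ 5 - 1 = 5 * e + (5 * (e ^+ 2 * (2 + 2 * e + e ^+ 2)) + e ^+ 5) by rewrite /e; ring.
apply: veqDl => //; first by have := veqM vP v5 hy; congr (veq _ _ _); lia.
apply: (vgeD vP); last by apply: vge_veq (veqX vP 5 hy) _; lia.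
have he2 := veqX vP 2 hy.
apply: vge_le (vgeM vP (vge_veq v5 (lexx _)) (vgeM vP (vge_veq he2 (lexx _)) (l := 0) _)) _; last by lia.
apply: (vgeD vP); last by apply: vge_veq he2 _; lia.
apply: (vgeD vP); first exact: (vge_int 2).
by apply: vge_le (vgeM vP (vge_int 2) (vge_veq hy (lexx _))) _; lia.
Qed.

(** If v N and v M differed, v (N - M) would be the smaller of the two, hence less than their mean
    c. *)
Lemma veq_balance (N M P : F) (c w : int) : P != 0 -> N * M = P ^+ 5 -> 5 * v P = 2 * c ->
  veq v w (N - M) -> c < w -> [/\ veq v c N, veq v c M & veq v (w - c) (N / M - 1)].
Proof.
move=> P0 NM vPc NMv cw.
have N0 : N != 0 by apply: contraNneq (expf_neq0 5 P0) => N0; rewrite -NM N0 mul0r.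
have M0 : M != 0 by apply: contraNneq (expf_neq0 5 P0) => M0; rewrite -NM M0 mulr0.
have vNM : v N + v M = 2 * c.
  by rewrite -vP.1 // NM; have /veqP[_ ->] := veqX vP 5 (veq_val v P0); rewrite -vPc mulrC.
have [vN vM] : v N = c /\ v M = c.
  case: (ltrgtP (v N) (v M)) => lt.
  - have := @veqBl _ _ vP _ _ M (veq_val v N0); rewrite (vge_veq (veq_val v M0)); last by lia.
    by move=> /(_ isT)/(veq_uniq NMv); lia.
  - have := @veqBl _ _ vP _ _ N (veq_val v M0); rewrite (vge_veq (veq_val v N0)); last by lia.
    by rewrite -(veqN vP) opprB => /(_ isT)/(veq_uniq NMv); lia.
  - by lia.
have hM : veq v c M by rewrite -vM veq_val.
split=> //; first by rewrite -vN veq_val.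
by have -> : N / M - 1 = (N - M) / M; [field | apply: veqF].
Qed.

Variable h : F.
Hypothesis hE : h ^+ 2 = 1 - h.
Let r := 1 + 2 * h.
Lemma rE2 : r ^+ 2 = 5.
Proof.
by rewrite /r (_ : _ ^+ 2 = 1 + 4 * h + 4 * h ^+ 2); [rewrite hE; ring | ring].
Qed.
Lemma v_r : veq v 2 r.
Proof.
have r0 : r != 0 by apply: contraTneq (veq_neq0 v5) => r0; rewrite -rE2 r0 expr0n eqxx.
have := veqX vP 2 (veq_val v r0); rewrite rE2 => /(veq_uniq v5).
by rewrite /veq r0 => h4; apply/eqP; lia.
Qed.
Lemma rs_h : rs h 2.
Proof.
have -> : h = (r - 1) / 2%:~R.
  rewrite /r; field; apply: veq_neq0 (veq_prime5 (a := 2) isT).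
apply: rs_mod (rsF (b' := 3) (rsB (rs0 _) (rsc 1)) (rsc 2) isT) _ => //.
exact: vge_veq v_r _.
Qed.
Lemma h_twoB : 2 - h = r * h.
Proof. by rewrite /r (_ : _ * h = h + 2 * h ^+ 2); [rewrite hE; ring | ring]. Qed.
Lemma h_threeD : 3 + h = r * (1 + h).
Proof. by rewrite /r (_ : _ * (1 + h) = 1 + 3 * h + 2 * h ^+ 2); [rewrite hE; ring | ring]. Qed.
Lemma h_fourB : 4 - h ^+ 2 = r * (1 + h).
Proof. by rewrite -h_threeD hE; ring. Qed.
Lemma h_fourB' : 4 - (1 + h) ^+ 2 = r * h.
Proof. by rewrite -h_twoB onehE //; ring. Qed.

(** X has the valuation 2 of r P (1 + W), the other term having valuation at least 3; the factors d
    and mu then bring N - M to n + 3. *)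
Lemma kt1_arith (d N M P T W mu X : F) (n : int) : veq v 1 d -> 2 <= n -> veq v n mu -> vge v 0 T -> veq v 0 P ->
  veq v 0 (1 + W) -> N * M = P ^+ 5 -> N - M = d * mu * X ->
  X = r * P * (1 + W) - d ^+ 2 * mu ^+ 2 * T ->
  [/\ veq v 0 N, veq v 0 M, veq v (n + 3) (N / M - 1) & vge v 3 (d ^+ 2 * mu ^+ 2 * T)].
Proof.
move=> vd n2' muv Tv Pv W1v NM NMB XE.
have smallv : vge v 3 (d ^+ 2 * mu ^+ 2 * T).
  have := vgeM vP (vge_veq (veqM vP (veqX vP 2 vd) (veqX vP 2 muv)) (lexx _)) Tv.
  by move/vge_le; apply; lia.
have Xv : veq v 2 X.
  by rewrite XE; apply: (veqBl vP) => //; have := veqM vP (veqM vP v_r Pv) W1v.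
have NMv : veq v (n + 3) (N - M).
  rewrite NMB; have := veqM vP (veqM vP vd muv) Xv.
  by congr (veq _ _ _); lia.
have /veqP[P0 vP0] := Pv.
have [||hN hM hNM] := @veq_balance N M P 0 _ P0 NM _ NMv; rewrite ?vP0 //; first by lia.
by move: hNM; rewrite subr0.
Qed.

End Residues.

(* The condition on (t, g e) for g^5 and e^5 to be the N and M of a pair of points. *)
Definition fermat_pt (F : comNzRingType) (g e t : F) :=
  g ^+ 5 + e ^+ 5 - dickson5 t (g * e) = (g ^+ 5 - e ^+ 5) ^+ 2.

Section Descent.
Variables (F : fieldType) (v : F -> int) (h d : F).
Hypotheses (vP : valuation_axiom v) (v5 : veq v 4 (5 : F)) (vd : veq v 1 d).
Hypotheses (hE : h ^+ 2 = 1 - h) (dE : d ^+ 2 = h ^+ 2 - 4).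
Hypothesis res : forall x, vge v 0 x -> exists2 c : nat, (c < 5)%N & vge v 1 (x - c%:R).
Let r := 1 + 2 * h.
Let rs := rs v.
Let rsM := rsM vP. Let rsB := rsB vP. Let rsD := rsD vP. Let rsX := rsX vP. Let rsN := rsN vP.
Let rsc := rsc v. Let rsF := rsF vP v5. Let rsV := rsV vP v5. Let rs_mod := rs_mod vP v5.
Let rs_unit := rs_unit vP v5. Let rs0 := @rs0 F v.
Let rs_h : rs h 2 := rs_h vP v5 hE.
Let v_r : veq v 2 r := v_r vP v5 hE.
Let rE2 : r ^+ 2 = 5 := rE2 hE.
Let r0 : r != 0 := veq_neq0 v_r.

Let nat0 (n : int) : ~~ (5 %| n)%Z -> (n%:~R : F) != 0.
Proof. by move=> hn; apply: veq_neq0 (veq_prime5 vP v5 hn). Qed.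
Let n2 : (2 : F) != 0 := nat0 (n := 2) isT.
Let n4 : (4 : F) != 0 := nat0 (n := 4) isT.

Section Normalized.
(* The names ending in 1 are the quantities divided by their power of [r], a square root of 5,
   so that they have residues. *)
Variables (g e t : F) (c : int) (b : int) (u : F).
Hypotheses (cP : c \in [:: 1; 2; -1; -2 : int]) (bP : b \in [:: 0; 1; 2; -1; -2 : int]).
Hypotheses (gc : rs g c) (eE : g - e = u * g * d ^+ 2) (ub : rs u b) (k3 : vge v 3 (g + e - t)).
Hypothesis gF : fermat_pt g e t.
Let k := g + e. Let p := g * e. Let m := g - e.
Let A := dvA h k p. Let B := dvB h k p. Let l := dvl h k t p. Let l' := dvl' h k t p.
Let x := dvx k t p.

(** Runs through the residues c and b, after which the goals are decided by computation. *)
Ltac byres := move: (cP) (bP); rewrite !inE; do ?case/orP; (move/eqP=> -> || move=> _); do ?case/orP; (move/eqP=> -> || move=> _).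

Let r1 : rs r 0. Proof. by apply: rs0; apply: vge_veq v_r _. Qed.
Let h1 : rs (1 + h) 3. Proof. exact: rsD (rsc 1) rs_h. Qed.
Let d2E : d ^+ 2 = - (r * (1 + h)). Proof. by rewrite dE -(h_fourB hE); ring. Qed.
Let d2 : rs (d ^+ 2) 0. Proof. by rewrite d2E; apply: rs_mod (rsN (rsM r1 h1)) _. Qed.
Let c0 : veq v 0 g. Proof. by apply: rs_unit gc _; byres. Qed.
Let mr : rs m 0. Proof. by rewrite /m eE; apply: rs_mod (rsM (rsM ub gc) d2) _; rewrite mulr0. Qed.
Let er : rs e c.
Proof. by rewrite (_ : e = g - m); [apply: rs_mod (rsB gc mr) _; rewrite subr0 subrr | rewrite /m; ring]. Qed.
Let kr : rs k (2 * c).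
Proof. by apply: rs_mod (rsD gc er) _; rewrite mulr_natl mulr2n subrr. Qed.
Let pr : rs p (c ^+ 2) := rsM gc er.
Let m2E : m ^+ 2 = 5 * (u ^+ 2 * g ^+ 2 * (1 + h) ^+ 2).
Proof. by rewrite /m eE -rE2 d2E; ring. Qed.
Let M2 := u ^+ 2 * g ^+ 2 * (1 + h) ^+ 2.
Let M2r : rs M2 (- (b * c) ^+ 2).
Proof. by apply: rs_mod (rsM (rsM (rsX 2 ub) (rsX 2 gc)) (rsX 2 h1)) _; byres. Qed.
Let kp : m ^+ 2 = k ^+ 2 - 4 * p. Proof. by rewrite /m /k /p; ring. Qed.
Let l0r : rs ((k - t) / r) 0.
Proof. by apply: rs0; have := vgeF vP k3 v_r; apply. Qed.

Let A1 := (1 + h) * p + r * M2.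
Let AE : A = r * A1.
Proof.
have -> : A = (4 - h ^+ 2) * p + m ^+ 2 by rewrite /A /dvA kp; ring.
by rewrite (h_fourB hE) m2E -/M2 -rE2 -/r /A1; ring.
Qed.
Let A1r : rs A1 (3 * c ^+ 2).
Proof. by apply: rs_mod (rsD (rsM h1 pr) (rsM r1 M2r)) _; rewrite mul0r addr0 subrr. Qed.
Let B1 := h * p + r * M2.
Let BE : B = r * B1.
Proof.
have -> : B = (4 - (1 + h) ^+ 2) * p + m ^+ 2 by rewrite /B /dvB kp; ring.
by rewrite (h_fourB' hE) m2E -/M2 -rE2 -/r /B1; ring.
Qed.
Let B1r : rs B1 (2 * c ^+ 2).
Proof. by apply: rs_mod (rsD (rsM rs_h pr) (rsM r1 M2r)) _; rewrite mul0r addr0 subrr. Qed.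
Let l1 := ((h * k - 2 * ((k - t) / r)) ^+ 2 + r * (1 + h) * M2) / 4.
Let lE : l = 5 * l1.
Proof.
suff : 4 * l = 4 * (5 * l1) by apply: mulfI.
rewrite /l dvl4 (h_twoB hE) (h_fourB hE) -kp m2E -/M2 -/r /l1 -rE2.
move: r0; generalize r => q ?; field; rewrite n4 //.
Qed.
Let l1r : rs l1 (- c ^+ 2).
Proof.
have := rsF (b' := 4) (rsD (rsX 2 (rsB (rsM rs_h kr) (rsM (rsc 2) l0r))) (rsM (rsM r1 h1) M2r)) (rsc 4) isT.
by move/rs_mod; apply; byres.
Qed.
Let l1' := (((1 + h) * k - 2 * ((k - t) / r)) ^+ 2 + r * h * M2) / 4.
Let lE' : l' = 5 * l1'.
Proof.
suff : 4 * l' = 4 * (5 * l1') by apply: mulfI.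
rewrite /l' dvl4' (h_threeD hE) (h_fourB' hE) -kp m2E -/M2 -/r /l1' -rE2.
move: r0; generalize r => q ?; field; rewrite n4 //.
Qed.
Let l1r' : rs l1' (- c ^+ 2).
Proof.
have := rsF (b' := 4) (rsD (rsX 2 (rsB (rsM h1 kr) (rsM (rsc 2) l0r))) (rsM (rsM r1 rs_h) M2r)) (rsc 4) isT.
by move/rs_mod; apply; byres.
Qed.
Let l1v : veq v 0 l1. Proof. by apply: rs_unit l1r _; byres. Qed.
Let l1v' : veq v 0 l1'. Proof. by apply: rs_unit l1r' _; byres. Qed.
Let n5 := veq_neq0 v5.
Let l1n := veq_neq0 l1v. Let l1n' := veq_neq0 l1v'.
Let G2 : (k - t) * l * l' = (m * A * B) ^+ 2.
Proof. by rewrite dvprod // /A /B /m /k /p -pow5_diff // -gF /dickson5; ring. Qed.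
Let L1 := M2 * (A1 * B1) ^+ 2 / (l1 * l1').
(** The bound v(k - t) >= 3 improves itself: l and l' are 5 times units, A and B are r times units,
    and m^2 is divisible by 5, so [G2] makes k - t divisible by 5. *)
Let L1E : k - t = 5 * L1.
Proof.
have E : (m * A * B) ^+ 2 = m ^+ 2 * (A * B) ^+ 2 by ring.
have -> : k - t = (m * A * B) ^+ 2 / (l * l') by rewrite -G2 lE lE'; field; rewrite n5 l1n l1n'.
rewrite E m2E -/M2 AE BE lE lE' /L1.
have -> : (r * A1 * (r * B1)) ^+ 2 = 25 * (A1 * B1) ^+ 2.
  by rewrite (_ : 25 = r ^+ 2 * r ^+ 2); [ring | rewrite rE2; ring].
by field; rewrite l1n l1n' n5.
Qed.
Let ABr : rs (A1 * B1) 1. Proof. by apply: rs_mod (rsM A1r B1r) _; byres. Qed.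
Let llr : rs (l1 * l1') 1. Proof. by apply: rs_mod (rsM l1r l1r') _; byres. Qed.
Let L1r : rs L1 (- (b * c) ^+ 2).
Proof. by apply: rs_mod (rsF (b' := 1) (rsM M2r (rsX 2 ABr)) llr _) _; byres. Qed.
Let x1 := (k ^+ 2 - M2 - 4 * (L1 * k)) / 4.
Let xE : x = 5 * x1.
Proof.
suff : 4 * x = 4 * (5 * x1) by apply: mulfI.
by rewrite /x (dvx4 t kp) m2E -/M2 L1E /x1; field.
Qed.
Let x1r : rs x1 (- c ^+ 2 * (4 + b ^+ 2 + 8 * b ^+ 2 * c)).
Proof.
have := rsF (b' := 4) (rsB (rsB (rsX 2 kr) M2r) (rsM (rsc 4) (rsM L1r kr))) (rsc 4) isT.
by move/rs_mod; apply; byres.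
Qed.

(** For c = 1 the residue of x1 vanishes when b = +-2, and that of 1 + W when b = +-1; for every
    other pair both are units. *)
Hypothesis bc : (b == 0) || (c != 1).
Let x1v : veq v 0 x1. Proof. by apply: rs_unit x1r _; move: bc; byres. Qed.
Let W := (1 + h) * x1 / l1'.
Let Wr : rs W (2 - 2 * b ^+ 2 - b ^+ 2 * c).
Proof. by apply: rs_mod (rsF (b' := - c ^+ 2) (rsM h1 x1r) l1r' _) _; byres. Qed.
Let W1v : veq v 0 (1 + W).
Proof. by apply: rs_unit (rsD (rsc 1) Wr) _; move: bc; byres. Qed.

Let s := dvt h k t.
Let P := A * B / l.
Let T := B * s / (h * l).
Let mu := m * A * B * x / (l * l').
Let h0 : h != 0 := golden_neq0 hE.
Let ln : l != 0. Proof. by rewrite lE mulf_neq0. Qed.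
Let ln' : l' != 0. Proof. by rewrite lE' mulf_neq0. Qed.

Let A1v : veq v 0 A1. Proof. by apply: rs_unit A1r _; byres. Qed.
Let B1v : veq v 0 B1. Proof. by apply: rs_unit B1r _; byres. Qed.
Let PE : P = A1 * B1 / l1.
Proof. by rewrite /P AE BE lE -rE2; move: r0; generalize r => q q0; clearbody A1 B1; field; rewrite l1n q0. Qed.
Let Pv : veq v 0 P.
Proof. by rewrite PE; have := veqF vP (veqM vP A1v B1v) l1v. Qed.
Let TE : T = B1 * (h * k - h ^+ 2 * ((k - t) / r)) / (h * l1).
Proof.
have -> : T = B * (r * (h * k - h ^+ 2 * ((k - t) / r))) / (h * l).
  rewrite /T; congr (_ * _ / _); rewrite /s /dvt.
  have -> : k + h ^+ 2 * t = (r * h) * k - h ^+ 2 * (k - t).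
    by rewrite -(h_twoB hE) (_ : 2 - h = 1 + h ^+ 2); [ring | rewrite hE; ring].
  by move: r0; generalize r => q q0; field.
rewrite BE lE -rE2; move: r0; generalize r => q q0; clearbody B1.
by field; rewrite h0 l1n q0.
Qed.
Let Tr : rs T c.
Proof.
rewrite TE; have hr := rsM B1r (rsB (rsM rs_h kr) (rsM (rsX 2 rs_h) l0r)).
by apply: rs_mod (rsF (b' := 2 * c ^+ 2) hr (rsM rs_h l1r) _) _; byres.
Qed.
Let muE : mu = m * (A1 * B1 * x1 / (l1 * l1')).
Proof.
have -> : mu = m * (r ^+ 2 * (A1 * B1) * x) / (l * l').
  by rewrite /mu AE BE; clearbody A1 B1; ring.
by rewrite rE2 xE lE lE'; clearbody A1 B1; field; rewrite l1n l1n' n5.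
Qed.

(** For b = 0 the residues of 1 + W and 1 + h agree, so T^2 - 4 P is smaller than r. This puts the
    next g + e - T in the range required by [k3]. *)
Lemma kt1_step (n : int) : 2 <= n -> veq v n m ->
  exists N M P T, [/\ pair_pt N M P T, veq v 0 N /\ veq v 0 M, veq v (n + 3) (N / M - 1),
                      rs T c & b = 0 -> vge v 3 (T ^+ 2 - 4 * P)].
Proof.
move=> n2' mv.
have [N [M [NMB pt]]] := division hE dE kp n2 ln ln' G2.
have XE := division_X hE dE ln ln' G2.
rewrite -/A -/B -/l -/l' -/x -/s -/P -/T -/mu -/r in NMB XE pt.
have WE : (1 + h) * x / l' = W by rewrite xE lE' /W; clearbody l1' x1; field; rewrite l1n' n5.
have muv : veq v n mu.
  rewrite muE; have := veqM vP mv (veqF vP (veqM vP (veqM vP A1v B1v) x1v) (veqM vP l1v l1v')).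
  by rewrite !add0r oppr0 !addr0.
rewrite WE in XE.
have [vN vM NMv smallv] := kt1_arith vP v5 hE vd n2' muv (rs_ge vP Tr) Pv W1v pt.1 NMB XE.
exists N, M, P, T; split=> // b0.
have -> : T ^+ 2 - 4 * P = r * (P * (1 + W - (1 + h))) - d ^+ 2 * mu ^+ 2 * T.
  have -> : T ^+ 2 - 4 * P = (T ^+ 2 - h ^+ 2 * P) - (4 - h ^+ 2) * P by ring.
  by rewrite (h_fourB hE) -/r XE; clearbody T P W mu; ring.
apply: (vgeB vP) => //.
have := vgeM vP (vge_veq v_r (lexx _)) (vgeM vP (vge_veq Pv (lexx _)) (l := 1) _) => /(_ (1 + W - (1 + h))).
apply; have : rs (1 + W - (1 + h)) 0; last by move=> hW; rewrite -[X in vge v 1 X]subr0; exact: hW.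
by apply: rs_mod (rsB (rsD (rsc 1) Wr) (rsD (rsc 1) rs_h)) _; rewrite b0; byres.
Qed.
End Normalized.
End Descent.

(** * The descents *)

Section KT1.
Variables (F : fieldType) (v : F -> int) (h d : F).
Hypotheses (vP : valuation_axiom v) (v5 : veq v 4 (5 : F)) (vd : veq v 1 d).
Hypotheses (hE : h ^+ 2 = 1 - h) (dE : d ^+ 2 = h ^+ 2 - 4).
Hypothesis res : forall x, vge v 0 x -> exists2 c : nat, (c < 5)%N & vge v 1 (x - c%:R).

Lemma rs_ex x : vge v 0 x -> exists2 b : int, b \in [:: 0; 1; 2; -1; -2 : int] & rs v x b.
Proof.
case/res=> c c5 hc; have hx : rs v x c by [].
by case: c c5 {hc} hx => [|[|[|[|[|[]]]]]] // _ hx; [exists 0 | exists 1 | exists 2 | exists (-2) | exists (-1)];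
  rewrite ?inE //; apply: (rs_mod vP v5 hx).
Qed.

Lemma veq_eq k l x : k = l -> veq v k x -> veq v l x.
Proof. by move->. Qed.

(** This property depends on unique factorisation and on the units of Z[zeta]; it is isolated here
    because the other steps only see the valuation at pi. *)
Definition fifth_root_lift := forall N M P T, N != 0 -> M != 0 -> pair_pt N M P T ->
  vge v 3 (N / M - 1) -> exists g e, [/\ g ^+ 5 = N, e ^+ 5 = M, g * e = P & vge v 2 (g / e - 1)].
Hypothesis lift : fifth_root_lift.

(** The lift gives g / e - 1 a valuation of at least 2, so by [v_pow5B1] it is exactly 4 less than
    that of N / M - 1. The bound 6 <= k is what ends the descents. *)
Lemma pair_lift N M P T (a k : int) : pair_pt N M P T -> veq v (5 * a) N -> veq v (5 * a) M ->
  3 <= k -> veq v k (N / M - 1) ->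
  exists g e, [/\ g ^+ 5 = N /\ e ^+ 5 = M, g * e = P, veq v a g /\ veq v a e,
    6 <= k & veq v (k - 4) (g / e - 1)].
Proof.
move=> pt hN hM k3 hk.
have [g [e [gN eM geP ge2]]] := lift (veq_neq0 hN) (veq_neq0 hM) pt (vge_veq hk k3).
have root5 y Y : y ^+ 5 = Y -> veq v (5 * a) Y -> veq v a y.
  move=> yY hY; have y0 : y != 0 by apply: contraTneq (veq_neq0 hY) => y0; rewrite -yY y0 expr0n eqxx.
  have := veqX vP 5 (veq_val v y0); rewrite yY => /(veq_uniq hY) hh.
  by rewrite /veq y0 /=; apply/eqP; move: hh; clear; lia.
have hg := root5 _ _ gN hN; have he := root5 _ _ eM hM.
have q0 : g / e - 1 != 0.
  apply: contraTneq (veq_neq0 hk) => /eqP; rewrite subr_eq0 => /eqP q1.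
  by rewrite -gN -eM -expr_div_n q1 expr1n subrr eqxx.
have k2 : 2 <= v (g / e - 1) by move: ge2; rewrite /vge (negPf q0).
have := v_pow5B1 vP v5 k2 (veq_val v q0); rewrite expr_div_n gN eM => /(veq_uniq hk) ->.
exists g, e; split=> //; first by move: k2; clear; lia.
by rewrite addrK veq_val.
Qed.

(* A division by 1 - zeta lowers the valuation of g - e by 1 and multiplies the residue of g
   by 3, which preserves the last hypothesis of [kt1]; that hypothesis excludes the final step. *)
Ltac case5 cP cP' cc := move: cP cP' cc; rewrite !inE; do ?case/orP; move/eqP=> ->; do ?case/orP; move/eqP=> ->.

Lemma kt1 (n : nat) g e t (c : int) : c \in [:: 1; 2; -1; -2 : int] -> rs v g c ->
  veq v (n%:Z + 2) (g - e) -> vge v 3 (g + e - t) -> fermat_pt g e t ->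
  ~~ (5 %| c * 3 ^+ n.+2 - 4)%Z -> False.
Proof.
elim: n g e t c => [|n IH] g e t c cP gc ge k3 gF c4.
all: have gv : veq v 0 g by apply: (rs_unit vP v5 gc); move: cP; rewrite !inE => /or4P[] /eqP ->.
all: have g0 := veq_neq0 gv; have d0 := veq_neq0 vd.
all: have uv := veqF vP ge (veqM vP gv (veqX vP 2 vd)).
all: have eE : g - e = (g - e) / (g * d ^+ 2) * g * d ^+ 2 by field; rewrite g0 d0.
  have [b bP ub] := rs_ex (vge_veq uv (l := 0) (k := 0) isT).
  (* Since 3^2 = 4 modulo 5, in the base case [c4] excludes the residue 1. *)
  have bc : (b == 0) || (c != 1) by apply/orP; right; apply: contraNneq c4 => ->.
  have [//|N [M [P [T [pt [hN hM] hNM _ _]]]]] := kt1_step vP v5 vd hE dE cP bP gc eE ub k3 gF bc (n := 2) _ ge.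
  by have [//|g' [e' []]] := pair_lift (a := 0) pt hN hM _ hNM.
have ub : rs v ((g - e) / (g * d ^+ 2)) 0.
  by rewrite /rs subr0; apply: vge_veq uv _; clear; lia.
have [|N [M [P [T [pt [hN hM] hNM Tc]]]]] := kt1_step vP v5 vd hE dE cP (b := 0) isT gc eE ub k3 gF isT _ ge.
  by clear; lia.
move=> /(_ erefl) TP.
have [|g' [e' [[gN eM] geP [gv' ev'] _ ge']]] := pair_lift (a := 0) pt hN hM _ hNM; first by clear; lia.
have ge'' : veq v (n%:Z + 2) (g' - e').
  have -> : g' - e' = (g' / e' - 1) * e' by field; apply: veq_neq0 ev'.
  by apply: (veq_eq _ (veqM vP ge' ev')); clear; lia.
have [c' c'P gc'] := rs_ex (vge_veq gv' (lexx _)).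
have ge0 : rs v (g' - e') 0 by rewrite /rs subr0; apply: vge_veq ge'' _; clear; lia.
have ec' : rs v e' c'.
  by have := rsB vP gc' ge0; rewrite subr0 (_ : g' - (g' - e') = e') //; ring.
(* Both g' and e' have residue c', so the second equation of [pair_pt] reads c = 2 c' modulo 5, that
   is c' = 3 c. *)
have Dc : rs v (dickson5 T P) (c ^+ 5).
  rewrite -geP /dickson5 -addrA -[c ^+ 5]addr0; apply: rsD (rsX vP 5 Tc) _ => //.
  have -> : - (5 * (T ^+ 3 * (g' * e'))) + 5 * (T * (g' * e') ^+ 2) =
    5 * (T * (g' * e') ^+ 2 - T ^+ 3 * (g' * e')) by ring.
  have r5 : rs v 5 0 by rewrite /rs subr0; apply: vge_veq v5 _.
  have := rsM vP r5 (rsB vP (rsM vP Tc (rsX vP 2 (rsM vP gc' ec'))) (rsM vP (rsX vP 3 Tc) (rsM vP gc' ec'))).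
  by rewrite mul0r.
have Dc' : rs v (dickson5 T P) (2 * c' ^+ 5).
  rewrite pt.2 -gN -eM.
  have := rsB vP (rsD vP (rsX vP 5 gc') (rsX vP 5 ec')) (rsX vP 2 (rsB vP (rsX vP 5 gc') (rsX vP 5 ec'))).
  by move/(rs_mod vP v5); apply; rewrite (_ : _ - _ = 0) //; ring.
have cc := rs_uniq vP v5 Dc Dc'.
have {c'P}[c'P {}cc] : c' \in [:: 1; 2; -1; -2 : int] /\ (5 %| c - 2 * c')%Z.
  by case5 cP c'P cc.
have c3 : (5 %| c' - 3 * c)%Z.
  by case5 cP c'P cc.
apply: (IH g' e' T c') => //.
- have hs : veq v 0 (T + (g' + e')).
    apply: (rs_unit vP v5 (rsD vP Tc (rsD vP gc' ec'))).
    by case5 cP c'P cc.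
  (* As P = g' e', T^2 - (g' + e')^2 is (T^2 - 4 P) - (g' - e')^2, and both parts have valuation at
     least 3. *)
  have -> : g' + e' - T = - ((T ^+ 2 - 4 * P - (g' - e') ^+ 2) / (T + (g' + e'))).
    by rewrite -geP; field; apply: veq_neq0 hs.
  rewrite (vgeN vP); have := vgeF vP (k := 3) _ hs; rewrite subr0; apply; apply: (vgeB vP) => //.
  by apply: vge_veq (veqX vP 2 ge'') _; clear; lia.
- by rewrite /fermat_pt geP pt.2 gN eM; ring.
apply: contra c4 => c4.
have -> : c * 3 ^+ n.+3 - 4 = (c' * 3 ^+ n.+2 - 4) - 3 ^+ n.+2 * (c' - 3 * c) by rewrite [3 ^+ n.+3]exprS; ring.
by rewrite rpredB // dvdz_mull.
Qed.
End KT1.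

Section KT2.
Variables (F : fieldType) (v : F -> int) (h d : F).
Hypotheses (vP : valuation_axiom v) (v5 : veq v 4 (5 : F)) (vd : veq v 1 d).
Hypotheses (hE : h ^+ 2 = 1 - h) (dE : d ^+ 2 = h ^+ 2 - 4).
Let r := 1 + 2 * h.

Section Step.
Variables (g e t : F) (n m : int).
Hypotheses (gv : veq v n g) (gev : veq v (n + m) (g - e)) (m2 : 2 <= m) (nm : 5 * n + 2 * m = - 8).
Hypothesis gF : fermat_pt g e t.
Let k := g + e. Let p := g * e. Let q := g - e.
Let A := dvA h k p. Let B := dvB h k p. Let l := dvl h k t p. Let l' := dvl' h k t p.
Let x := dvx k t p. Let s := dvt h k t.

Let hv : veq v 0 h. Proof. exact: (rs_unit vP v5 (rs_h vP v5 hE)). Qed.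
Let h1v : veq v 0 (1 + h).
Proof. exact: (rs_unit vP v5 (rsD vP (rsc v 1) (rs_h vP v5 hE))). Qed.
Let v2 : veq v 0 (2 : F). Proof. exact: (veq_prime5 vP v5 (a := 2) isT). Qed.
Let v4 : veq v 0 (4 : F). Proof. exact: (veq_prime5 vP v5 (a := 4) isT). Qed.
Let rv := v_r vP v5 hE.
Let ev : veq v n e.
Proof.
by rewrite (_ : e = g - (g - e)); [apply: veqBl gv _ => //; apply: vge_veq gev _; clear -m2 nm; lia | ring].
Qed.
Let kv : veq v n k.
Proof.
rewrite (_ : k = 2 * g - (g - e)); last by rewrite /k; ring.
apply: (veqBl vP); last by apply: vge_veq gev _; clear -m2 nm; lia.
by apply: veq_eq (veqM vP v2 gv); rewrite add0r.
Qed.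
Let pv : veq v (2 * n) p. Proof. by apply: veq_eq (veqM vP gv ev); clear -m2 nm; lia. Qed.
Let kp : q ^+ 2 = k ^+ 2 - 4 * p. Proof. by rewrite /q /k /p; ring. Qed.
Let q2 : vge v (2 * n + 3) (q ^+ 2).
Proof. by apply: vge_veq (veqX vP 2 gev) _; clear -m2 nm; lia. Qed.
Let Av : veq v (2 * n + 2) A.
Proof.
rewrite (_ : A = (4 - h ^+ 2) * p + q ^+ 2); last by rewrite /A /dvA kp; ring.
rewrite (h_fourB hE); apply: (veqDl vP); last by apply: vge_le q2 _; clear -m2 nm; lia.
by apply: veq_eq (veqM vP (veqM vP rv h1v) pv); clear -m2 nm; lia.
Qed.
Let Bv : veq v (2 * n + 2) B.
Proof.
rewrite (_ : B = (4 - (1 + h) ^+ 2) * p + q ^+ 2); last by rewrite /B /dvB kp; ring.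
rewrite (h_fourB' hE); apply: (veqDl vP); last by apply: vge_le q2 _; clear -m2 nm; lia.
by apply: veq_eq (veqM vP (veqM vP rv hv) pv); clear -m2 nm; lia.
Qed.
Let G2 : (k - t) * l * l' = (q * A * B) ^+ 2.
Proof. by rewrite dvprod // /A /B /q /k /p -pow5_diff // -gF /dickson5; ring. Qed.
(** The relation 5 n + 2 m = - 8 enters here: (q A B)^2 has valuation 2 (5 n + m + 4) = 5 n. *)
Let Gv : veq v (5 * n) ((k - t) * l * l').
Proof. by rewrite G2; apply: veq_eq (veqX vP 2 (veqM vP (veqM vP gev Av) Bv)); clear -m2 nm; lia. Qed.

Let lin (j : int) (b c : F) : vge v 0 b -> vge v 0 c -> vge v j t -> j <= n ->
  vge v (j + n) (k ^+ 2 + (b ^+ 2 - 4) * p + c * t * k).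
Proof.
move=> hb hc ht jn; have hj2 : j + n <= 2 * n by move: jn; clear; lia.
apply: (vgeD vP); first apply: (vgeD vP).
- by apply: vge_veq (veqX vP 2 kv) _; move: hj2; clear; lia.
- have hb4 : vge v 0 (b ^+ 2 - 4) by apply: (vgeB vP); [apply: (vgeX vP 2 hb) | apply: vge_veq v4 _].
  by apply: vge_le (vgeM vP hb4 (vge_veq pv (lexx _))) _; move: hj2; clear; lia.
by apply: vge_le (vgeM vP (vgeM vP hc ht) (vge_veq kv (lexx _))) _; move: hj2; clear; lia.
Qed.
Let lE : l = (k ^+ 2 + (h ^+ 2 - 4) * p + - h * t * k) + t ^+ 2.
Proof. by rewrite /l /dvl; ring. Qed.
Let lE' : l' = (k ^+ 2 + ((1 + h) ^+ 2 - 4) * p + (1 + h) * t * k) + t ^+ 2.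
Proof. by rewrite /l' /dvl'; ring. Qed.
Let hg : vge v 0 h. Proof. exact: vge_veq hv _. Qed.
Let h1g : vge v 0 (1 + h). Proof. exact: vge_veq h1v _. Qed.
Let hNg : vge v 0 (- h). Proof. by rewrite (vgeN vP). Qed.

(** If v t < n, then t would dominate all three factors and their product would have valuation 5 v t
    < 5 n. *)
Let tg : vge v n t.
Proof.
rewrite /vge; case: eqVneq => //= t0; case: (lerP n (v t)) => // tn.
have tv := veq_val v t0; have tg := vge_veq tv (lexx _).
have l0v : veq v (v t) (k - t).
  rewrite -(veqN vP) opprB; apply: (veqBl vP tv); apply: vge_veq kv _; move: tn; clear; lia.
have lv : veq v (v t * 2) l.
  by rewrite lE; apply: (veqDr vP (veqX vP 2 tv)); apply: vge_le (lin hg hNg tg (ltW tn)) _; move: tn; clear; lia.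
have lv' : veq v (v t * 2) l'.
  by rewrite lE'; apply: (veqDr vP (veqX vP 2 tv)); apply: vge_le (lin h1g h1g tg (ltW tn)) _; move: tn; clear; lia.
by have := veq_uniq Gv (veqM vP (veqM vP l0v lv) lv'); move: tn; clear; lia.
Qed.
(** The lower bounds n, 2 n, 2 n add up to the exact valuation of the product, so each is
    attained. *)
Let lvs : [/\ veq v n (k - t), veq v (2 * n) l & veq v (2 * n) l'].
Proof.
have g0 := veq_neq0 Gv.
have [kt0 l0 l0'] : [/\ k - t != 0, l != 0 & l' != 0].
  by move: g0; rewrite !mulf_eq0 !negb_or => /andP[/andP[]].
have := veq_uniq Gv (veqM vP (veqM vP (veq_val v kt0) (veq_val v l0)) (veq_val v l0')).
have t2 : vge v (n + n) (t ^+ 2) by apply: vge_le (vgeX vP 2 tg) _; clear; lia.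
have : vge v n (k - t) by apply: (vgeB vP) => //; apply: vge_veq kv _.
have : vge v (n + n) l by rewrite lE; apply: (vgeD vP) => //; apply: lin.
have : vge v (n + n) l' by rewrite lE'; apply: (vgeD vP) => //; apply: lin.
rewrite /vge /veq (negPf kt0) (negPf l0) (negPf l0') /=.
by move: (v _) (v _) (v _) => a b c; clear; move=> *; split; lia.
Qed.

Lemma kt2_step : exists N M P T, [/\ pair_pt N M P T, veq v (5 * (n + 2)) N,
  veq v (5 * (n + 2)) M & veq v (m - 1) (N / M - 1)].
Proof.
have [l0v lv lv'] := lvs.
have [N [M [NMB pt]]] := division hE dE kp (veq_neq0 v2) (veq_neq0 lv) (veq_neq0 lv') G2.
have XE := division_X hE dE (veq_neq0 lv) (veq_neq0 lv') G2.
rewrite -/A -/B -/l -/l' -/x -/s in NMB XE pt.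
set P := A * B / l in NMB XE pt; set T := B * s / (h * l) in NMB XE pt.
set mu := q * A * B * x / (l * l') in NMB XE.
have Pv : veq v (2 * n + 4) P by apply: veq_eq (veqF vP (veqM vP Av Bv) lv); clear -m2 nm; lia.
have sv : veq v n s.
  have -> : s = r * h * k - h ^+ 2 * (k - t).
    by rewrite -(h_twoB hE) (_ : 2 - h = 1 + h ^+ 2); [rewrite /s /dvt; ring | rewrite hE; ring].
  rewrite -(veqN vP) opprB; apply: (veqBl vP).
    by apply: veq_eq (veqM vP (veqX vP 2 hv) l0v); clear -m2 nm; lia.
  by apply: vge_veq (veqM vP (veqM vP rv hv) kv) _; clear -m2 nm; lia.
have Tv : veq v (n + 2) T by apply: veq_eq (veqF vP (veqM vP Bv sv) (veqM vP hv lv)); clear -m2 nm; lia.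
have xv : veq v (2 * n) x.
  have hx : veq v (2 * n) (4 * x).
    rewrite (dvx4 t kp) -(veqN vP) opprB; apply: (veqBl vP).
      by apply: veq_eq (veqM vP (veqM vP v4 l0v) kv); clear -m2 nm; lia.
    apply: (vgeB vP); last by apply: vge_le q2 _; clear -m2 nm; lia.
    by apply: vge_veq (veqM vP v5 (veqX vP 2 kv)) _; clear -m2 nm; lia.
  by apply: (veq_Mcancel vP v4); rewrite addr0 [x * _]mulrC.
have muv : veq v (3 * n + m + 4) mu.
  by apply: veq_eq (veqF vP (veqM vP (veqM vP (veqM vP gev Av) Bv) xv) (veqM vP lv lv')); clear -m2 nm; lia.
(* In [division_X] the term d^2 mu^2 T dominates: its valuation 7 n + 2 m + 12 is 2 n + 4, against
   at least 2 n + 6 for the other one. *)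
have Xv : veq v (2 * n + 4) (T ^+ 2 - h ^+ 2 * P).
  rewrite XE -(veqN vP) opprB; apply: (veqBl vP).
    by apply: veq_eq (veqM vP (veqM vP (veqX vP 2 vd) (veqX vP 2 muv)) Tv); clear -m2 nm; lia.
  have W0 : vge v 0 (1 + (1 + h) * x / l').
    apply: (vgeD vP); first exact: vge_veq (veq1 vP) _.
    by apply: vge_veq (veqF vP (veqM vP h1v xv) lv') _; clear -m2 nm; lia.
  by apply: vge_le (vgeM vP (vge_veq (veqM vP rv Pv) (lexx _)) W0) _; clear -m2 nm; lia.
have NMv : veq v (5 * n + m + 9) (N - M).
  by rewrite NMB; apply: veq_eq (veqM vP (veqM vP vd muv) Xv); clear -m2 nm; lia.
have [||hN hM hNM] := veq_balance vP v5 (c := 5 * (n + 2)) (veq_neq0 Pv) pt.1 _ NMv.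
- by have /veqP[_ ->] := Pv; clear -m2 nm; lia.
- by clear -m2 nm; lia.
exists N, M, P, T; split=> //.
by apply: veq_eq hNM; clear -m2 nm; lia.
Qed.
End Step.

Hypothesis lift : fifth_root_lift v.

(* A division by 1 - zeta turns (n, m) into (n + 2, m - 5). *)
Lemma kt2 (m : nat) g e t n : veq v n g -> veq v (n + m%:Z) (g - e) -> 2 <= m%:Z :> int ->
  5 * n + 2 * m%:Z = - 8 -> ~ fermat_pt g e t.
Proof.
have [j] := ubnP m; elim: j => // j IH in m g e t n * => mj gv gev m2 nm gF.
have [N [M [P [T [pt hN hM hNM]]]]] := kt2_step gv gev m2 nm gF.
(* The lift forces m - 1 >= 6, so m - 5 >= 2 and the hypotheses recur with a smaller m. *)
have [|g' [e' [[gN eM] geP [gv' ev'] m7 ge']]] := pair_lift vP v5 lift pt hN hM _ hNM; first by clear -m2 nm; lia.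
apply: (IH (m - 5)%N g' e' T (n + 2)) => //; first by clear -m7 mj; lia.
- have -> : g' - e' = (g' / e' - 1) * e' by field; apply: veq_neq0 ev'.
  by apply: (veq_eq _ (veqM vP ge' ev')); clear -m7; lia.
- by clear -m7; lia.
- by clear -m7 nm; lia.
by rewrite /fermat_pt geP pt.2 gN eM; ring.
Qed.
End KT2.

(** * Fifth roots of N and M in Q(zeta) *)

Section RatioLift.
Variables (F : fieldType) (v : F -> int) (z : F).
Hypotheses (vP : valuation_axiom v) (v5 : veq v 4 (5 : F)) (zv : veq v 1 (1 - z)).
Hypothesis res : forall x, vge v 0 x -> exists2 c : nat, (c < 5)%N & vge v 1 (x - c%:R).

Lemma zeta_expB1 c : vge v 2 (z ^+ c - (1 - c%:R * (1 - z))).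
Proof.
elim: c => [|c IH]; first by rewrite expr0 mul0r subr0 subrr vge0.
have -> : z ^+ c.+1 - (1 - c.+1%:R * (1 - z)) = z * (z ^+ c - (1 - c%:R * (1 - z))) + c%:R * (1 - z) ^+ 2.
  by rewrite exprS -addn1 natrD; ring.
have z0 : vge v 0 z.
  rewrite (_ : z = 1 - (1 - z)); last by ring.
  by apply: (vgeB vP); [apply: vge_veq (veq1 vP) _ | apply: vge_veq zv _].
apply: (vgeD vP); first exact: vge_le (vgeM vP z0 IH) _.
by apply: vge_le (vgeM vP (vge_nat vP c) (vge_veq (veqX vP 2 zv) (lexx _))) _.
Qed.

(** The fifth power map is the identity on F_5, so y = 1 modulo pi. Since z^c = 1 - c (1 - z) modulo
    pi^2, a suitable c removes the coefficient of pi. *)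
Lemma ratio_lift y : vge v 3 (y ^+ 5 - 1) -> exists c, vge v 2 (z ^+ c * y - 1).
Proof.
move=> y5; have yv : veq v 0 y.
  have h5 : veq v 0 (y ^+ 5).
    by rewrite -(subrK 1 (y ^+ 5)) addrC; apply: (veqDl vP (veq1 vP)); apply: vge_le y5 _.
  have y0 : y != 0 by apply: contraTneq (veq_neq0 h5) => ->; rewrite expr0n eqxx.
  have := veqX vP 5 (veq_val v y0) => /(veq_uniq h5) hh.
  by rewrite /veq y0 /=; apply/eqP; move: hh; clear; lia.
have [a [a5 ya]] := rs_ex vP v5 res (vge_veq yv (lexx _)).
have ya5 := rsX vP 5 ya.
have y51 : rs v (y ^+ 5) 1 by rewrite /rs; apply: vge_le y5 _.
have {ya5} a1 := rs_uniq vP v5 ya5 y51.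
have {a1 ya a5} y1 : vge v 1 (y - 1).
  have : rs v y 1; last by [].
  move: a5 a1 ya; rewrite !inE; do ?case/orP; move/eqP=> -> // _.
have [c _ hc] := res (vgeF vP y1 zv).
exists c.
have -> : z ^+ c * y - 1 = (z ^+ c - (1 - c%:R * (1 - z))) * y + ((y - 1) / (1 - z) - c%:R) * (1 - z)
   - c%:R * (1 - z) * (y - 1) by field; apply: veq_neq0 zv.
have c0 := vge_nat vP c.
apply: (vgeB vP); first apply: (vgeD vP).
- exact: vge_le (vgeM vP (zeta_expB1 c) (vge_veq yv (lexx _))) _.
- exact: vge_le (vgeM vP hc (vge_veq zv (lexx _))) _.
by apply: vge_le (vgeM vP (vgeM vP c0 (vge_veq zv (lexx _))) y1) _.
Qed.
End RatioLift.

Lemma v5_res x : vge v5 0 x -> exists2 c : nat, (c < 5)%N & vge v5 1 (x - c%:R).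
Proof. by case/v5_residue=> c []; exists c. Qed.

(** Replacing g by w g and P / g by P / (w g) keeps the product and multiplies the ratio by w^2; w =
    z^(3 c) is a square root of z^c because 6 c = c modulo 5. *)
Lemma twist_lift (F : fieldType) (z N M P g y : F) (c : nat) : z ^+ 5 = 1 -> g != 0 -> P != 0 ->
  N = g ^+ 5 -> N * M = P ^+ 5 -> y = g ^+ 2 / P ->
  exists g' e', [/\ g' ^+ 5 = N, e' ^+ 5 = M, g' * e' = P & g' / e' = z ^+ c * y].
Proof.
move=> z5 g0 P0 NE NM yE.
have z0 : z != 0 by apply: contra_eq_neq z5 => ->; rewrite expr0n eq_sym oner_eq0.
have zz m : (z ^+ m) ^+ 5 = 1 by rewrite -exprM mulnC exprM z5 expr1n.
have z6 : z ^+ c = (z ^+ (3 * c)) ^+ 2.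
  by rewrite -exprM (_ : 3 * c * 2 = c + 5 * c)%N; [rewrite exprD exprM z5 expr1n mulr1 | lia].
have w0 : z ^+ (3 * c) != 0 by rewrite expf_neq0.
move: (zz (3 * c)%N) z6 w0; move: (z ^+ (3 * c)) => w w5 z6 w0.
exists (w * g), (P / (w * g)); split.
- by rewrite exprMn w5 mul1r.
- rewrite expr_div_n -NM exprMn w5 mul1r -NE; field.
  by rewrite NE expf_neq0.
- by field; rewrite w0 g0.
by rewrite z6 yE; field; rewrite P0 w0 g0.
Qed.

(** By [pair_val] and [fifth_power], N = u g^5 with a unit u. Then N / M = N^2 / P^5 = u^2 (g^2 /
    P)^5 is 1 modulo pi^3, so u is a fifth power, and [ratio_lift] chooses the root. *)
Lemma cyc5_fifth_root_lift : fifth_root_lift v5.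
Proof.
move=> N M P T N0 M0 pt NM1.
have [u [g [uO uV g0 NE]]] := fifth_power N0 (fun q qP => pair_val (val5_valuation qP) N0 M0 pt).
have NM := pt.1.
have u0 : u != 0 by apply: contraNneq N0 => u0; rewrite NE u0 mul0r.
have P0 : P != 0.
  by apply: contraNneq (mulf_neq0 N0 M0) => P0; rewrite NM P0 expr0n.
have NMy : N / M = u ^+ 2 * (g ^+ 2 / P) ^+ 5.
  have -> : M = P ^+ 5 / N by rewrite -NM mulrAC mulfV ?mul1r.
  have g5 : g ^+ 5 != 0 := expf_neq0 5 g0; have P5 := expf_neq0 5 P0.
  rewrite NE expr_div_n -exprM (_ : (2 * 5 = 5 * 2)%N) // exprM.
  by move: (g ^+ 5) (P ^+ 5) u0 g5 P5 => a b u0 a0 b0; clear -u0 a0 b0; field; rewrite u0 a0 b0.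
have qv : veq v5 0 (g ^+ 2 / P).
  have uv := val5_unit pi5_prime uO uV u0.
  have q0 : g ^+ 2 / P != 0 by rewrite mulf_neq0 ?invr_eq0 ?expf_neq0.
  have : veq v5 0 (N / M).
    by rewrite -(subrK 1 (N / M)) addrC; apply: (veqDl v5P (veq1 v5P)); apply: vge_le NM1 _.
  rewrite NMy => hh.
  have hu : veq v5 0 u by rewrite /veq u0 uv.
  have := veqM v5P (veqX v5P 2 hu) (veqX v5P 5 (veq_val v5 q0)) => /(veq_uniq hh) h5.
  by rewrite /veq q0 /=; apply/eqP; move: h5; clear; lia.
have [|w uE] := fifth_power_unit uO uV u0 qv; first by rewrite -NMy.
have w0 : w != 0 by apply: contraNneq u0 => w0; rewrite uE w0 expr0n.
have yE : (w * g) ^+ 2 / P = w ^+ 2 * (g ^+ 2 / P) by rewrite exprMn mulrA.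
have y5 : vge v5 3 (((w * g) ^+ 2 / P) ^+ 5 - 1).
  by rewrite yE exprMn -exprM (_ : (2 * 5 = 5 * 2)%N) // exprM -uE -NMy.
have [c hc] := ratio_lift v5P v5_5 v5_pi v5_res y5.
have wg0 : w * g != 0 by rewrite mulf_neq0.
have NE' : N = (w * g) ^+ 5 by rewrite exprMn -uE.
have [g' [e' [h1 h2 h3 h4]]] := twist_lift c z5_5 wg0 P0 NE' NM erefl.
by exists g', e'; split=> //; rewrite h4.
Qed.

Lemma pair_pt_of_points (F : comNzRingType) (U1 V1 U2 V2 : F) :
  V1 * (1 - V1) = U1 ^+ 5 -> V2 * (1 - V2) = U2 ^+ 5 ->
  pair_pt (V1 * V2) ((1 - V1) * (1 - V2)) (U1 * U2) (U1 + U2).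
Proof.
move=> h1 h2; split; first by rewrite exprMn -h1 -h2; ring.
have -> : dickson5 (U1 + U2) (U1 * U2) = U1 ^+ 5 + U2 ^+ 5 by rewrite /dickson5; ring.
by rewrite -h1 -h2; ring.
Qed.

(** * Rational points on the two curves *)

Section RationalPoints.
Variables (F : fieldType) (v : F -> int) (f : {rmorphism rat -> F}).
Hypotheses (vP : valuation_axiom v) (v5 : veq v 4 (5 : F)).
Hypothesis res : forall x, vge v 0 x -> exists2 c : nat, (c < 5)%N & vge v 1 (x - c%:R).

Lemma val_int (n : int) : n != 0 -> exists k : int, veq v (4 * k) (n%:~R : F).
Proof.
move=> n0; have an : (0 < `|n|)%N by rewrite absz_gt0.
have [m cm nE] := pfactor_coprime (isT : prime 5) an.
have hm : veq v 0 (m%:R : F).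
  have := @veq_prime5 F v vP v5 m%:Z; rewrite -pmulrn; apply.
  by rewrite dvdzE /= -prime_coprime.
have hn : veq v (4 * (logn 5 `|n|)%:Z) (`|n|%:R : F).
  have -> : (`|n|%:R : F) = m%:R * 5 ^+ logn 5 `|n| by rewrite {1}nE natrM natrX.
  by apply: veq_eq (veqM vP hm (veqX vP (logn 5 `|n|) v5)); rewrite add0r.
exists (logn 5 `|n|).
move: hn; generalize (4 * (logn 5 `|n|)%:Z); case: (n) => k e //.
by rewrite NegzE rmorphN (veqN vP).
Qed.

(** A nonzero rational is a power of 5 times a unit at pi. These multiples of 4 sharpen every
    congruence below. *)
Lemma val_rat q : q != 0 -> exists k : int, veq v (4 * k) (f q).
Proof.
move=> q0; have [a ha] : exists k : int, veq v (4 * k) ((numq q)%:~R : F) by apply: val_int; rewrite numq_eq0.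
have [b hb] : exists k : int, veq v (4 * k) ((denq q)%:~R : F) by apply: val_int; rewrite denq_eq0.
exists (a - b); rewrite -{1}(divq_num_den q) fmorph_div !rmorph_int.
by apply: veq_eq (veqF vP ha hb); rewrite mulrBr.
Qed.

Lemma vge_rat q (k : int) : vge v (4 * k + 1) (f q) -> vge v (4 * k + 4) (f q).
Proof.
case: (eqVneq q 0) => [->|q0]; first by rewrite rmorph0 !vge0.
have [j hj] := val_rat q0 => /(veq_geF hj) h; apply: vge_veq hj _; move: h; clear; lia.
Qed.

Lemma vge_sqrt k x : vge v (2 * k) (x ^+ 2) -> vge v k x.
Proof.
case: (eqVneq x 0) => [->|x0]; first by rewrite vge0.
by move=> /(veq_geF (veqX vP 2 (veq_val v x0))) h; apply: vge_veq (veq_val v x0) _; move: h; clear; lia.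
Qed.

Lemma veq_sqrt k x : veq v (2 * k) (x ^+ 2) -> veq v k x.
Proof.
move=> h; have x0 : x != 0 by apply: contraTneq (veq_neq0 h) => ->; rewrite expr0n eqxx.
have := veq_uniq h (veqX vP 2 (veq_val v x0)) => e.
by rewrite /veq x0 /=; apply/eqP; move: e; clear; lia.
Qed.

Variables (h d : F).
Hypotheses (vd : veq v 1 d).
Hypotheses (hE : h ^+ 2 = 1 - h) (dE : d ^+ 2 = h ^+ 2 - 4).
Hypothesis lift : fifth_root_lift v.
Let r := 1 + 2 * h.

Let n2 : (2 : F) != 0. Proof. exact: veq_neq0 (veq_prime5 vP v5 (a := 2) isT). Qed.
Let v2 : veq v 0 (2 : F). Proof. exact: (veq_prime5 vP v5 (a := 2) isT). Qed.
Let v4 : veq v 0 (4 : F). Proof. exact: (veq_prime5 vP v5 (a := 4) isT). Qed.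

(** The point (U, V) = (- S, (1 + r Z) / 2) is paired with itself. With s = v(S) and w = v(r Z) one
    has 5 s = 2 w and v(N / M - 1) = - w; the fifth roots give [kt2] with n = s and m = - w - 4. *)
Lemma no_point_neg S Z : 5 * Z ^+ 2 = 1 + 4 * S ^+ 5 -> ~~ vge v 0 (f S) -> False.
Proof.
move=> E Sneg; have S0 : f S != 0 by apply: contraNneq Sneg => ->; rewrite vge0.
have Sv := veq_val v S0; move: Sneg; rewrite /vge (negPf S0) /= -ltNge.
move: (v (f S)) Sv => s Sv s0.
have E' : r ^+ 2 * f Z ^+ 2 = 1 + 4 * f S ^+ 5.
  rewrite (rE2 hE) -(rmorph_nat f 5) -(rmorph_nat f 4) -!(rmorphXn f) -!(rmorphM f) E.
  by rewrite (rmorphD f) rmorph1.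
have RZ2 : veq v (s * 5) ((r * f Z) ^+ 2).
  rewrite exprMn E' addrC; apply: (veqDl vP).
    by apply: veq_eq (veqM vP v4 (veqX vP 5 Sv)); rewrite add0r.
  by apply: vge_veq (veq1 vP) _; move: s0; clear; lia.
have R0 : r * f Z != 0 by apply: contraTneq (veq_neq0 RZ2) => ->; rewrite expr0n eqxx.
have Rv := veq_val v R0.
have := veq_uniq RZ2 (veqX vP 2 Rv); move: (v (r * f Z)) Rv => w Rv sw.
have w0 : w < 0 by move: sw s0; clear; lia.
pose V := (1 + r * f Z) / 2; pose U := - f S.
have VU : V * (1 - V) = U ^+ 5.
  have -> : V * (1 - V) = (1 - r ^+ 2 * f Z ^+ 2) / 4 by rewrite /V; field; rewrite n2 (veq_neq0 v4).
  by rewrite E' /U; field; rewrite (veq_neq0 v4).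
have g1 : vge v (w + 1) 1 by apply: vge_veq (veq1 vP) _; move: w0; clear; lia.
have hV : veq v w V.
  by apply: veq_eq (veqF vP (veqDr vP Rv g1) v2); rewrite subr0.
have hV1 : veq v w (1 - V).
  rewrite -(veqN vP) opprB; apply: (veqBl vP hV) => //.
have pt := pair_pt_of_points VU VU.
have aN : 5 * s = w + w by move: sw; clear; lia.
have hN : veq v (5 * s) (V * V) by rewrite aN; apply: (veqM vP).
have hM : veq v (5 * s) ((1 - V) * (1 - V)) by rewrite aN; apply: (veqM vP).
have hNM : veq v (- w) (V * V / ((1 - V) * (1 - V)) - 1).
  have -> : V * V / ((1 - V) * (1 - V)) - 1 = r * f Z / ((1 - V) * (1 - V)).
    have -> : r * f Z = 2 * V - 1 by rewrite /V; field.
    by have y0 := veq_neq0 hV1; clearbody V; field.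
  by apply: veq_eq (veqF vP Rv hM); move: aN; clear; lia.
have [|g [e [[gN eM] geP [gv ev] m7 ge]]] := pair_lift vP v5 lift pt hN hM _ hNM; first by move: sw w0; clear; lia.
have wE : (`|- w - 4|%N : int) = - w - 4 by rewrite gez0_abs //; move: m7; clear; lia.
apply: (kt2 vP v5 vd hE dE lift (m := `|- w - 4|%N) (e := e) (t := U + U) gv); rewrite ?wE.
- have -> : g - e = (g / e - 1) * e by field; apply: veq_neq0 ev.
  by apply: veq_eq (veqM vP ge ev); clear; lia.
- by move: m7; clear; lia.
- by move: sw; clear; lia.
by rewrite /fermat_pt geP (pt.2) gN eM; ring.
Qed.
End RationalPoints.

Lemma five_dvd_3X (i : nat) : (5 %| (3 : int) ^+ (4 * i) - 1)%Z.
Proof.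
by rewrite exprM -[X in _ - X](expr1n _ i) subrXX dvdz_mulr.
Qed.

(** Here g + e = -1 and g - e = m. The condition depends on m only through m^2, a rational function
    of e by the equation of the curve, so it becomes an identity in one variable. *)
Lemma fermat_pt_elliptic (F : fieldType) (e Y D : F) : (2 : F) != 0 -> D != 0 -> Y ^+ 2 = D ->
  D = - 100 * e ^+ 5 + 200 * e ^+ 3 - 180 * e ^+ 2 + 60 * e - 7 ->
  let m := (20 * e ^+ 2 - 10 * e + 1) / Y in
  fermat_pt ((- 1 + m) / 2) ((- 1 - m) / 2) ((100 * e ^+ 5 - 25 * e ^+ 4 - 40 * e ^+ 2 + 25 * e - 4) / D).
Proof.
move=> n2 D0 YD DE m.
have n4 : (4 : F) != 0 by rewrite (_ : 4 = 2 * 2) ?mulf_neq0 //; ring.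
set t := _ / D; pose p := (1 - m ^+ 2) / 4.
have hp : (- 1 + m) / 2 * ((- 1 - m) / 2) = p by rewrite /p; field; rewrite n2 n4.
rewrite /fermat_pt hp.
have -> : ((- 1 + m) / 2) ^+ 5 + ((- 1 - m) / 2) ^+ 5 = - 1 + 5 * p - 5 * p ^+ 2.
  by rewrite -hp; field.
have -> : (((- 1 + m) / 2) ^+ 5 - ((- 1 - m) / 2) ^+ 5) ^+ 2 = m ^+ 2 * (1 - 3 * p + p ^+ 2) ^+ 2.
  by rewrite -hp; field.
have mE : m ^+ 2 = (20 * e ^+ 2 - 10 * e + 1) ^+ 2 / D by rewrite /m expr_div_n YD.
rewrite /p mE /t /dickson5.
clearbody m; clear p t hp.
rewrite DE; rewrite DE in D0; field; rewrite D0 n4 //.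
Qed.

Lemma rmorph_elliptic (R R' : comNzRingType) (f : {rmorphism R -> R'}) e :
  f (- 100 * e ^+ 5 + 200 * e ^+ 3 - 180 * e ^+ 2 + 60 * e - 7) =
  - 100 * f e ^+ 5 + 200 * f e ^+ 3 - 180 * f e ^+ 2 + 60 * f e - 7.
Proof. by rewrite !(rmorph_nat, rmorphXn, rmorphM, rmorphN, rmorphB, rmorphD). Qed.

Section RationalPoints.
Variables (F : fieldType) (v : F -> int) (f : {rmorphism rat -> F}).
Hypotheses (vP : valuation_axiom v) (v5 : veq v 4 (5 : F)).
Hypothesis res : forall x, vge v 0 x -> exists2 c : nat, (c < 5)%N & vge v 1 (x - c%:R).
Variables (h d : F).
Hypotheses (vd : veq v 1 d).
Hypotheses (hE : h ^+ 2 = 1 - h) (dE : d ^+ 2 = h ^+ 2 - 4).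
Hypothesis lift : fifth_root_lift v.
Let r := 1 + 2 * h.

Let v2 : veq v 0 (2 : F). Proof. exact: (veq_prime5 vP v5 (a := 2) isT). Qed.
Let n2 : (2 : F) != 0. Proof. exact: veq_neq0 v2. Qed.
Let v4 : veq v 0 (4 : F). Proof. exact: (veq_prime5 vP v5 (a := 4) isT). Qed.
Let n4 : (4 : F) != 0. Proof. exact: veq_neq0 v4. Qed.
Let rv := v_r vP v5 hE.
Let r0 := veq_neq0 rv.
Let rs5 : rs v 5 0. Proof. by rewrite /rs subr0; apply: vge_veq v5 _. Qed.

(** The point is paired with (- 1, - h), which comes from S = 1, Z = - 1. This makes N / M - 1 equal
    to r (Z - 1) over a unit, small since Z is a rational number with residue 1; S != 1 ensures Z !=
    1. *)
Lemma no_point_congr1 S Z : 5 * Z ^+ 2 = 1 + 4 * S ^+ 5 -> S != 1 -> vge v 4 (f S - 1) ->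
  rs v (f Z) 1 -> False.
Proof.
move=> E S1 hS Z1.
have E' : 5 * f Z ^+ 2 = 1 + 4 * f S ^+ 5.
  rewrite -(rmorph_nat f 5) -(rmorph_nat f 4) -!(rmorphXn f) -!(rmorphM f) E.
  by rewrite (rmorphD f) rmorph1.
have S10 : f S - 1 != 0 by rewrite subr_eq0 -(rmorph1 f) (inj_eq (fmorph_inj f)).
have S5 : f S ^+ 5 - 1 != 0.
  have S4 : 2 <= v (f S - 1) by move: hS; rewrite /vge (negPf S10) /=; clear; lia.
  exact: veq_neq0 (v_pow5B1 vP v5 S4 (veq_val v S10)).
have Z10 : Z - 1 != 0.
  apply: contraNneq S5 => /eqP; rewrite subr_eq0 => /eqP Z1'.
  move: E'; rewrite Z1' rmorph1 expr1n mulr1 => E'.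
  have : 4 * (f S ^+ 5 - 1) = 0 by rewrite mulrBr -[4 * _](addKr 1) -E'; ring.
  by move/eqP; rewrite mulf_eq0 (negPf n4).
have [j hj] := val_rat f vP v5 Z10.
have j1 : 1 <= j.
  have : vge v (4 * 0 + 1) (f (Z - 1)) by rewrite rmorphB rmorph1; exact: Z1.
  by move=> /(veq_geF hj); clear; lia.
pose V := (1 + r * f Z) / 2; pose U := - f S.
have VU : V * (1 - V) = U ^+ 5.
  have -> : V * (1 - V) = (1 - r ^+ 2 * f Z ^+ 2) / 4 by rewrite /V; field; rewrite n2 n4.
  by rewrite (rE2 hE) E' /U; field.
have VU' : (- h) * (1 - - h) = (- 1) ^+ 5.
  by rewrite (_ : - h * _ = - h - h ^+ 2); [rewrite hE; ring | ring].
have pt := pair_pt_of_points VU VU'.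
have h2 := rs_h vP v5 hE.
have r0' : rs v r 0 by rewrite /rs subr0; apply: vge_veq rv _.
have hV : rs v V 3.
  by apply: (rs_mod vP v5 (rsF vP v5 (b' := 3) (rsD vP (rsc v 1) (rsM vP r0' Z1)) (rsc v 2) isT) _).
have hN := rsM vP hV (rsN vP h2).
have hM := rsM vP (rsB vP (rsc v 1) hV) (rsB vP (rsc v 1) (rsN vP h2)).
have Nv := rs_unit vP v5 hN isT.
have Mv := rs_unit vP v5 hM isT.
have hNM : veq v (4 * j + 2) (V * - h / ((1 - V) * (1 - - h)) - 1).
  have -> : V * - h / ((1 - V) * (1 - - h)) - 1 = r * f (Z - 1) / (2 * ((1 - V) * (1 - - h))).
    have := veq_neq0 Mv; rewrite mulf_eq0 negb_or => /andP[V0 h0].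
    rewrite rmorphB rmorph1 (_ : r * (f Z - 1) = 2 * (V - (1 + h))); last by rewrite /V /r; field.
    by rewrite opprK in h0 *; clearbody V; field; rewrite n2 V0 h0.
  by apply: veq_eq (veqF vP (veqM vP rv hj) (veqM vP v2 Mv)); clear; lia.
have [|g [e [[gN eM] geP [gv ev] _ ge]]] := pair_lift (a := 0) vP v5 lift pt Nv Mv _ hNM.
  by move: j1; clear; lia.
have ge' : veq v (4 * j - 2) (g - e).
  have -> : g - e = (g / e - 1) * e by field; apply: veq_neq0 ev.
  by apply: veq_eq (veqM vP ge ev); clear; lia.
have gc : rs v g (- 1).
  have [c cP gc] := rs_ex vP v5 res (vge_veq gv (lexx _)).
  have := rsX vP 5 gc; rewrite gN => h5; have := rs_uniq vP v5 h5 hN => c5.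
  move: c5 gc; move: cP; rewrite !inE; do ?case/orP; move/eqP=> -> //.
have ge0 : rs v (g - e) 0 by rewrite /rs subr0; apply: vge_veq ge' _; move: j1; clear; lia.
have ec : rs v e (- 1).
  by have := rsB vP gc ge0; rewrite subr0 (_ : g - (g - e) = e) //; ring.
have S1' : rs v (f S) 1 by apply: vge_le hS _.
have sv : veq v 0 (g + e + (U + - 1)).
  by apply: (rs_unit vP v5 (rsD vP (rsD vP gc ec) (rsD vP (rsN vP S1') (rsc v (- 1)))) isT).
have kt : vge v 3 (g + e - (U + - 1)).
  have -> : g + e - (U + - 1) = ((g - e) ^+ 2 - (f S - 1) ^+ 2) / (g + e + (U + - 1)).
    have -> : (f S - 1) ^+ 2 = (U + - 1) ^+ 2 - 4 * (g * e) by rewrite geP /U; ring.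
    by field; apply: veq_neq0 sv.
  have := vgeF vP (k := 3) _ sv; rewrite subr0; apply; apply: (vgeB vP).
    by apply: vge_veq (veqX vP 2 ge') _; move: j1; clear; lia.
  by apply: vge_le (vgeX vP 2 hS) _.
have jE : (`|j - 1|%N : int) = j - 1 by rewrite gez0_abs //; move: j1; clear; lia.
apply: (kt1 vP v5 vd hE dE res lift (n := (4 * `|j - 1|)%N) (e := e) (c := - 1) isT gc _ kt).
- by apply: veq_eq ge'; rewrite PoszM jE; clear; lia.
- by rewrite /fermat_pt geP (pt.2) gN eM; ring.
(* The number of steps is a multiple of 4 and 3^4 = 1 modulo 5, so the residue condition reduces to
   5 not dividing - 13. *)
have h3 := five_dvd_3X `|j - 1|; move: h3; set y := 3 ^+ (4 * `|j - 1|) => h3.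
rewrite (_ : _ - 4 = - 9 * (y - 1) + - 13); last by rewrite !exprS -/y; ring.
by rewrite rpredDl ?dvdz_mull.
Qed.

(** Once S is integral at 5, so is Z because its valuation is a multiple of 4. The equation then
    gives S = 1 and Z = +-1 modulo 5, and the sign of Z is free. *)
Lemma no_point (S Z : rat) : 5 * Z ^+ 2 = 1 + 4 * S ^+ 5 -> S = 1.
Proof.
move=> E; apply/eqP/negPn/negP => S1.
case: (boolP (vge v 0 (f S))) => [S0|]; last exact: (no_point_neg vP v5 vd hE dE lift E).
have E' : (r * f Z) ^+ 2 = 1 + 4 * f S ^+ 5.
  rewrite exprMn (rE2 hE) -(rmorph_nat f 5) -(rmorph_nat f 4) -!(rmorphXn f) -!(rmorphM f) E.
  by rewrite (rmorphD f) rmorph1.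
have [a aP Sa] := rs_ex vP v5 res S0.
have h14 := rsD vP (rsc v 1) (rsM vP (rsc v 4) (rsX vP 5 Sa)).
have Z0 : vge v 0 (f Z).
  have h0 : vge v 0 (r * f Z) by apply: (vge_sqrt vP); rewrite mulr0 E'; apply: rs_ge h14.
  have := vgeF vP h0 rv; rewrite mulrAC mulfV // mul1r => h1.
  by apply: (vge_rat vP v5 (k := - 1)); apply: vge_le h1 _.
have RZ4 : vge v 4 ((r * f Z) ^+ 2).
  by rewrite exprMn; apply: vge_le (vgeM vP (vge_veq (veqX vP 2 rv) (lexx _)) (vgeX vP 2 Z0)) _.
have h0 : rs v (1 + 4 * f S ^+ 5) 0 by rewrite /rs subr0 -E'; apply: vge_le RZ4 _.
have Sa1 : rs v (f S) 1.
  have := rs_uniq vP v5 h14 h0 => ha.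
  move: ha Sa; move: aP; rewrite !inE; do ?case/orP; move/eqP=> -> //.
have hS : vge v 4 (f S - 1).
  rewrite -(rmorph1 f) -rmorphB; apply: (vge_rat vP v5 (k := 0)).
  by rewrite rmorphB rmorph1; exact: Sa1.
have ZZ : vge v 4 ((f Z - 1) * (f Z + 1)).
  have -> : (f Z - 1) * (f Z + 1) = 4 * (f S ^+ 5 - 1 ^+ 5) / 5.
    have n5 := veq_neq0 v5.
    have -> : 4 * (f S ^+ 5 - 1 ^+ 5) = (r * f Z) ^+ 2 - 5 by rewrite E'; ring.
    by rewrite exprMn (rE2 hE); field.
  have h8 := vge_pow5_sub vP (vge_veq v5 (lexx 4)) (k := 4) isT S0 (vge_veq (veq1 vP) (lexx _)) hS.
  by apply: vge_le (vgeF vP (vgeM vP (vge_veq v4 (lexx _)) h8) v5) _.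
have [b bP Zb] := rs_ex vP v5 res Z0.
have Zb' := rsM vP (rsB vP Zb (rsc v 1)) (rsD vP Zb (rsc v 1)).
have b1 : (5 %| (b - 1) * (b + 1) - 0)%Z.
  by apply: (rs_uniq vP v5 Zb'); rewrite /rs subr0; apply: vge_le ZZ _.
have [b1'|b1'] : b = 1 \/ b = - 1.
  by move: bP b1; rewrite !inE; do ?case/orP; move/eqP=> -> //; [left | right].
  by apply: (no_point_congr1 E S1 hS); rewrite -b1'.
apply: (no_point_congr1 (Z := - Z) _ S1 hS); first by rewrite sqrrN.
by rewrite rmorphN; have := rsN vP Zb; rewrite b1' opprK.
Qed.

(** If e is integral at 5, Y^2 = - 7 modulo 5 is not a square. Otherwise v(e) = 4 a with a < 0, and
    v(Y) = 10 a + 4 is a multiple of 4 only for a = 2 i; then m has valuation - 4 i and [kt1]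
    applies. *)
Lemma no_elliptic_point (e Y : rat) :
  Y ^+ 2 = - 100 * e ^+ 5 + 200 * e ^+ 3 - 180 * e ^+ 2 + 60 * e - 7 -> False.
Proof.
move=> YD; set y := f Y; set x := f e.
have yD : y ^+ 2 = - 100 * x ^+ 5 + 200 * x ^+ 3 - 180 * x ^+ 2 + 60 * x - 7.
  by rewrite -(rmorphXn f) YD rmorph_elliptic.
have D5 : y ^+ 2 = 5 * (- 20 * x ^+ 5 + 40 * x ^+ 3 - 36 * x ^+ 2 + 12 * x) + (- 7)%:~R.
  by rewrite yD mulrNz; ring.
case: (boolP (vge v 0 x)) => [x0|xn].
  have [a _ xa] := rs_ex vP v5 res x0.
  have := rsD vP (rsM vP rs5 (rsD vP (rsB vP (rsD vP (rsM vP (rsc v (- 20)) (rsX vP 5 xa))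
    (rsM vP (rsc v 40) (rsX vP 3 xa))) (rsM vP (rsc v 36) (rsX vP 2 xa))) (rsM vP (rsc v 12) xa))) (rsc v (- 7)).
  rewrite mul0r -D5 => hy.
  have y0 : vge v 0 y by apply: (vge_sqrt vP); rewrite mulr0; apply: (rs_ge vP hy).
  have [b bP yb] := rs_ex vP v5 res y0.
  have := rs_uniq vP v5 (rsX vP 2 yb) hy.
  by move: bP; rewrite !inE; do ?case/orP; move/eqP=> ->.
have e0 : e != 0 by apply: contraNneq xn => ee; rewrite /x ee rmorph0 vge0.
have [a ha] := val_rat f vP v5 e0; rewrite -/x in ha.
have a0 : a < 0.
  by rewrite ltNge; apply: contra xn => a0; apply: vge_veq ha _; move: a0; clear; lia.
have xg (n : nat) : vge v (4 * a * n%:Z) (x ^+ n) := vge_veq (veqX vP n ha) (lexx _).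
have g0 (c : int) : vge v 0 (c%:~R : F) := vge_int vP c.
have gM (c : int) k n : k <= 4 * a * n%:Z -> vge v k (c%:~R * x ^+ n).
  by move=> hk; apply: vge_le (vgeM vP (g0 c) (xg n)) _; rewrite add0r.
pose D := y ^+ 2.
have Dv : veq v (2 * (10 * a + 4)) D.
  rewrite /D yD.
  have -> : - 100 * x ^+ 5 + 200 * x ^+ 3 - 180 * x ^+ 2 + 60 * x - 7 =
    - (4 * 5 ^+ 2 * x ^+ 5) + (5 * (40%:~R * x ^+ 3 + (- 36)%:~R * x ^+ 2 + 12%:~R * x ^+ 1) + (- 7)%:~R * x ^+ 0).
    by rewrite !mulrNz; ring.
  apply: (veqDl vP).
    by rewrite (veqN vP); apply: veq_eq (veqM vP (veqM vP v4 (veqX vP 2 v5)) (veqX vP 5 ha)); clear; lia.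
  apply: (vgeD vP); last by apply: gM; move: a0; clear; lia.
  apply: vge_le (vgeM vP (vge_veq v5 (lexx _)) (l := 12 * a) _) _; last by move: a0; clear; lia.
  by apply: (vgeD vP); [apply: (vgeD vP) |]; apply: gM; move: a0; clear; lia.
have D0 := veq_neq0 Dv.
have yv : veq v (10 * a + 4) y := veq_sqrt vP Dv.
have Y0 : Y != 0 by apply: contraTneq (veq_neq0 yv) => Y0; rewrite /y Y0 rmorph0 eqxx.
have [i ai] : exists i : int, a = 2 * i.
  have [k hk] := val_rat f vP v5 Y0; have := veq_uniq hk yv => e2.
  by exists (k - 1 - 2 * a); move: e2; clear; lia.
have i0 : i <= - 1 by move: a0 ai; clear; lia.
pose m := (20 * x ^+ 2 - 10 * x + 1) / y.
have mv : veq v (- (4 * i)) m.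
  have -> : m = (4 * 5 * x ^+ 2 + (5 * ((- 2)%:~R * x ^+ 1) + 1%:~R * x ^+ 0)) / y.
    by congr (_ / _); rewrite !mulrNz; ring.
  have hn : veq v (8 * a + 4) (4 * 5 * x ^+ 2 + (5 * ((- 2)%:~R * x ^+ 1) + 1%:~R * x ^+ 0)).
    apply: (veqDl vP).
      by apply: veq_eq (veqM vP (veqM vP v4 v5) (veqX vP 2 ha)); clear; lia.
    apply: (vgeD vP); last by apply: gM; move: a0; clear; lia.
    apply: vge_le (vgeM vP (vge_veq v5 (lexx _)) (gM (- 2) (4 * a) 1%N _)) _; first by clear; lia.
    by move: a0; clear; lia.
  by apply: veq_eq (veqF vP hn yv); move: ai; clear; lia.
have mr : rs v m 0 by rewrite /rs subr0; apply: vge_veq mv _; move: i0; clear; lia.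
have FP := fermat_pt_elliptic n2 D0 erefl yD; cbv zeta in FP; rewrite -/m in FP.
set g := (- 1 + m) / 2 in FP; set ee := (- 1 - m) / 2 in FP; set t := _ / D in FP.
have gr : rs v g 2.
  by apply: (rs_mod vP v5 (rsF vP v5 (b' := 3) (rsD vP (rsc v (- 1)) mr) (rsc v 2) isT) _).
have geE : g - ee = m by rewrite /g /ee; field.
have iE : (`|- i - 1|%N : int) = - i - 1 by rewrite gez0_abs //; move: i0; clear; lia.
apply: (kt1 vP v5 vd hE dE res lift (n := (4 * `|(- i - 1)%R| + 2)%N) (c := 2) isT gr _ _ FP).
- by rewrite geE; apply: veq_eq mv; rewrite PoszD PoszM iE; clear; lia.
(* As g + ee = -1, this is minus the sum of D and the numerator of t, over D; the terms in x^5
   cancel in that sum. *)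
- have -> : g + ee - t = - ((- (5 ^+ 2 * x ^+ 4) + (200%:~R * x ^+ 3 + (- 220)%:~R * x ^+ 2 +
      85%:~R * x ^+ 1 + (- 11)%:~R * x ^+ 0)) / D).
    rewrite /g /ee /t !mulrNz.
    have -> : (- 1 + m) / 2 + (- 1 - m) / 2 = - D / D by field; rewrite n2 D0.
    rewrite -[RHS]mulNr -[LHS]mulrBl; congr (_ * _); rewrite /D yD; ring.
  rewrite (vgeN vP); apply: vge_le (vgeF vP (k := 16 * a + 8) _ Dv) _; last by move: ai i0; clear; lia.
  apply: (vgeD vP); first by rewrite (vgeN vP); apply: vge_veq (veqM vP (veqX vP 2 v5) (veqX vP 4 ha)) _; clear; lia.
  by apply: (vgeD vP); [apply: (vgeD vP); [apply: (vgeD vP) |] |]; apply: gM; move: ai i0; clear; lia.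
have h3 := five_dvd_3X `|(- i - 1)%R|; move: h3; set z := 3 ^+ (4 * `|(- i - 1)%R|) => h3.
rewrite addn2 (_ : _ - 4 = 162 * (z - 1) + 158); last by rewrite !exprS -/z; ring.
by rewrite rpredDl ?dvdz_mull.
Qed.
End RationalPoints.

Lemma golden_of_zeta (F : fieldType) (z : F) : z ^+ 5 = 1 -> 1 + z + z ^+ 2 + z ^+ 3 + z ^+ 4 = 0 ->
  let h := z + z ^+ 4 in let d := z - z ^+ 4 in h ^+ 2 = 1 - h /\ d ^+ 2 = h ^+ 2 - 4.
Proof.
move=> z5 zs h d.
have z8 : z ^+ 8 = z ^+ 3 by rewrite (_ : z ^+ 8 = z ^+ 5 * z ^+ 3); [rewrite z5 mul1r | rewrite -exprD].
have hE : h ^+ 2 = z ^+ 2 + z ^+ 3 + 2.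
  by rewrite /h (_ : (z + z ^+ 4) ^+ 2 = z ^+ 2 + 2 * z ^+ 5 + z ^+ 8); [rewrite z5 z8; ring | ring].
have dE : d ^+ 2 = z ^+ 2 + z ^+ 3 - 2.
  by rewrite /d (_ : (z - z ^+ 4) ^+ 2 = z ^+ 2 - 2 * z ^+ 5 + z ^+ 8); [rewrite z5 z8; ring | ring].
split; last by rewrite hE dE; ring.
apply/eqP; rewrite -subr_eq0 hE -zs /h; apply/eqP; ring.
Qed.

Lemma v_d (F : fieldType) (v : F -> int) (h d : F) : valuation_axiom v -> veq v 4 (5 : F) ->
  h ^+ 2 = 1 - h -> d ^+ 2 = h ^+ 2 - 4 -> veq v 1 d.
Proof.
move=> vP v5 hE dE; apply: (veq_sqrt vP); rewrite dE -opprB (veqN vP) (h_fourB hE).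
have h1 := rs_unit vP v5 (rsD vP (rsc v 1) (rs_h vP v5 hE)) isT.
by apply: veq_eq (veqM vP (v_r vP v5 hE) h1).
Qed.

Lemma hyperelliptic_points (S Z : rat) : 5 * Z ^+ 2 = 1 + 4 * S ^+ 5 -> S = 1.
Proof.
have [hE dE] := golden_of_zeta z5_5 z5_sum.
exact: (no_point (rat5 : {rmorphism rat -> cyc5}) v5P v5_5 v5_res (v_d v5P v5_5 hE dE) hE dE cyc5_fifth_root_lift).
Qed.

Lemma hyperelliptic_no_point (e Y : rat) :
  Y ^+ 2 = - 100 * e ^+ 5 + 200 * e ^+ 3 - 180 * e ^+ 2 + 60 * e - 7 -> False.
Proof.
have [hE dE] := golden_of_zeta z5_5 z5_sum.
exact: (no_elliptic_point (rat5 : {rmorphism rat -> cyc5}) v5P v5_5 v5_res (v_d v5P v5_5 hE dE) hE dE cyc5_fifth_root_lift).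
Qed.

(** * The sextic and its roots *)

Section Sextic.
Variables (K : fieldType) (e c : K).
(** This is c^2 times the monic polynomial whose roots are the six ratios of distinct roots of X^3 -
    X^2 + e X - c. *)
Definition sextic X := c ^+ 2 * (X ^+ 6 + 1) + (3 * c ^+ 2 - e * c) * (X ^+ 5 + X)
  + (6 * c ^+ 2 + (1 - 5 * e) * c + e ^+ 3) * (X ^+ 4 + X ^+ 2)
  + (7 * c ^+ 2 - 2 * e * c - (1 - 2 * e) * (e ^+ 2 - 2 * c)) * X ^+ 3.
(* Eliminating b from e2 = e s^2 and e3 = c s^3, where s = a + b + 1, gives s = snum a / sden a. *)
Definition sden X := c * ((X + 1) ^+ 2 - e * (X ^+ 2 + X + 1)) - e ^+ 2 * X.
Definition snum X := (X + 1) * (c * (X ^+ 2 + X + 1) - e ^+ 2 * X).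

(** For s = snum X / sden X and b = s - X - 1, the left side is sden^2 times e s^2 - (X b + X + b):
    the roots of the sextic are where the relation for e2 holds. *)
Lemma sextic_elim X : e * snum X ^+ 2 - (X + 1) * snum X * sden X + (X ^+ 2 + X + 1) * sden X ^+ 2 =
  e ^+ 2 * sextic X.
Proof. rewrite /snum /sden /sextic; ring. Qed.

Hypotheses (e0 : e != 0) (c0 : c != 0) (ec : c != e) (ec3 : c != e ^+ 3).
Variables a b : K.
Hypotheses (a0 : a != 0) (fa : sextic a = 0) (ab : sden a * (a + b + 1) = snum a).
Let s := a + b + 1.

(** If sden and snum vanish together, either a = -1, which forces c = e, or c (a^2 + a + 1) = e^2 a,
    which forces c = e^3. *)
Lemma sden_neq0 : sden a != 0.
Proof.
apply/eqP=> d0; move: ab; rewrite d0 mul0r => /esym/eqP; rewrite mulf_eq0 => /orP[/eqP a1|/eqP h].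
  have aE : a = - 1 by rewrite -[a](addrK 1) a1 sub0r.
  move/eqP: d0; rewrite aE /sden (_ : _ - _ = e * (e - c)); last by ring.
  by rewrite mulf_eq0 (negPf e0) subr_eq0 eq_sym (negPf ec).
have : sden a = a * (c - e ^+ 3).
  by rewrite -[LHS](subrK ((1 - e) * (c * (a ^+ 2 + a + 1) - e ^+ 2 * a))) {2}h /sden; ring.
by move/eqP; rewrite d0 eq_sym mulf_eq0 (negPf a0) subr_eq0 (negPf ec3).
Qed.

Lemma triple_e2 : a * b + a + b = e * s ^+ 2.
Proof.
have d0 := sden_neq0; have E := sextic_elim a; rewrite fa mulr0 -ab -/s in E.
have : sden a ^+ 2 * (e * s ^+ 2 - (a + 1) * s + (a ^+ 2 + a + 1)) = 0 by rewrite -E; ring.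
move/eqP; rewrite mulf_eq0 expf_eq0 (negPf d0) /= => /eqP h.
have -> : e * s ^+ 2 = (a + 1) * s - (a ^+ 2 + a + 1).
  by apply/eqP; rewrite -subr_eq0 -h; apply/eqP; ring.
by rewrite /s; ring.
Qed.

Lemma triple_e3 : a * b = c * s ^+ 3.
Proof.
have h2 := triple_e2; have E := ab; rewrite -/s in E.
have hs : e * s ^+ 2 = (a + 1) * s - (a ^+ 2 + a + 1) by rewrite -h2 /s; ring.
have : e ^+ 2 * (c * s ^+ 3 - a * b) = 0.
  have -> : e ^+ 2 * (c * s ^+ 3 - a * b) = c * s * e * (e * s ^+ 2) - e ^+ 2 * a * b by ring.
  have -> : c * s * e * (e * s ^+ 2) = c * (a + 1) * (e * s ^+ 2) - c * e * s * (a ^+ 2 + a + 1).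
    by rewrite {1}hs; ring.
  have -> : c * (a + 1) * (e * s ^+ 2) - c * e * s * (a ^+ 2 + a + 1) - e ^+ 2 * a * b =
     sden a * s - snum a + (c * (a + 1) * (e * s ^+ 2) - c * (a + 1) * ((a + 1) * s - (a ^+ 2 + a + 1))).
    by rewrite /sden /snum /s; ring.
  by rewrite E hs; ring.
move/eqP; rewrite mulf_eq0 expf_eq0 (negPf e0) /= subr_eq0 => /eqP; exact: esym.
Qed.

Lemma triple_s_neq0 : s != 0.
Proof.
apply/eqP=> s0; have := triple_e2; have := triple_e3; rewrite s0 !expr0n !mulr0 /=.
move=> /eqP; rewrite mulf_eq0 (negPf a0) /= => /eqP b0; rewrite b0 mulr0 add0r addr0 => a00.
by move: a0; rewrite a00 eqxx.
Qed.
Lemma triple_b_neq0 : b != 0.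
Proof.
apply/eqP=> b0; have := triple_e3; rewrite b0 mulr0 => /esym/eqP.
by rewrite mulf_eq0 (negPf c0) expf_eq0 (negPf triple_s_neq0) andbF.
Qed.

Lemma sextic_prod X : sextic X =
  c ^+ 2 * ((X - a) * (X - b) * (X - b / a) * (X - 1 / a) * (X - 1 / b) * (X - a / b)).
Proof.
have s0 := triple_s_neq0; have b0 := triple_b_neq0.
have eE : e = (a * b + a + b) / s ^+ 2 by rewrite triple_e2; field.
have cE : c = a * b / s ^+ 3 by rewrite triple_e3; field.
by rewrite /sextic eE cE /s; rewrite /s in s0; field; rewrite s0 a0 b0.
Qed.

(** By Newton's identities the fifth power sum is s^5 (5 e^2 - 5 e + 1 - 5 (e - 1) c). *)
Lemma triple_fermat : 5 * (e - 1) * c = 5 * e ^+ 2 - 5 * e + 1 -> a ^+ 5 + b ^+ 5 + 1 = 0.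
Proof.
have s0 := triple_s_neq0.
have eE : e = (a * b + a + b) / s ^+ 2 by rewrite triple_e2; field.
have cE : c = a * b / s ^+ 3 by rewrite triple_e3; field.
move=> h; have -> : a ^+ 5 + b ^+ 5 + 1 = s ^+ 5 * (5 * e ^+ 2 - 5 * e + 1 - 5 * (e - 1) * c).
  by rewrite eE cE /s; rewrite /s in s0; field.
by rewrite h subrr mulr0.
Qed.
End Sextic.

(* The coefficients of the statement over any field, to be transported by morphisms. *)
Definition uF (K : fieldType) (t : K) : K := (3*t^+2 - 2*t + 2) / (t^+2 + t - 1).
Definition vF (K : fieldType) (t : K) : K :=
  (t^+5 - 5*t^+4 + 10*t^+3 - 20*t^+2 + 15*t - 7) / ((t - 2) * (t^+2 + t - 1)^+2).
Definition wF (K : fieldType) (t : K) : K :=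
  (-3*t^+5 + 10*t^+4 - 20*t^+3 + 20*t^+2 - 20*t + 6) / ((t - 2) * (t^+2 + t - 1)^+2).
Definition sF (K : fieldType) (t : K) : K := (t^+4 - 3*t^+3 - t^+2 + 3*t + 1) * (t - 2).
Definition aF (K : fieldType) (t : K) (i : nat) : K :=
  let s := sF t in
  let q := t^+2 + t - 1 in
  match i with
  | 0 => - ((t^+2 + 1) * (t^+3 - t^+2 + 2*t - 3)) / s
  | 1 => - (3*t^+7 - 9*t^+6 + 16*t^+5 - 15*t^+4 + 10*t^+3 - 11*t^+2 + 8*t - 7) / (q * s)
  | 2 => (2*t^+8 - 14*t^+7 + 52*t^+6 - 99*t^+5 + 100*t^+4 - 54*t^+3 + 38*t^+2 - 44*t + 13)
           / (q * (t - 2) * s)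
  | 3 => (t^+8 + t^+7 - 21*t^+6 + 65*t^+5 - 90*t^+4 + 78*t^+3 - 57*t^+2 + 32*t - 15)
           / (q * (t - 2) * s)
  | 4 => - (2*t^+5 - 6*t^+4 + 13*t^+3 - 14*t^+2 + 7*t - 5) / s
  | 5 => - (q * (t^+3 - t^+2 + 2*t - 3)) / s
  | _ => 0
  end.

Section Coefficients.
Variables (R K : fieldType) (f : {rmorphism R -> K}) (t : R).
Let rE := (rmorph_nat, rmorphXn, fmorphV, rmorphM, rmorphN, rmorphB, rmorphD, rmorph1, rmorph0).
Lemma rmorph_uF : f (uF t) = uF (f t). Proof. by rewrite /uF !rE. Qed.
Lemma rmorph_vF : f (vF t) = vF (f t). Proof. by rewrite /vF !rE. Qed.
Lemma rmorph_wF : f (wF t) = wF (f t). Proof. by rewrite /wF !rE. Qed.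
Lemma rmorph_aF i : f (aF t i) = aF (f t) i.
Proof. by case: i => [|[|[|[|[|[|i]]]]]]; rewrite /aF /sF /= !rE. Qed.
End Coefficients.

Section TCoordinate.
Variables (K : fieldType) (t : K).
Hypotheses (n5 : (5 : K) != 0) (t1 : t - 1 != 0) (t2 : t - 2 != 0).
Hypotheses (tq : t ^+ 2 + t - 1 != 0) (ts : t ^+ 4 - 3 * t ^+ 3 - t ^+ 2 + 3 * t + 1 != 0).
Let e := - (t - 2)^-1.
Let c := - (t ^+ 2 + t - 1) / (5 * (t - 2) * (t - 1)).
Definition sexticF X := X ^+ 6 + uF t * X ^+ 5 + vF t * X ^+ 4 + wF t * X ^+ 3 + vF t * X ^+ 2 + uF t * X + 1.

Lemma sexticFE X : c ^+ 2 * sexticF X = sextic e c X.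
Proof.
rewrite /sextic /sexticF /uF /vF /wF /e /c; field.
by rewrite n5 t1 t2 tq.
Qed.

(** The coefficients [aF t i] are those of snum / sden - X - 1 modulo the sextic. After
    multiplication by sden the claim is a polynomial divisibility. *)
Lemma beta_relation a : sexticF a = 0 ->
  sden e c a * (a + (\sum_(i < 6) aF t i * a ^+ i) + 1) = snum e c a.
Proof.
move=> fa; rewrite !big_ord_recr big_ord0 /= add0r.
(* q1 X + q0 is the quotient of sden (X + sum + 1) - snum by the sextic. *)
set q1 := aF t 5 * (c * (1 - e)).
pose q0 := aF t 5 * (2 * c - c * e - e ^+ 2) + aF t 4 * (c * (1 - e)) - q1 * uF t.
apply/eqP; rewrite -subr_eq0 -[X in _ == X](mulr0 (q1 * a + q0)) -fa; apply/eqP.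
rewrite /q0 /q1 /sexticF /sden /snum /uF /vF /wF /aF /sF /e /c.
by field; rewrite n5 t1 t2 tq ts.
Qed.
End TCoordinate.

(** * Roots and discriminant of the rational cubic *)

Lemma rat_quadratic (t : rat) : t ^+ 2 + t - 1 != 0.
Proof.
apply/eqP=> h; have /eqP := rat_sqr_neq5 (2 * t + 1); apply.
have -> : (2 * t + 1) ^+ 2 = 4 * (t ^+ 2 + t - 1) + 5 by ring.
by rewrite h mulr0 add0r.
Qed.

Lemma rmorph_quartic (R R' : comNzRingType) (f : {rmorphism R -> R'}) y :
  f (y ^+ 4 - 5 * y ^+ 3 + 5 * y ^+ 2 + 5 * y - 5) = f y ^+ 4 - 5 * f y ^+ 3 + 5 * f y ^+ 2 + 5 * f y - 5.
Proof. by rewrite !(rmorph_nat, rmorphXn, rmorphM, rmorphN, rmorphB, rmorphD). Qed.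

(** An Eisenstein polynomial at 5: either y^4 or the constant term dominates. With y = 2 - t it is
    the quartic factor of [s_t]. *)
Lemma quartic_neq0 (F : fieldType) (v : F -> int) (f : {rmorphism rat -> F}) (y : rat) :
  valuation_axiom v -> veq v 4 (5 : F) -> y ^+ 4 - 5 * y ^+ 3 + 5 * y ^+ 2 + 5 * y - 5 != 0.
Proof.
move=> vP v5; rewrite -(fmorph_eq0 f) rmorph_quartic.
case: (eqVneq y 0) => [->|y0].
  by rewrite rmorph0 !expr0n /= !mulr0 subr0 !add0r oppr_eq0 (veq_neq0 v5).
have [k hk] := val_rat f vP v5 y0; move: (f y) hk => x hk.
have g n : veq v (4 + 4 * k * n%:Z) (5 * x ^+ n) := veqM vP v5 (veqX vP n hk).
have gg l n : l <= 4 + 4 * k * n%:Z -> vge v l (5 * x ^+ n) by apply: vge_veq.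
case: (lerP k 0) => k0.
- have -> : x ^+ 4 - 5 * x ^+ 3 + 5 * x ^+ 2 + 5 * x - 5 =
    x ^+ 4 - (5 * x ^+ 3 - 5 * x ^+ 2 - 5 * x ^+ 1 + 5 * x ^+ 0) by ring.
  apply: veq_neq0 (_ : veq v (16 * k) _); apply: (veqBl vP).
    by apply: veq_eq (veqX vP 4 hk); clear; lia.
  apply: (vgeD vP); first apply: (vgeB vP); first apply: (vgeB vP).
  apply (gg _ 3%N); move: k0; clear; lia.
 apply (gg _ 2%N); move: k0; clear; lia.
 apply (gg _ 1%N); move: k0; clear; lia.
 apply (gg _ 0%N); move: k0; clear; lia.
- have -> : x ^+ 4 - 5 * x ^+ 3 + 5 * x ^+ 2 + 5 * x - 5 =
  - (5 - (x ^+ 4 - 5 * x ^+ 3 + 5 * x ^+ 2 + 5 * x ^+ 1)) by ring.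
rewrite oppr_eq0; apply: veq_neq0 (_ : veq v 4 _); apply: (veqBl vP v5).
apply: (vgeD vP); first apply: (vgeD vP); first apply: (vgeB vP).
  + by apply: vge_veq (veqX vP 4 hk) _; move: k0; clear; lia.
  all: by apply: gg; move: k0; clear; lia.
Qed.

Lemma rat_quartic (t : rat) : t ^+ 4 - 3 * t ^+ 3 - t ^+ 2 + 3 * t + 1 != 0.
Proof.
have := quartic_neq0 (rat5 : {rmorphism rat -> cyc5}) (2 - t) v5P v5_5.
by congr (_ != 0); ring.
Qed.

(** Dividing by s^5 and completing the square in p / s^2 gives a point of 5 Z^2 = 1 + 4 S^5 with S =
    - 1 / s. *)
Lemma dickson5_eqN1 (s p : rat) : dickson5 s p = - 1 -> s = - 1.
Proof.
move=> h; have s0 : s != 0.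
  apply/eqP=> s0; move: h; have -> : dickson5 s p = 0 by rewrite s0 /dickson5; ring.
  by move/eqP; rewrite eq_sym oppr_eq0 oner_eq0.
suff S1 : - s^-1 = 1 by rewrite -[s]invrK -[s^-1]opprK S1 invrN invr1.
apply: (@hyperelliptic_points _ (2 * p / s ^+ 2 - 1)).
have -> : 5 * (2 * p / s ^+ 2 - 1) ^+ 2 = 1 + 4 * (dickson5 s p / s ^+ 5) by rewrite /dickson5; field.
by rewrite h; field.
Qed.

Section Cubic.
Variables (e c : rat).
Hypothesis ec : 5 * (e - 1) * c = 5 * e ^+ 2 - 5 * e + 1.
Hypothesis c0 : c != 0.

(** Two roots would have sum 1 - q and product p = c / q, and the vanishing fifth power sum reads
    dickson5 (1 - q) p = - q^5. After scaling by q, [dickson5_eqN1] gives 1 - q = - q. *)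
Lemma cubic_no_root q : q ^+ 3 - q ^+ 2 + e * q - c != 0.
Proof.
apply/eqP=> h; have q0 : q != 0.
  by apply: contraNneq c0 => q0; move/eqP: h; rewrite q0 !expr0n mulr0 subr0 !add0r oppr_eq0.
pose p := c / q; have cE : c = p * q by rewrite /p; field.
have eE : e = p + q * (1 - q).
  apply: (mulIf q0); apply/eqP; rewrite -subr_eq0.
  have -> : e * q - (p + q * (1 - q)) * q = (q ^+ 3 - q ^+ 2 + e * q - c) + (c - p * q) by ring.
  by rewrite h add0r -cE subrr.
have D0 : dickson5 (1 - q) p + q ^+ 5 = 0.
  have -> : dickson5 (1 - q) p + q ^+ 5 = 5 * e ^+ 2 - 5 * e + 1 - 5 * (e - 1) * c.
    by rewrite eE cE /dickson5; ring.
  by rewrite ec subrr.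
have := @dickson5_eqN1 ((1 - q) / q) (p / q ^+ 2).
have -> : dickson5 ((1 - q) / q) (p / q ^+ 2) = (dickson5 (1 - q) p + q ^+ 5) / q ^+ 5 - 1.
  by rewrite /dickson5; field.
rewrite D0 mul0r sub0r => /(_ erefl) /(congr1 (fun z => z * q)).
by rewrite divfK // mulN1r => /eqP; rewrite subr_eq addNr oner_eq0.
Qed.

(** Multiplied by (5 (e - 1))^2, the discriminant involves c only through 5 (e - 1) c, whose
    elimination leaves the quintic in e. *)
Lemma cubic_disc q : q ^+ 2 != e ^+ 2 - 4 * e ^+ 3 - 4 * c + 18 * e * c - 27 * c ^+ 2.
Proof.
apply/eqP=> h; apply: (@hyperelliptic_no_point e (5 * (e - 1) * q)).
rewrite exprMn h.
have -> : (5 * (e - 1)) ^+ 2 * (e ^+ 2 - 4 * e ^+ 3 - 4 * c + 18 * e * c - 27 * c ^+ 2) =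
  25 * (e - 1) ^+ 2 * (e ^+ 2 - 4 * e ^+ 3) + 5 * (e - 1) * (18 * e - 4) * (5 * (e - 1) * c)
    - 27 * (5 * (e - 1) * c) ^+ 2 by ring.
by rewrite ec; ring.
Qed.
End Cubic.

Lemma rmorph_disc (R R' : comNzRingType) (f : {rmorphism R -> R'}) e c :
  f (e ^+ 2 - 4 * e ^+ 3 - 4 * c + 18 * e * c - 27 * c ^+ 2) =
  f e ^+ 2 - 4 * f e ^+ 3 - 4 * f c + 18 * f e * f c - 27 * f c ^+ 2.
Proof. by rewrite !(rmorph_nat, rmorphXn, rmorphM, rmorphN, rmorphB, rmorphD). Qed.
(** * The Galois group *)

Section Degrees.
Variables (L : fieldExtType rat).
Local Notation iota := (in_alg L).
Local Notation "p ^^" := (map_poly iota p) (at level 2).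

Lemma adjoin_degree_irr (p : {poly rat}) (x : L) :
  irreducible_poly p -> root p^^ x -> adjoin_degree 1 x = (size p).-1.
Proof.
move=> [p1 p_irr] px.
have := minPoly_dvdp (K := 1%AS) (p := p^^) _ px.
have /polyOver1P[q qE] := minPolyOver 1%AS x.
have sq : size q = (adjoin_degree 1%AS x).+1 by rewrite -(size_map_poly iota q) -qE size_minPoly.
rewrite qE dvdp_map => /(_ _) qp.
have : q %= p.
  apply: p_irr; last by apply: qp; apply/polyOver1P; exists p.
  by rewrite sq eqSS -lt0n /adjoin_degree.
by move/eqp_size; rewrite sq => <-.
Qed.

Lemma irr_of_degree (p : {poly rat}) (x : L) :
  root p^^ x -> size p = (adjoin_degree 1 x).+1 -> (0 < adjoin_degree 1%AS x)%N ->
  irreducible_poly p /\ p^^ %= minPoly 1 x.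
Proof.
move=> px sp d0.
have mp : minPoly 1%AS x %= p^^.
  have := minPoly_dvdp (K := 1%AS) (p := p^^) _ px => /(_ _)/dvdp_size_eqp <-.
    by rewrite size_minPoly size_map_poly sp.
  by apply/polyOver1P; exists p.
split; last by rewrite eqp_sym.
split; first by rewrite sp ltnS.
move=> q q1 qp.
have qm : q^^ %| minPoly 1%AS x by rewrite (eqp_dvdr _ mp) dvdp_map.
have := minPoly_irr (p := q^^) _ qm => /(_ _)/orP[]; first by apply/polyOver1P; exists q.
  by move=> h; rewrite -(eqp_map iota); apply: eqp_trans h mp.
by move/eqp_size; rewrite size_map_poly size_poly1 => sq; rewrite sq in q1.
Qed.

Lemma dvd_dim_of_irr (E : {subfield L}) (p : {poly rat}) (x : L) :
  irreducible_poly p -> root p^^ x -> x \in E -> ((size p).-1 %| \dim E)%N.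
Proof.
move=> p_irr px xE; rewrite -(adjoin_degree_irr p_irr px).
have sE : (<<1%AS; x>>%AS <= E)%VS by apply/FadjoinP; rewrite sub1v.
by have := field_dimS sE; rewrite dim_Fadjoin dimv1 muln1.
Qed.

Definition cubic (e c : rat) : {poly rat} := 'X^3 - 'X^2 + e *: 'X - c%:P.

Lemma size_cubic e c : size (cubic e c) = 4%N.
Proof.
rewrite /cubic -!addrA size_polyDl size_polyXn // ltnS.
rewrite (leq_trans (size_polyD _ _)) // geq_max size_polyN size_polyXn /=.
rewrite (leq_trans (size_polyD _ _)) // geq_max size_polyN.
by rewrite (leq_trans (size_scale_leq _ _)) ?size_polyX // (leq_trans (size_polyC_leq1 _)).
Qed.

Section Triple.
Variables (E : {subfield L}) (e c : rat) (x y z : L).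
Hypothesis ec : 5 * (e - 1) * c = 5 * e ^+ 2 - 5 * e + 1.
Hypothesis c0 : c != 0.
Hypotheses (e1 : x + y + z = 1) (e2 : x * y + y * z + z * x = e%:A) (e3 : x * y * z = c%:A).
Hypotheses (xE : x \in E) (yE : y \in E) (zE : z \in E).

Lemma cubic_roots u : root (cubic e c)^^ u = (u \in [:: x; y; z]).
Proof.
have -> : root (cubic e c)^^ u = ((u - x) * (u - y) * (u - z) == 0).
  rewrite /root /cubic rmorphB rmorphD rmorphB /= map_polyZ !map_polyXn map_polyX map_polyC /=.
  rewrite !hornerE -e2 -e3; congr (_ == 0).
  have -> : u ^+ 2 = u ^+ 2 * (x + y + z) by rewrite e1 mulr1.
  by ring.
by rewrite !mulf_eq0 !subr_eq0 !inE orbA.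
Qed.

Lemma cubic_irr : irreducible_poly (cubic e c).
Proof.
apply: cubic_irreducible; first by rewrite size_cubic.
move=> q; rewrite /root /cubic !hornerE; exact: cubic_no_root.
Qed.

Let delta := (x - y) * (y - z) * (z - x).
Let disc := e ^+ 2 - 4 * e ^+ 3 - 4 * c + 18 * e * c - 27 * c ^+ 2.

Lemma delta2 : delta ^+ 2 = disc%:A.
Proof.
have -> : disc%:A = e%:A ^+ 2 - 4 * e%:A ^+ 3 - 4 * c%:A + 18 * e%:A * c%:A - 27 * c%:A ^+ 2 :> L.
  have := @rmorph_disc _ _ iota e c; exact.
have zE' : z = 1 - x - y by rewrite -e1; ring.
by rewrite -e2 -e3 /delta zE'; ring.
Qed.

(** The factor 3 comes from a root of the irreducible cubic, the factor 2 from delta, a square root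
    of the discriminant. *)
Lemma six_dvd_dim : (6 %| \dim E)%N.
Proof.
rewrite (@Gauss_dvd 2 3) //; apply/andP; split; last first.
  by have := dvd_dim_of_irr cubic_irr _ zE; rewrite size_cubic; apply; rewrite cubic_roots !inE eqxx !orbT.
have s2 : size ('X^2 - disc%:P) = 3%N by rewrite size_XnsubC.
have dE : delta \in E by rewrite !rpredM ?rpredB.
have := dvd_dim_of_irr (p := 'X^2 - disc%:P) _ _ dE; rewrite s2; apply.
  apply: cubic_irreducible; first by rewrite s2.
  by move=> q; rewrite /root !hornerE subr_eq0; apply: cubic_disc.
by rewrite /root rmorphB /= map_polyXn map_polyC /= !hornerE delta2 subrr.
Qed.

Lemma uniq_triple : uniq [:: x; y; z].
Proof.
have d0 : delta != 0.
  apply/eqP=> d0; have /eqP := delta2; rewrite d0 expr0n /= eq_sym.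
  rewrite scaler_eq0 oner_eq0 orbF => /eqP h.
  by have := cubic_disc ec 0; rewrite -/disc h expr0n eqxx.
move: d0; rewrite /delta !mulf_eq0 !negb_or !subr_eq0 /= !inE negb_or andbT.
by rewrite (eq_sym z x) => /andP[/andP[-> ->] ->].
Qed.
End Triple.
End Degrees.

Section GaloisTriple.
Variables (L : splittingFieldType rat) (E : {subfield L}) (e c : rat) (x y z : L).
Hypothesis ec : 5 * (e - 1) * c = 5 * e ^+ 2 - 5 * e + 1.
Hypothesis c0 : c != 0.
Hypotheses (e1 : x + y + z = 1) (e2 : x * y + y * z + z * x = e%:A) (e3 : x * y * z = c%:A).
Hypotheses (xE : x \in E) (yE : y \in E) (zE : z \in E).
Hypothesis gen : (E <= <<1; x / z>>)%VS.
Local Notation G := ('Gal(E / 1))%g.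
Local Notation iota := (in_alg L).

Definition triple : seq L := [:: x; y; z].
Definition troot (i : 'I_3) : L := triple`_i.

Lemma troot_inj : injective troot.
Proof.
move=> i j /eqP; rewrite /troot nth_uniq // ?ltn_ord //; last exact: uniq_triple ec e1 e2 e3.
by move/eqP/val_inj.
Qed.
Lemma troot_in i : troot i \in E.
Proof. by case: i => [[|[|[|]]]]. Qed.

Lemma gal_troot g (i : 'I_3) : g \in G -> exists j, g (troot i) = troot j.
Proof.
move=> gG; have sE : (1%AS <= E)%VS := sub1v _.
have r_in u : u \in E -> root (map_poly iota (cubic e c)) u -> root (map_poly iota (cubic e c)) (g u).
  move=> uE ru; have := root_minPoly_gal sE gG uE; rewrite -!dvdp_XsubCl => /dvdp_trans; apply.
  apply: minPoly_dvdp => //.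
  by apply/polyOver1P; exists (cubic e c).
have := r_in _ (troot_in i) _; rewrite !(cubic_roots e1 e2 e3).
have tin : troot i \in triple by rewrite mem_nth.
move=> /(_ tin) => gin.
have lt3 : (index (g (troot i)) triple < 3)%N by rewrite -[3%N]/(size triple) index_mem.
by exists (Ordinal lt3); rewrite /troot /= nth_index.
Qed.

Lemma gal_perm_ex g : g \in G -> exists s : 'S_3, forall i, g (troot i) = troot (s i).
Proof.
move=> gG; have [f fE] := fin_all_exists (fun i => gal_troot i gG).
have f_inj : injective f.
  move=> i j fij; apply: troot_inj.
  have : g (troot i) = g (troot j) by rewrite !fE fij.
  exact: fmorph_inj.
by exists (perm f_inj) => i; rewrite permE.
Qed.

Definition gal_perm (g : gal_of E) : 'S_3 :=
  odflt 1%g [pick s : 'S_3 | [forall i, g (troot i) == troot (s i)]].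

Lemma gal_permP g i : g \in G -> g (troot i) = troot (gal_perm g i).
Proof.
move=> gG; rewrite /gal_perm; case: pickP => [s /forallP/(_ i)/eqP //|nos].
by have [s sE] := gal_perm_ex gG; have /forallP[] := negbT (nos s) => j; apply/eqP; apply: sE.
Qed.

Lemma gal_permM : {in G &, {morph gal_perm : g h / (g * h)%g}}.
Proof.
move=> g h gG hG; apply/permP=> i; apply: troot_inj.
rewrite -gal_permP ?groupM // galM ?troot_in // permM.
by rewrite [g _]gal_permP // gal_permP.
Qed.
Canonical gal_perm_morphism := Morphism gal_permM.

(** An automorphism is determined by its value at x / z, which generates E. *)
Lemma gal_perm_injm : ('injm gal_perm_morphism)%g.
Proof.
apply/injmP=> g h gG hG /= gh; apply/eqP/gal_eqP=> a aE.
have r i : g (troot i) = h (troot i) by rewrite !gal_permP // gh.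
have /Fadjoin_polyP[p p1 ->] := subvP gen _ aE.
have sE : (1%AS <= E)%VS := sub1v _.
have gp k : k \in G -> k p.[x / z] = p.[k (x / z)].
  move=> kG; have := fixedPoly_gal sE kG p1 => {2}<-; exact/esym/horner_map.
rewrite !gp // !rmorphM !fmorphV /=.
by have := r 0; have := r 2; rewrite /troot /= => -> ->.
Qed.

Hypothesis dimE : \dim E = 6%N.
Hypothesis galE : galois 1 E.

Lemma gal_perm_surj : (gal_perm_morphism @* G = [set: 'S_3])%g.
Proof.
apply/eqP; rewrite eqEcard subsetT cardsT card_Sn card_injm ?gal_perm_injm //.
by have := galois_dim (K := 1%AS) galE; rewrite dimv1 divn1 dimE => <-.
Qed.

Lemma gal_isog_S3 : (G \isog [set: 'S_3])%g.
Proof. by rewrite -gal_perm_surj; apply: sub_isog gal_perm_injm. Qed.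

Lemma gal_perm_onto (s : 'S_3) : exists2 g, g \in G & gal_perm g = s.
Proof.
have : s \in (gal_perm_morphism @* G)%g by rewrite gal_perm_surj inE.
by case/morphimP=> g _ gG ->; exists g.
Qed.
End GaloisTriple.

(** * The six points and their two orbits *)

Section Points.
Variable L : fieldExtType rat.
Implicit Types (P Q R : 'rV[L]_3) (x y z k : L).

Lemma projeq_sym P Q : projeq P Q -> projeq Q P.
Proof. by case=> k k0 ->; exists k^-1; rewrite ?invr_eq0 // scalerA mulVf ?scale1r. Qed.
Lemma projeq_trans Q P R : projeq P Q -> projeq Q R -> projeq P R.
Proof. by case=> k k0 -> [l l0 ->]; exists (k * l); rewrite ?mulf_neq0 // scalerA. Qed.
Lemma projeq_perm (s : 'S_3) P Q : projeq P Q -> projeq (perm_pt s P) (perm_pt s Q).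
Proof. by case=> k k0 ->; exists k => //; apply/rowP=> j; rewrite !mxE. Qed.
Lemma perm_ptM (s t : 'S_3) P : perm_pt s (perm_pt t P) = perm_pt (s * t)%g P.
Proof. by apply/rowP=> j; rewrite !mxE permM. Qed.

Lemma pt3_entries x y z : ((pt3 x y z 0 0 = x) * (pt3 x y z 0 1 = y) * (pt3 x y z 0 2 = z))%type.
Proof. by rewrite !mxE. Qed.
Lemma scale_pt3 k x y z : k *: pt3 x y z = pt3 (k * x) (k * y) (k * z).
Proof. by apply/rowP=> -[[|[|[|//]]] ?]; rewrite !mxE. Qed.
Lemma pt3_projeq1 x y x' y' : projeq (pt3 x y 1) (pt3 x' y' 1) -> x = x'.
Proof.
case=> k _ /rowP E; have := E 0; have := E 2; rewrite !mxE /= mulr1 => <-.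
by rewrite mul1r.
Qed.

Variables (x y z : L).
Hypotheses (x0 : x != 0) (y0 : y != 0) (z0 : z != 0).
Let S := six_pts (x / z) (y / z).
Let troot (i : 'I_3) : L := [:: x; y; z]`_i.

(** The six points are the coordinate permutations of [x, y, z], scaled to last coordinate 1; both
    orbit statements rest on this. *)
Lemma six_ptsE : [/\ projeq (pt3 x y z) (pt3 (x / z) (y / z) 1),
  projeq (pt3 y x z) (pt3 (y / z) (x / z) 1) ,
  projeq (pt3 z y x) (pt3 (1 / (x / z)) (y / z / (x / z)) 1) /\
  projeq (pt3 y z x) (pt3 (y / z / (x / z)) (1 / (x / z)) 1) &
  projeq (pt3 z x y) (pt3 (1 / (y / z)) (x / z / (y / z)) 1) /\
  projeq (pt3 x z y) (pt3 (x / z / (y / z)) (1 / (y / z)) 1)].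
Proof.
split; [exists z|exists z|split; exists x|split; exists y] => //; rewrite scale_pt3; congr pt3;
  by field; rewrite ?x0 ?y0 ?z0.
Qed.

Lemma perm_pt_six (s : 'S_3) : exists2 R, R \in S & projeq (perm_pt s (pt3 x y z)) R.
Proof.
have [h1 h2 [h3 h4] [h5 h6]] := six_ptsE.
have -> : perm_pt s (pt3 x y z) = pt3 (troot (s 0)) (troot (s 1)) (troot (s 2)).
  by apply/rowP=> -[[|[|[|//]]] ?]; rewrite !mxE /= /troot; congr (nth _ _ (val (s _))); apply: val_inj.
have s01 : s 0 != s 1 by rewrite (inj_eq perm_inj).
have s02 : s 0 != s 2 by rewrite (inj_eq perm_inj).
have s12 : s 1 != s 2 by rewrite (inj_eq perm_inj).
move: (s 0) (s 1) (s 2) s01 s02 s12 => [[|[|[|//]]] ?] [[|[|[|//]]] ?] [[|[|[|//]]] ?] //= _ _ _.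
all: rewrite /troot /=.
all: eexists; [|first [exact: h1 | exact: h2 | exact: h3 | exact: h4 | exact: h5 | exact: h6]].
all: by rewrite /S !inE eqxx ?orbT.
Qed.

Lemma six_perm_pt R : R \in S -> exists s : 'S_3, projeq R (perm_pt s (pt3 x y z)).
Proof.
have [h1 h2 [h3 h4] [h5 h6]] := six_ptsE.
pose i1 : 'I_3 := 1; pose i2 : 'I_3 := 2.
have E (s : 'S_3) : perm_pt s (pt3 x y z) = pt3 (troot (s 0)) (troot (s 1)) (troot (s 2)).
  by apply/rowP=> -[[|[|[|//]]] ?]; rewrite !mxE /= /troot; congr (nth _ _ (val (s _))); apply: val_inj.
rewrite /S !inE; do ?case/orP; move/eqP=> ->.
- exists 1%g; rewrite E !perm1; exact: projeq_sym.
- exists (tperm 0 i1); rewrite E !permE /=; exact: projeq_sym.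
- exists (tperm 0 i2); rewrite E !permE /=; exact: projeq_sym.
- exists (tperm 0 i1 * tperm 0 i2)%g; rewrite E !permE /= !permE /=; exact: projeq_sym.
- exists (tperm 0 i2 * tperm 0 i1)%g; rewrite E !permE /= !permE /=; exact: projeq_sym.
- exists (tperm i1 i2)%g; rewrite E !permE /=; exact: projeq_sym.
Qed.

Lemma six_orbit P Q : P \in S ->
  (exists s : 'S_3, projeq Q (perm_pt s P)) <-> (exists2 R, R \in S & projeq Q R).
Proof.
move=> /six_perm_pt[s Ps]; split=> [[s' Qs']|[R /six_perm_pt[s' Rs'] QR]].
  have := projeq_trans Qs' (projeq_perm s' Ps); rewrite perm_ptM => h.
  by have [R RS hR] := perm_pt_six (s' * s)%g; exists R => //; apply: projeq_trans h hR.
exists (s' * s^-1)%g; apply: projeq_trans QR _; apply: projeq_trans Rs' _.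
have := projeq_sym (projeq_perm (s' * s^-1)%g Ps); rewrite perm_ptM -mulgA mulVg mulg1.
by [].
Qed.
End Points.

Section GalPoints.
Variables (L : splittingFieldType rat) (E : {subfield L}) (x y z : L).
Hypotheses (x0 : x != 0) (y0 : y != 0) (z0 : z != 0).
Local Notation G := ('Gal(E / 1))%g.
Local Notation v0 := (pt3 x y z).
Hypothesis gal_in : forall g, g \in G -> exists s : 'S_3, gal_pt g v0 = perm_pt s v0.
Hypothesis gal_onto : forall s : 'S_3, exists2 g, g \in G & gal_pt g v0 = perm_pt s v0.

Lemma projeq_gal (g : gal_of E) (P Q : 'rV[L]_3) : projeq P Q -> projeq (gal_pt g P) (gal_pt g Q).
Proof.
case=> k k0 ->; exists (g k); first by rewrite fmorph_eq0.
by apply/rowP=> j; rewrite !mxE rmorphM.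
Qed.
Lemma gal_perm_pt (g : gal_of E) s (P : 'rV[L]_3) : gal_pt g (perm_pt s P) = perm_pt s (gal_pt g P).
Proof. by apply/rowP=> j; rewrite !mxE. Qed.

(** Automorphisms permute the coordinates of [x, y, z] and commute with coordinate permutations, so
    the one acting as s^-1 s' takes the point of s to the point of s'. *)
Lemma six_gal_orbit P Q : P \in six_pts (x / z) (y / z) ->
  (exists2 g, g \in G & projeq Q (gal_pt g P)) <-> (exists2 R, R \in six_pts (x / z) (y / z) & projeq Q R).
Proof.
move=> /(six_perm_pt x0 y0 z0)[s Ps]; split=> [[g gG Qg]|[R /(six_perm_pt x0 y0 z0)[s' Rs'] QR]].
  have := projeq_trans Qg (projeq_gal g Ps); rewrite gal_perm_pt.
  have [s' ->] := gal_in gG; rewrite perm_ptM => h.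
  by have [R RS hR] := perm_pt_six x0 y0 z0 (s * s')%g; exists R => //; apply: projeq_trans h hR.
have [g gG gs] := gal_onto (s^-1 * s')%g; exists g => //.
apply: projeq_trans QR _; apply: projeq_trans Rs' _; apply: projeq_sym.
by have := projeq_gal g Ps; rewrite gal_perm_pt gs perm_ptM mulgA mulgV mul1g.
Qed.
End GalPoints.

(* A point of the Fermat quintic with e1 = 1 has e2 = e and 5 (e - 1) e3 = 5 e^2 - 5 e + 1;
   the coordinate t corresponds to e = 1 / (2 - t), c being e3. *)
Definition eF (R : fieldType) (t : R) : R := - (t - 2)^-1.
Definition cF (R : fieldType) (t : R) : R := - (t ^+ 2 + t - 1) / (5 * (t - 2) * (t - 1)).

Section CurveCoordinates.
Variables (R K : fieldType) (f : {rmorphism R -> K}) (t : R).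
Let rE := (rmorph_nat, rmorphXn, fmorphV, rmorphM, rmorphN, rmorphB, rmorphD, rmorph1, rmorph0).
Lemma rmorph_eF : f (eF t) = eF (f t). Proof. by rewrite /eF !rE. Qed.
Lemma rmorph_cF : f (cF t) = cF (f t). Proof. by rewrite /cF !rE. Qed.
Lemma rmorph_quad : f (t ^+ 2 + t - 1) = f t ^+ 2 + f t - 1. Proof. by rewrite !rE. Qed.
Lemma rmorph_quart : f (t ^+ 4 - 3 * t ^+ 3 - t ^+ 2 + 3 * t + 1) =
  f t ^+ 4 - 3 * f t ^+ 3 - f t ^+ 2 + 3 * f t + 1.
Proof. by rewrite !rE. Qed.
Lemma rmorph_subn n : f (t - n%:R) = f t - n%:R. Proof. by rewrite !rE. Qed.
End CurveCoordinates.

Section CurveRelations.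
Variables (K : fieldType) (t : K).
Hypotheses (n5 : (5 : K) != 0) (t1 : t - 1 != 0) (t2 : t - 2 != 0).
Hypotheses (tq : t ^+ 2 + t - 1 != 0) (ts : t ^+ 4 - 3 * t ^+ 3 - t ^+ 2 + 3 * t + 1 != 0).

Lemma eF_neq0 : eF t != 0. Proof. by rewrite oppr_eq0 invr_eq0. Qed.
Lemma cF_neq0 : cF t != 0.
Proof. by rewrite mulf_neq0 ?oppr_eq0 // invr_eq0 !mulf_neq0. Qed.
Lemma cF_neq_eF : cF t != eF t.
Proof.
rewrite -subr_eq0 (_ : _ - _ = - ((t - 2) / (5 * (t - 1)))).
  by rewrite oppr_eq0 mulf_neq0 // invr_eq0 mulf_neq0.
by rewrite /cF /eF; field; rewrite n5 t1 t2.
Qed.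
Lemma cF_neq_eF3 : cF t != eF t ^+ 3.
Proof.
rewrite -subr_eq0 (_ : _ - _ = - ((t ^+ 4 - 3 * t ^+ 3 - t ^+ 2 + 3 * t + 1) / (5 * (t - 2) ^+ 3 * (t - 1)))).
  by rewrite oppr_eq0 mulf_neq0 // invr_eq0 !mulf_neq0 // expf_neq0.
by rewrite /cF /eF; field; rewrite n5 t1 t2.
Qed.
Lemma eF_cF : 5 * (eF t - 1) * cF t = 5 * eF t ^+ 2 - 5 * eF t + 1.
Proof. by rewrite /cF /eF; field; rewrite n5 t1 t2. Qed.
End CurveRelations.

(** * Degree, roots and points for [f_t] *)

Section Theorem1.
Variables (t : rat) (ht1 : t != 1) (ht2 : t != 2).

Lemma size_f_t : size (f_t t) = 7%N.
Proof. by rewrite /f_t (@PolyK _ 0) //= oner_eq0. Qed.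

Lemma horner_f_t (K : fieldType) (f : {rmorphism rat -> K}) x :
  (map_poly f (f_t t)).[x] = sexticF (f t) x.
Proof.
rewrite /f_t map_Poly horner_Poly /= rmorph1.
rewrite -[u_t t]/(uF t) -[v_t t]/(vF t) -[w_t t]/(wF t) rmorph_uF rmorph_vF rmorph_wF /sexticF.
ring.
Qed.

Variables (L : splittingFieldType rat) (E : {subfield L}).
Hypothesis hE : splittingFieldFor 1%VS (map_poly (in_alg L) (f_t t)) E.
Variable a : L.
Hypotheses (aE : a \in E) (ha : root (map_poly (in_alg L) (f_t t)) a).
Local Notation iota := (in_alg L).
Let b := beta_of t a.
Let T : L := iota t.
Let e := eF t. Let c := cF t.

Let n5 : (5 : rat) != 0. Proof. by []. Qed.
Let t1 : t - 1 != 0. Proof. by rewrite subr_eq0. Qed.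
Let t2 : t - 2 != 0. Proof. by rewrite subr_eq0. Qed.
Let tq := rat_quadratic t.
Let ts := rat_quartic t.
Let n5L : (5 : L) != 0. Proof. by rewrite -(rmorph_nat iota) fmorph_eq0. Qed.
Let T1 : T - 1 != 0. Proof. by rewrite -(rmorph_subn iota t 1) fmorph_eq0. Qed.
Let T2 : T - 2 != 0. Proof. by rewrite -(rmorph_subn iota t 2) fmorph_eq0. Qed.
Let Tq : T ^+ 2 + T - 1 != 0. Proof. by rewrite -(rmorph_quad iota) fmorph_eq0. Qed.
Let Ts : T ^+ 4 - 3 * T ^+ 3 - T ^+ 2 + 3 * T + 1 != 0.
Proof. by rewrite -(rmorph_quart iota) fmorph_eq0. Qed.
Let eL : eF T = e%:A. Proof. by rewrite -(rmorph_eF iota). Qed.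
Let cL : cF T = c%:A. Proof. by rewrite -(rmorph_cF iota). Qed.

Let fa : sexticF T a = 0. Proof. by rewrite -horner_f_t; apply/eqP. Qed.
Let a0 : a != 0.
Proof.
apply/eqP=> a00; move: fa; rewrite a00 /sexticF !expr0n /= !mulr0 !add0r => /eqP.
by rewrite oner_eq0.
Qed.
Let sE x : cF T ^+ 2 * sexticF T x = sextic (eF T) (cF T) x := sexticFE n5L T1 T2 Tq x.
Let sa : sextic (eF T) (cF T) a = 0. Proof. by rewrite -sE fa mulr0. Qed.
Let bE : b = \sum_(i < 6) aF T i * a ^+ i.
Proof. by apply: eq_bigr => i _; rewrite -(rmorph_aF iota). Qed.
Let ab : sden (eF T) (cF T) a * (a + b + 1) = snum (eF T) (cF T) a.
Proof. by rewrite bE; exact: beta_relation. Qed.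

Let eT0 := eF_neq0 T2. Let cT0 := cF_neq0 n5L T1 T2 Tq.
Let cTe := cF_neq_eF n5L T1 T2. Let cTe3 := cF_neq_eF3 n5L T1 T2 Ts.
Let s := a + b + 1.
Let s0 : s != 0 := triple_s_neq0 eT0 cTe cTe3 a0 sa ab.
Let b0 : b != 0 := triple_b_neq0 eT0 cT0 cTe cTe3 a0 sa ab.
Let x := a / s. Let y := b / s. Let z := 1 / s.
Let x0 : x != 0. Proof. exact: mulf_neq0 a0 (invr_neq0 s0). Qed.
Let y0 : y != 0. Proof. exact: mulf_neq0 b0 (invr_neq0 s0). Qed.
Let z0 : z != 0. Proof. exact: mulf_neq0 (oner_neq0 L) (invr_neq0 s0). Qed.
Let xz : x / z = a. Proof. by rewrite /x /z div1r invrK mulfVK. Qed.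
Let yz : y / z = b. Proof. by rewrite /y /z div1r invrK mulfVK. Qed.
Let e1 : x + y + z = 1. Proof. by rewrite /x /y /z -!mulrDl divff. Qed.
Let e2 : x * y + y * z + z * x = e%:A.
Proof.
rewrite -eL; have := triple_e2 eT0 cTe cTe3 a0 sa ab; rewrite -/s => h.
by apply: (mulIf (expf_neq0 2 s0)); rewrite -h /x /y /z; field.
Qed.
Let e3 : x * y * z = c%:A.
Proof.
rewrite -cL; have := triple_e3 eT0 cTe cTe3 a0 sa ab; rewrite -/s => h.
by apply: (mulIf (expf_neq0 3 s0)); rewrite -h /x /y /z; field.
Qed.
Let ec : 5 * (e - 1) * c = 5 * e ^+ 2 - 5 * e + 1 := eF_cF n5 t1 t2.
Let c0 : c != 0 := cF_neq0 n5 t1 t2 tq.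
Let bEE : b \in E.
Proof. by apply: rpred_sum => i _; rewrite rpredM ?rpredX // rpredZ ?mem1v. Qed.
Let sEE : s \in E. Proof. by rewrite !rpredD ?mem1v. Qed.
Let xE : x \in E. Proof. by rewrite rpredM ?rpredV. Qed.
Let yE : y \in E. Proof. by rewrite rpredM ?rpredV. Qed.
Let zE : z \in E. Proof. by rewrite rpredM ?rpredV ?mem1v. Qed.

Let rts := [:: a; b; b / a; 1 / a; 1 / b; a / b].

Lemma root_f_t u : root (map_poly iota (f_t t)) u = (u \in rts).
Proof.
rewrite /root (_ : _.[u] = sexticF T u); last exact: horner_f_t.
have -> : (sexticF T u == 0) = (cF T ^+ 2 * sexticF T u == 0) by rewrite mulf_eq0 expf_eq0 (negPf cT0).
rewrite sE (sextic_prod eT0 cT0 cTe cTe3 a0 sa ab) mulf_eq0 expf_eq0 (negPf cT0) /=.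
by rewrite !mulf_eq0 !subr_eq0 !inE !orbA.
Qed.

Lemma beta_in_adjoin : b \in <<1%AS; a>>%AS.
Proof.
have aA : a \in <<1%AS; a>>%AS := memv_adjoin 1%AS a.
by apply: rpred_sum => i _; rewrite rpredM ?rpredX // rpredZ ?mem1v.
Qed.

Lemma rts_in_adjoin u : u \in rts -> u \in <<1%AS; a>>%AS.
Proof.
have aA : a \in <<1%AS; a>>%AS := memv_adjoin 1%AS a.
have bA : b \in <<1%AS; a>>%AS := beta_in_adjoin.
have oA : 1 \in <<1%AS; a>>%AS := mem1v _.
by rewrite !inE; do ?case/orP; move/eqP=> ->; rewrite // rpredM // rpredV.
Qed.

Lemma splitting_adjoin : E = <<1; a>>%VS :> {vspace L}.
Proof.
have [rs prs defE] := hE; apply/eqP; rewrite eqEsubv; apply/andP; split; last first.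
  by apply/(FadjoinP (K := 1%AS)); rewrite sub1v.
rewrite -defE; apply/(Fadjoin_seqP (K := 1%AS) (E := <<1%AS; a>>%AS)); split; first exact: sub1v.
by move=> u urs; apply: rts_in_adjoin; rewrite -root_f_t (eqp_root prs) root_prod_XsubC.
Qed.

(** The degree is at most that of [f_t], and it is divisible by 6 because Q(a) is the whole field E,
    which contains x, y, z. Irreducibility of [f_t] follows from this. *)
Lemma adjoin_degree_six : adjoin_degree 1%AS a = 6%N.
Proof.
have d6 : (6 %| adjoin_degree 1%AS a)%N.
  have := six_dvd_dim ec c0 e1 e2 e3 xE yE zE.
  by rewrite splitting_adjoin (dim_Fadjoin 1%AS) dimv1 muln1.
have : (minPoly 1%AS a %| map_poly iota (f_t t)).
  by apply: minPoly_dvdp => //; apply/polyOver1P; exists (f_t t).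
move/dvdp_leq; rewrite -size_poly_eq0 size_map_poly size_f_t size_minPoly => /(_ isT).
by rewrite ltnS => le6; apply/eqP; rewrite eqn_leq le6 dvdn_leq // /adjoin_degree.
Qed.

Lemma f_t_irr : irreducible_poly (f_t t) /\ map_poly iota (f_t t) %= minPoly 1 a.
Proof. by apply: (irr_of_degree ha); rewrite adjoin_degree_six // size_f_t. Qed.

Lemma dim_six : \dim E = 6%N.
Proof. by rewrite splitting_adjoin (dim_Fadjoin 1%AS) dimv1 muln1 adjoin_degree_six. Qed.

Let sep (K : {subfield L}) u : separable_element K u.
Proof. by apply: pcharf0_separable => p; rewrite pchar_lalg pchar_num. Qed.

(** Up to a constant [f_t] is a minimal polynomial in characteristic 0, so it has six distinct
    roots, and a list of six elements containing them cannot repeat. *)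
Lemma uniq_rts : uniq rts.
Proof.
have [rs prs defE] := hE.
have urs : uniq rs.
  rewrite -separable_prod_XsubC -(eqp_separable prs) (eqp_separable f_t_irr.2).
  exact: sep.
have srs : size rs = 6%N.
  by apply/eqP; rewrite -eqSS -(size_prod_XsubC rs id) -(eqp_size prs) size_map_poly size_f_t.
apply: (leq_size_uniq urs); last by rewrite srs.
by move=> u; rewrite -root_prod_XsubC -(eqp_root prs) root_f_t.
Qed.

Lemma galois_E : galois 1 E.
Proof.
apply/and3P; split; first exact: sub1v.
  by apply/(separableP (K := 1%AS)) => u _; apply: sep.
apply/(splitting_normalField (K := 1%AS)); first exact: sub1v.
by exists (map_poly iota (f_t t)) => //; apply/polyOver1P; exists (f_t t).
Qed.

Let genE : (E <= <<1; x / z>>)%VS. Proof. by rewrite xz splitting_adjoin. Qed.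

Lemma galE_S3 : ('Gal(E / 1) \isog [set: 'S_3])%g.
Proof. exact: gal_isog_S3 ec e1 e2 e3 xE yE zE genE dim_six galois_E. Qed.

Let v0 := pt3 x y z.
Let gal_v0 (g : gal_of E) (sg : 'S_3) : (forall i, g (troot x y z i) = troot x y z (sg i)) -> gal_pt g v0 = perm_pt sg v0.
Proof. by move=> h; apply/rowP=> j; rewrite !mxE; exact: h. Qed.

Lemma gal_orbit P Q : P \in six_pts a b ->
  (exists2 g, g \in 'Gal(E / 1)%g & projeq Q (gal_pt g P)) <-> (exists2 R, R \in six_pts a b & projeq Q R).
Proof.
have orb := @six_gal_orbit L E x y z x0 y0 z0 _ _ P Q; rewrite xz yz in orb; apply: orb => [g gG|sg].
  by have [sg hs] := gal_perm_ex ec e1 e2 e3 xE yE zE gG; exists sg; apply: gal_v0.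
have [g gG gs] := gal_perm_onto ec e1 e2 e3 xE yE zE genE dim_six galois_E sg.
exists g => //; apply: gal_v0 => i; rewrite (gal_permP ec e1 e2 e3 xE yE zE i gG) gs //.
Qed.

Lemma perm_orbit P Q : P \in six_pts a b ->
  (exists sg : 'S_3, projeq Q (perm_pt sg P)) <-> (exists2 R, R \in six_pts a b & projeq Q R).
Proof. by have orb := six_orbit x0 y0 z0 (P := P) Q; rewrite xz yz in orb. Qed.

Lemma fermat_ab : a ^+ 5 + b ^+ 5 + 1 = 0.
Proof. exact: (triple_fermat eT0 cTe cTe3 a0 sa ab (eF_cF n5L T1 T2)). Qed.

Lemma six_pts_on P : P \in six_pts a b -> (forall i, P 0 i \in E) /\ onF5 P /\ nontrivial P.
Proof.
have key u w : u \in E -> w \in E -> u != 0 -> w != 0 -> u ^+ 5 + w ^+ 5 + 1 = 0 ->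
    (forall i, pt3 u w 1 0 i \in E) /\ onF5 (pt3 u w 1) /\ nontrivial (pt3 u w 1).
  move=> uE wE u0 w0 uw; split; first by case=> [[|[|[|//]]] ?]; rewrite !mxE //= mem1v.
  split; first by rewrite /onF5 !pt3_entries expr1n.
  by case=> [[|[|[|//]]] ?]; rewrite !mxE //= oner_neq0.
have F := fermat_ab.
have F1 : (1 / a) ^+ 5 + (b / a) ^+ 5 + 1 = 0.
  by rewrite (_ : _ + 1 = (a ^+ 5 + b ^+ 5 + 1) / a ^+ 5); [rewrite F mul0r | field].
have F2 : (1 / b) ^+ 5 + (a / b) ^+ 5 + 1 = 0.
  by rewrite (_ : _ + 1 = (a ^+ 5 + b ^+ 5 + 1) / b ^+ 5); [rewrite F mul0r | field].
have o1 : 1 / a \in E by rewrite rpredM ?rpredV ?mem1v.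
have o2 : 1 / b \in E by rewrite rpredM ?rpredV ?mem1v.
have o3 : b / a \in E by rewrite rpredM ?rpredV.
have o4 : a / b \in E by rewrite rpredM ?rpredV.
have z1 : 1 / a != 0 by rewrite mulf_neq0 ?invr_eq0 ?oner_neq0.
have z2 : 1 / b != 0 by rewrite mulf_neq0 ?invr_eq0 ?oner_neq0.
have z3 : b / a != 0 by rewrite mulf_neq0 ?invr_eq0.
have z4 : a / b != 0 by rewrite mulf_neq0 ?invr_eq0.
rewrite !inE; do ?case/orP; move/eqP=> ->; apply: key => //; try by rewrite [X in X + _]addrC.
Qed.

(** With last coordinate 1, proportional points have equal first coordinates, and these are the six
    distinct roots. *)
Lemma six_pts_distinct i j : (i < 6)%N -> (j < 6)%N -> i != j ->
  ~ projeq (nth 0 (six_pts a b) i) (nth 0 (six_pts a b) j).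
Proof.
move=> i6 j6 ij h; pose fs := [:: a; b; 1 / a; b / a; 1 / b; a / b].
have ufs : uniq fs.
  rewrite (perm_uniq (_ : perm_eq fs rts)) ?uniq_rts //.
  by rewrite /fs /rts 2!perm_cons; exact: (permEl (perm_catCA [:: 1 / a] [:: b / a] [:: 1 / b; a / b])).
move/negP: ij; apply; rewrite -(nth_uniq 0 _ _ ufs) //; apply/eqP.
by move: i j i6 j6 h => [|[|[|[|[|[|//]]]]]] [|[|[|[|[|[|//]]]]]] _ _ /=; apply: pt3_projeq1.
Qed.
End Theorem1.

Theorem theorem1 (t : rat) (ht1 : t != 1) (ht2 : t != 2)
  (L : splittingFieldType rat) (E : {subfield L})
  (hE : splittingFieldFor 1%VS (map_poly (in_alg L) (f_t t)) E)
  (alpha : L) (halphaE : alpha \in E)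
  (halpha : root (map_poly (in_alg L) (f_t t)) alpha) :
  let beta := beta_of t alpha in
  let rts := [:: alpha; beta; beta / alpha; 1 / alpha; 1 / beta; alpha / beta] in
  let S := six_pts alpha beta in
  (* (1) *)
  irreducible_poly (f_t t) /\
  (* (2) *)
  ((forall x, x \in E -> (root (map_poly (in_alg L) (f_t t)) x <-> x \in rts)) /\
   uniq rts /\
   (E = <<1; alpha>>%VS :> {vspace L}) /\
   galois 1 <<1; alpha>> /\ \dim <<1; alpha>> = 6%N /\
   ('Gal(E / 1) \isog [set: 'S_3])%g) /\
  (* (3) *)
  ((forall P, P \in S -> (forall i, P 0 i \in E) /\ onF5 P /\ nontrivial P) /\
   (forall i j, (i < 6)%N -> (j < 6)%N -> i != j -> ~ projeq (nth 0 S i) (nth 0 S j)) /\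
   (forall P, P \in S -> forall Q : 'rV[L]_3,
      (exists2 g, g \in 'Gal(E / 1)%g & projeq Q (gal_pt g P)) <->
      (exists2 R, R \in S & projeq Q R)) /\
   (forall P, P \in S -> forall Q : 'rV[L]_3,
      (exists s : 'S_3, projeq Q (perm_pt s P)) <->
      (exists2 R, R \in S & projeq Q R))).
Proof.
move=> beta rts S; have EE := splitting_adjoin ht1 ht2 hE halphaE halpha.
split; first by have [] := f_t_irr ht1 ht2 hE halphaE halpha.
split.
  split=> [x _|]; first by rewrite (root_f_t ht1 ht2 halpha).
  split; first exact (uniq_rts ht1 ht2 hE halphaE halpha).
  split=> //; rewrite -EE.
  split; first exact (galois_E hE).
  split; first exact (dim_six ht1 ht2 hE halphaE halpha).
  exact (galE_S3 ht1 ht2 hE halphaE halpha).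
split; first by move=> P PS; exact (six_pts_on ht1 ht2 halphaE halpha PS).
split; first by move=> i j hi hj hij; exact (six_pts_distinct ht1 ht2 hE halphaE halpha hi hj hij).
split=> P PS Q; first exact (gal_orbit ht1 ht2 hE halphaE halpha Q PS).
exact (perm_orbit ht1 ht2 halpha Q PS).
Qed.
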